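(* Fix a twisting parameter $\omega\in P^+$. Let $Z$ be a $\vert^{\mathrm{CG}}_\omega$-invariant function defined on a region $Y\subseteq\mathbb C^r$ satisfying Hypothesis (A) (stated in the context), such that $DZ$ is holomorphic on $Y$. Let $Z$ have Taylor series expansion at $\mathbf 0$ given by $\sum_{\lambda\in Q^+}a_\lambda\mathbf x^\lambda$. Then for $i=1,\dots,r$ and $j=r_{m_i}(\delta_i(\lambda))$ we have $$a_\lambda=\begin{cases}a_{\sigma_i\lambda+(l_i+1-m_i)\alpha_i}&\text{if }j=0,\\[4pt] g_{-jq(\alpha_i)}\,a_{\lambda+(j-m_i)\alpha_i}+a_{\sigma_i\lambda+(l_i+1-j)\alpha_i}-g_{-jq(\alpha_i)}\,a_{\sigma_i\lambda+(l_i+1-m_i)\alpha_i}&\text{if }j\ne0.\end{cases}$$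
   Context: Root data. $A$ is a symmetrizable generalized Cartan matrix of size $r$ with realization $(\mathfrak h,\Pi,\Pi^\vee)$, simple roots $\alpha_1,\dots,\alpha_r\in\mathfrak h^*$, simple coroots $h_1,\dots,h_r\in\mathfrak h$, Kac-Moody root system $\Phi$ with positive roots $\Phi^+$, and Weyl group $W\subset GL(\mathfrak h^* )$ generated by the simple reflections $\sigma_i$. Write $A=EB$ with $E$ diagonal and $B=(b_{ij})$ symmetric, normalized so that $b_{ij}\in\mathbb Z$, $b_{ii}\in2\mathbb Z$, $b_{ii}>0$; $\langle\cdot,\cdot\rangle$ is a non-degenerate symmetric $W$-invariant bilinear form on $\mathfrak h^*$ with $\langle\alpha_i,\alpha_j\rangle=b_{ij}$, $q(\alpha)=\frac12\langle\alpha,\alpha\rangle$ is the quadratic form (not the number $q$ below), and $\alpha_i^\vee=\alpha_i/q(\alpha_i)$, so $\lambda(h_i)=\langle\lambda,\alpha_i^\vee\rangle$. $Q=\bigoplus\mathbb Z\alpha_i$, $Q^+=\bigoplus\mathbb Z_{\ge0}\alpha_i$, $P^+=\{\lambda\in\mathfrak h^*\mid\langle\lambda,\alpha_i^\vee\rangle\in\mathbb Z_{\ge0}\ \forall i\}$. $\Phi^+_{\rm re}$ is the set of positive real roots. Parameters. Fix an integer $n\ge2$; $m_\alpha=n/\gcd(n,q(\alpha))$ for real roots $\alpha$, $m_i=m_{\alpha_i}$. Fix a real $q>1$ and complex numbers $g_t$ ($t\in\mathbb Z$) depending only on $t$ mod $n$, with $g_0=-1$ and $g_tg_{-t}=q$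 if $t\not\equiv0\bmod n$. $r_k(t)\in\{0,\dots,k-1\}$ is the remainder of $t$ modulo $k$. For $\lambda=\sum k_i\alpha_i\in Q$, $\mathbf x^\lambda=\prod x_i^{k_i}$. Coefficients $a_\lambda$ with $\lambda\in Q\setminus Q^+$ are $0$. Action. For $\omega\in P^+$ put $l_i=\langle\omega,\alpha_i^\vee\rangle$, $\delta_i(\lambda)=l_i+1-\langle\lambda,\alpha_i^\vee\rangle$. For $\mathbf x$ with $x_i\ne0$ let $\sigma_i\mathbf x$ have $k$-th coordinate $x_kx_i^{-\langle\alpha_k,\alpha_i^\vee\rangle}$; for an $m_i$-th root of unity $\eta$ let $\varepsilon_{i,\eta}\mathbf x$ have $k$-th coordinate $\eta^{\langle\alpha_k,\alpha_i^\vee\rangle}x_k$; let $f_i^{(j)}(\mathbf x)=\frac1{m_i}\sum_{\eta\in\mu_{m_i}}\eta^{j-l_i-1}f(\varepsilon_{i,\eta}\mathbf x)$ and $$f(\mathbf x)\vert^{\mathrm{CG}}_\omega\sigma_i=\frac{x_i^{l_i+1}}{1-qx_i^{m_i}}\sum_{0\le j\le m_i-1}f_i^{(j)}(\sigma_i\mathbf x)\big[x_i^{-j}(1-q)-(x_i^{-m_i}-1)g_{q(\alpha_i)j}\big].$$ $\vert^{\mathrm{CG}}_\omega$-invariant means $f\vert^{\mathrm{CG}}_\omega\sigma_i=f$ for all $i$. $D(\mathbf x;q)=\prod_{\alpha\in\Phi^+_{\rm re}}(1-q\mathbf x^{m_\alpha\alpha})$. Hypothesis (A). A $W$-invariant region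 $Y\subseteq\mathbb C^r$ satisfies Hypothesis (A) if for each $1\le j\le r$ there is a subset $Y_j\subseteq Y$ such that: $Y_j$ is an open connected Reinhardt domain containing $\mathbf 0$ (Reinhardt: stable under $(x_k)\mapsto(e^{i\theta_k}x_k)$ for all real $\theta_k$); the product $\prod_{\alpha\in\Phi^+_{\rm re}\setminus\{\alpha_j\}}(1-q\mathbf x^{m_\alpha\alpha})$ does not vanish on $Y_j$; and $Y_j$ is $\sigma_j$-invariant. Invariance of a set under $\sigma_i$ means $\sigma_i\mathbf x$ lies in the set for each point $\mathbf x$ of it with $x_i\neq0$. $Z$ is a meromorphic function on $Y$; the products are understood to converge where they are used. Such a $Z$ is holomorphic near $\mathbf 0$. *)

(* Defs.v *)
From HB Require Import structures.
From mathcomp Require Import all_boot all_order all_algebra finmap.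
From mathcomp Require Import all_classical all_reals all_analysis.
From mathcomp.analysis.showcase Require summability.
From mathcomp.real_closed Require Import complex.

Set Implicit Arguments.
Unset Strict Implicit.
Unset Printing Implicit Defensive.

Import Order.TTheory GRing.Theory Num.Theory.
Import numFieldNormedType.Exports.

Local Open Scope classical_set_scope.
Local Open Scope ring_scope.

(* The topological and normed structures of numFieldNormedType are found on
   the carrier of a numFieldType, not on [R[i]] itself, hence this alias. *)
Definition cplx (R : realType) : numClosedFieldType := R[i].

(* Unordered sums and products over the indices in S. The products are those
   of the factors 1 - u i, and "convergent" means absolutely convergent. *)
Section Unordered.
Variables (R : realType) (I : choiceType).
Implicit Types (S : set I) (u : I -> cplx R).

Definition abs_summable S u : Prop :=
  summable S (fun i => (complex.Re (`|u i| : R[i]))%:E).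

Definition usum S u : cplx R :=
  lim ((fun A : {fset I} => \sum_(i <- A | i \in S) u i)
         @ @summability.totally I).

Definition uprod1B S u : cplx R :=
  lim ((fun A : {fset I} => \prod_(i <- A | i \in S) (1 - u i))
         @ @summability.totally I).

End Unordered.

Section SeveralVariables.
Variables (R : realType) (r : nat).
Local Notation C := (cplx R).
Local Notation V := 'rV[C]_r.
Implicit Types (U Y : set V) (f g h Z : V -> C) (x : V).

Definition holomorphic_on U f : Prop :=
  open U /\ forall x, U x -> differentiable f x.

(* Equality of meromorphic functions on U. A meromorphic function is
   represented by a total function V -> C whose values on a closed nowhere
   dense subset, which contains the poles, are irrelevant. *)
Definition generically_eq U f g : Prop :=
  exists O : set V, [/\ open O, O `<=` U, U `<=` closure O &
    forall x, O x -> f x = g x].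

(* Local quotients of holomorphic functions g / h, where h does not vanish
   identically on any nonempty open subset of U. *)
Definition meromorphic_on Y Z : Prop :=
  open Y /\ forall p, Y p -> exists U g h,
    [/\ U p, U `<=` Y, holomorphic_on U g & holomorphic_on U h] /\
    U `<=` closure [set x | U x /\ h x != 0] /\
    generically_eq U Z (fun x => g x / h x).

Definition reinhardt U : Prop :=
  forall x (theta : 'I_r -> R), U x ->
    U (\row_k ((cos (theta k) +i* sin (theta k))%C * x 0 k)).

Definition mono x (lam : 'rV[int]_r) : C := \prod_k x 0 k ^ lam 0 k.

(* Elements of the root lattice are given by their coordinates in the basis
   of simple roots. *)
Definition Qplus : set 'rV[int]_r := [set lam | forall k, 0 <= lam 0 k].

Definition alphaQ (i : 'I_r) : 'rV[int]_r := delta_mx 0 i.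

(* The power series with coefficients a is the Taylor series at 0 of the
   meromorphic function Z on Y. *)
Definition taylor_at0 Y Z (a : 'rV[int]_r -> C) : Prop :=
  exists U, [/\ open U, U 0, U `<=` Y,
    forall x, U x -> abs_summable Qplus (fun lam => a lam * mono x lam) &
    generically_eq U Z (fun x => usum Qplus (fun lam => a lam * mono x lam))].

End SeveralVariables.

Arguments Qplus {r}.

Definition gcm (r : nat) (A : 'M[int]_r) : Prop :=
  [/\ forall i, A i i = 2,
      forall i j, i != j -> A i j <= 0 &
      forall i j, A i j = 0 -> A j i = 0].

Record realization (R : realType) (r : nat) (A : 'M[int]_r) := Realization {
  hh : vectType (cplx R);
  alpha : 'I_r -> 'Hom(hh, (cplx R)^o);
  hcoroot : 'I_r -> hh;
  alpha_free : free [seq alpha i | i <- enum 'I_r];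
  hcoroot_free : free [seq hcoroot i | i <- enum 'I_r];
  alphaE : forall i j, alpha j (hcoroot i) = (A i j)%:~R;
  dim_hh : (\dim {: hh} + \rank (map_mx intr A : 'M[rat]_r) = r.*2)%N
}.

Section Weyl.
Variables (R : realType) (r : nat) (A : 'M[int]_r) (H : realization R A).
Local Notation C := (cplx R).

Definition hdual := 'Hom(hh H, C^o).

Definition srefl (i : 'I_r) (lam : hdual) : hdual :=
  lam - (lam (hcoroot H i) : C) *: alpha H i.

(* The simple reflections are involutions, so words in them give all of W. *)
Definition weyl (w : seq 'I_r) (lam : hdual) : hdual := foldr srefl lam w.

Definition real_root (b : hdual) : Prop :=
  exists (w : seq 'I_r) (i : 'I_r), b = weyl w (alpha H i).

Definition ofQ (lam : 'rV[int]_r) : hdual :=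
  \sum_k ((lam 0 k)%:~R : C) *: alpha H k.

Definition pos_real_roots : set 'rV[int]_r :=
  [set b | Qplus b /\ real_root (ofQ b)].

End Weyl.

Record root_datum (R : realType) (r : nat) := RootDatum {
  cartan : 'M[int]_r;
  cartan_gcm : gcm cartan;
  rlz :> realization R cartan;
  matB : 'M[int]_r;
  diagE : 'rV[rat]_r;
  cartanE : map_mx intr cartan = diag_mx diagE *m map_mx intr matB;
  matB_sym : matB^T = matB;
  matB_even : forall i, (2 %| matB i i)%Z;
  matB_gt0 : forall i, 0 < matB i i;
  bform : hdual rlz -> hdual rlz -> cplx R;
  bform_linear : forall c x y z, bform (c *: x + y) z = c * bform x z + bform y z;
  bform_sym : forall x y, bform x y = bform y x;
  bform_nondeg : forall x, (forall y, bform x y = 0) -> x = 0;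
  bform_weyl : forall w x y, bform (weyl w x) (weyl w y) = bform x y;
  bform_alpha : forall i j, bform (alpha rlz i) (alpha rlz j) = (matB i j)%:~R
}.

Arguments bform {R r} _ _ _.

Section RootDatum.
Variables (R : realType) (r : nat) (D : root_datum R r).
Local Notation C := (cplx R).
Implicit Types (i : 'I_r) (lam : 'rV[int]_r).

Definition qform (b : hdual D) : C := bform D b b / 2.

Definition alphav i : hdual D := (qform (alpha D i))^-1 *: alpha D i.

Definition pairing (x : hdual D) i : C := bform D x (alphav i).

(* Integral versions on the root lattice of the pairing, of the quadratic form
   and of the simple reflections; see the lemmas that follow them. *)
Definition pairQ lam i : int := \sum_k lam 0 k * cartan D i k.

Definition qQ lam : int :=
  ((\sum_k \sum_l lam 0 k * lam 0 l * matB D k l) %/ 2)%Z.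

Definition sreflQ i lam : 'rV[int]_r := lam - pairQ lam i *: alphaQ i.

Lemma bformZr c x z : bform D z (c *: x) = c * bform D z x.
Proof.
have b0 : bform D z 0 = 0.
  have := bform_linear 1 (0 : hdual D) 0 z.
  rewrite scaler0 addr0 mul1r => /eqP.
  by rewrite -subr_eq subrr eq_sym bform_sym => /eqP.
by rewrite bform_sym -[c *: x]addr0 bform_linear !(bform_sym _ z) b0 addr0.
Qed.

Lemma bformDr x y z : bform D z (x + y) = bform D z x + bform D z y.
Proof.
by rewrite bform_sym -[x]scale1r bform_linear mul1r scale1r !(bform_sym _ z).
Qed.

Lemma bform_ofQr lam z :
  bform D z (ofQ D lam) = \sum_k (lam 0 k)%:~R * bform D z (alpha D k).
Proof.
rewrite /ofQ; elim/big_ind2: _ => [|x1 x2 y1 y2 <- <-|k _].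
- by rewrite -(scale0r (0 : hdual D)) bformZr mul0r.
- by rewrite bformDr.
- by rewrite bformZr.
Qed.

Lemma matB_neq0 i : ((matB D i i)%:~R : C) != 0.
Proof. by rewrite intr_eq0 gt_eqF ?matB_gt0. Qed.

Lemma alpha_hcoroot i : (alpha D i (hcoroot D i) : C) = 2.
Proof. by rewrite alphaE; case: (cartan_gcm D) => -> _ _. Qed.

Lemma srefl_alpha i : srefl i (alpha D i) = - alpha D i.
Proof.
have -> : - alpha D i = (1 - 2 : C) *: alpha D i.
  by rewrite -[2]/(1 + 1) opprD addrA subrr add0r scaleN1r.
by rewrite scalerBl scale1r /srefl alpha_hcoroot.
Qed.

Lemma pairingE (x : hdual D) i : pairing x i = x (hcoroot D i).
Proof.
rewrite /pairing /alphav bformZr /qform bform_alpha.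
set b := (matB D i i)%:~R; set c : C := x (hcoroot D i).
have := bform_weyl [:: i] x (alpha D i); rewrite /= srefl_alpha.
rewrite -scaleN1r bformZr /srefl -/c -scaleNr bform_sym bformDr bformZr.
rewrite bform_alpha -/b (bform_sym (alpha D i)) => e.
have {}e : c * b = 2 * bform D x (alpha D i).
  by rewrite mulr_natl mulr2n -{1}e mulN1r mulNr opprD opprK addrAC addNr add0r.
apply: (mulIf (matB_neq0 i)); rewrite -/b e invf_div mulrAC.
by rewrite divfK ?matB_neq0.
Qed.

Lemma pairing_ofQ lam i : pairing (ofQ D lam) i = (pairQ lam i)%:~R.
Proof.
rewrite pairingE /ofQ sum_lfunE rmorph_sum; apply: eq_bigr => k _.
by rewrite scale_lfunE alphaE rmorphM.
Qed.

Lemma ofQ_sreflQ i lam : ofQ D (sreflQ i lam) = srefl i (ofQ D lam).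
Proof.
rewrite /srefl -pairingE pairing_ofQ /sreflQ.
have -> : alpha D i = ofQ D (alphaQ i).
  rewrite /ofQ (bigD1 i) //= mxE !eqxx scale1r big1 ?addr0 // => k ki.
  by rewrite mxE eqxx /= (negbTE ki) scale0r.
rewrite /ofQ scaler_sumr -sumrB; apply: eq_bigr => k _.
by rewrite !mxE scalerA -scalerBl rmorphB /= rmorphM.
Qed.

Lemma matBC k l : matB D l k = matB D k l.
Proof. by rewrite -{1}[matB D]matB_sym mxE. Qed.

Lemma dvdz_sum_sym m (F : 'I_m -> 'I_m -> int) :
    (forall k l, F k l = F l k) -> (forall k, (2 %| F k k)%Z) ->
  (2 %| \sum_k \sum_l F k l)%Z.
Proof.
elim: m F => [|m IH] F Fs Fd; first by rewrite big_ord0.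
rewrite big_ord_recr /=; under eq_bigr do rewrite big_ord_recr /=.
rewrite big_split big_ord_recr /= addrA rpredD // -addrA rpredD //; first exact: IH.
under [X in _ + X]eq_bigr do rewrite Fs.
by apply/dvdzP; eexists; rewrite mulr_natr -mulr2n.
Qed.

Lemma qform_ofQ lam : qform (ofQ D lam) = (qQ lam)%:~R.
Proof.
rewrite /qform /qQ.
set s := \sum_k \sum_l _.
have es : bform D (ofQ D lam) (ofQ D lam) = s%:~R.
  rewrite bform_ofQr rmorph_sum; apply: eq_bigr => k _.
  rewrite bform_sym bform_ofQr rmorph_sum mulr_sumr; apply: eq_bigr => l _.
  by rewrite bform_alpha !rmorphM mulrA.
have ds : (2 %| s)%Z.
  apply: dvdz_sum_sym => [k l|k]; last by rewrite dvdz_mull ?matB_even.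
  by rewrite matBC [lam 0 k * _]mulrC.
have e2 : (2 : C) != 0 by rewrite pnatr_eq0.
by apply: (mulIf e2); rewrite divfK // es -{1}(divzK ds) rmorphM.
Qed.

End RootDatum.

(* n, g and q are the parameters of the same names, l i stands for
   <omega, alpha_i^vee>. *)
Section ChintaGunnells.
Variables (R : realType) (r : nat) (D : root_datum R r) (n : nat) (q : R).
Variables (g : int -> cplx R) (l : 'I_r -> nat).
Local Notation C := (cplx R).
Local Notation V := 'rV[C]_r.
Local Notation qC := (q%:C%C : C).
Implicit Types (i : 'I_r) (lam b : 'rV[int]_r) (x : V) (Y : set V) (f Z : V -> C).

Definition mult b : nat := (n %/ gcdn n `|qQ D b|)%N.

Definition multi i : nat := mult (alphaQ i).

Definition delta i lam : int := (l i)%:Z + 1 - pairQ D lam i.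

Definition sigma_pt i x : V := \row_k (x 0 k * x 0 i ^ (- pairQ D (alphaQ k) i)).

Definition eps_pt i (eta : C) x : V :=
  \row_k (eta ^ pairQ D (alphaQ k) i * x 0 k).

Definition unity_roots (m : nat) : set C := [set eta | eta ^+ m = 1].

Definition fpart i (j : nat) f x : C :=
  ((multi i)%:R)^-1 *
  \sum_(eta \in unity_roots (multi i))
    eta ^ (j%:Z - (l i)%:Z - 1) * f (eps_pt i eta x).

Definition cg_act i f x : C :=
  x 0 i ^+ (l i).+1 / (1 - qC * x 0 i ^+ multi i) *
  \sum_(j < multi i) fpart i j f (sigma_pt i x) *
    (x 0 i ^- j * (1 - qC)
       - (x 0 i ^- multi i - 1) * g (qQ D (alphaQ i) * j%:Z)).

(* The points of Y at which both f and [cg_act i f] are given by values of f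
   at points of Y. *)
Definition cg_domain Y i : set V :=
  [set x | [/\ Y x, x 0 i != 0 &
     forall eta, unity_roots (multi i) eta -> Y (eps_pt i eta (sigma_pt i x))]].

Definition cg_invariant Y Z : Prop :=
  forall i, generically_eq (cg_domain Y i) (cg_act i Z) Z.

Definition root_term x b : C := qC * mono x ((mult b)%:Z *: b).

Definition root_prod (S : set 'rV[int]_r) x : C := uprod1B S (root_term x).

Definition root_prod_cvg (S : set 'rV[int]_r) x : Prop :=
  abs_summable S (root_term x).

Definition sigma_invariant i Y : Prop :=
  forall x, Y x -> x 0 i != 0 -> Y (sigma_pt i x).

(* The region Y, its W-invariance included. *)
Definition hypothesis_A Y : Prop :=
  [/\ open Y, connected Y, forall i, sigma_invariant i Y &
  forall j, exists Yj : set V,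
    [/\ Yj `<=` Y, [/\ open Yj, connected Yj, reinhardt Yj & Yj 0],
      forall x, Yj x ->
        let S := pos_real_roots D `\ alphaQ j in
        root_prod_cvg S x /\ root_prod S x != 0 &
      sigma_invariant j Yj]].

(* D Z is holomorphic on Y, as an equality of meromorphic functions. *)
Definition DZ_holomorphic Y Z : Prop :=
  (forall x, Y x -> root_prod_cvg (pos_real_roots D) x) /\
  exists F : V -> C, holomorphic_on Y F /\
    generically_eq Y (fun x => root_prod (pos_real_roots D) x * Z x) F.

End ChintaGunnells.

(* Main.v *)
(** Fix [i], put [m = m_i], and let [a] be the Taylor coefficients of [Z].  On
    [Y_i] the function [G = (1 - q x_i ^ m) Z] extends continuously and is
    locally a uniform limit of holomorphic functions, being [D Z] divided by the
    nonvanishing product over the real roots other than [alpha_i].  Its Laurent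
    coefficients on the tori in [Y_i] are limits of averages over grids of roots
    of unity; by Goursat's bisection argument and the connectedness of [Y_i] they
    do not depend on the torus, so they are
    [b lambda = a lambda - q a (lambda - m alpha_i)].  The grids of order
    [m 2 ^ n] are permuted by [sigma_i] and by the [eps_(i, eta)], so averaging
    the functional equation of [Z] over them relates values of [b] at [lambda] and
    at [sigma_i lambda].  Moreover [b (lambda + k m alpha_i)] is [O((2 q) ^ -k)],
    because [Y_i] contains tori with [|x_i|] arbitrarily large, namely the
    [sigma_i]-images of those with [|x_i|] small.

    Along the line [lambda + Z m alpha_i], the defect [T] of the claimed identity
    is antisymmetric and satisfies a recurrence of order two with characteristic
    roots [q] and [1 / q].  Decay of [b] excludes the root [1 / q], antisymmetry
    then excludes [q], and [T = 0]. *)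

Require Import Defs.
From mathcomp Require Import all_boot all_order all_algebra finmap.
From mathcomp Require Import all_classical all_reals all_analysis.
From mathcomp.analysis.showcase Require summability.
From mathcomp.real_closed Require Import complex.
From mathcomp Require Import ring lra zify.

Set Implicit Arguments.
Unset Strict Implicit.
Unset Printing Implicit Defensive.

Import Order.TTheory GRing.Theory Num.Theory.
Import numFieldNormedType.Exports.

Local Open Scope classical_set_scope.
Local Open Scope ring_scope.

(** The functional equation exchanges tori with [|x_i|] small and tori with [|x_i|] large, and the
    poles of [Z] along [q x_i ^ m = 1] lie between them. The Laurent coefficients of [Z] could
    differ on the two sides; clearing this one factor makes those of [G] comparable. Equations
    between meromorphic functions hold only on dense open sets, and a torus may miss such a set
    altogether. The continuity of [G] extends them to every point where they are averaged. Averages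
    over finite grids take the place of contour integrals. In the order [m 2 ^ n] the factor [m]
    puts the [m]-th roots of unity on the grid, and the power of two lets the grid be halved as
    often as bisection demands. Averages are stable under uniform approximation, so the infinite
    product enters through its finite partial products, which are polynomials. *)

Section ComplexModulus.
Variable R : realType.
Local Notation C := (cplx R).
Implicit Types z w : C.

(** Real-valued modulus: suprema and linear arithmetic live in [R], whereas the norm of [z] is
    itself an element of [C]. *)
Definition modc z : R := complex.Re (`|z| : R[i]).

Lemma normc_modc z : `|z| = ((modc z)%:C)%C.
Proof. by rewrite /modc /Num.norm /=. Qed.

Lemma modc_ge0 z : 0 <= modc z.
Proof. by rewrite -lecR -normc_modc normr_ge0. Qed.

Lemma ler_modc z (x : R) : (modc z <= x) = (`|z| <= (x%:C)%C).
Proof. by rewrite normc_modc lecR. Qed.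

Lemma ltr_modc z (x : R) : (modc z < x) = (`|z| < (x%:C)%C).
Proof. by rewrite normc_modc ltcR. Qed.

Lemma modcM z w : modc (z * w) = modc z * modc w.
Proof. by apply: (@complexI R); rewrite -normc_modc normrM !normc_modc -rmorphM. Qed.

Lemma modcD z w : modc (z + w) <= modc z + modc w.
Proof. by rewrite ler_modc rmorphD /= -!normc_modc ler_normD. Qed.

Lemma modcN z : modc (- z) = modc z.
Proof. by rewrite /modc normrN. Qed.

Lemma modcB z w : modc (z - w) = modc (w - z).
Proof. by rewrite /modc distrC. Qed.

Lemma modc0 : modc 0 = 0.
Proof. by rewrite /modc normr0. Qed.

Lemma modc1 : modc 1 = 1.
Proof. by rewrite /modc normr1. Qed.

Lemma modc_eq0 z : (modc z == 0) = (z == 0).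
Proof.
rewrite -[RHS]normr_eq0 normc_modc.
by apply/eqP/eqP => [->//|[]].
Qed.

Lemma modc_gt0 z : (0 < modc z) = (z != 0).
Proof. by rewrite lt_def modc_ge0 andbT modc_eq0. Qed.

Lemma modcX z n : modc (z ^+ n) = modc z ^+ n.
Proof. by elim: n => [|n IH]; rewrite ?expr0 ?modc1 // !exprS modcM IH. Qed.

Lemma modcV z : modc z^-1 = (modc z)^-1.
Proof.
have [->|z0] := eqVneq z 0; first by rewrite invr0 modc0 invr0.
apply: (mulfI (x := modc z)); first by rewrite modc_eq0.
by rewrite -modcM divff // modc1 divff // modc_eq0.
Qed.

Lemma modc_real (x : R) : modc (x%:C)%C = `|x|.
Proof. by rewrite /modc normc_def /= expr0n addr0 sqrtr_sqr. Qed.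

Lemma modc_exprz z (k : int) : modc (z ^ k) = modc z ^ k.
Proof.
by case: k => k; rewrite /exprz ?modcV modcX.
Qed.

Lemma modc_prod (I : Type) (s : seq I) (P : pred I) (F : I -> C) :
  modc (\prod_(i <- s | P i) F i) = \prod_(i <- s | P i) modc (F i).
Proof. by apply: (big_morph modc); [exact: modcM | exact: modc1]. Qed.

Lemma modc_sum (I : Type) (s : seq I) (P : pred I) (F : I -> C) :
  modc (\sum_(i <- s | P i) F i) <= \sum_(i <- s | P i) modc (F i).
Proof.
elim/big_ind2: _ => [||//]; first by rewrite modc0.
by move=> x1 x2 y1 y2 h1 h2; rewrite (le_trans (modcD _ _)) // lerD.
Qed.

Lemma modc_ReIm z : modc z <= `|complex.Re z| + `|complex.Im z|.
Proof.
rewrite [z in modc z]complexE (le_trans (modcD _ _)) // modcM !modc_real.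
by rewrite /modc normc_def /= expr0n add0r expr1n sqrtr1 mul1r.
Qed.

Lemma Re_le_modc z : `|complex.Re z| <= modc z.
Proof.
rewrite /modc normc_def /= -sqrtr_sqr ler_wsqrtr // lerDl sqr_ge0 //.
Qed.

Lemma Im_le_modc z : `|complex.Im z| <= modc z.
Proof.
by rewrite /modc normc_def /= -sqrtr_sqr ler_wsqrtr // lerDr sqr_ge0.
Qed.

Lemma complex_gt0 z : 0 < z -> exists2 x : R, 0 < x & z = (x%:C)%C.
Proof.
move=> z0; exists (complex.Re z).
  by move: z0; rewrite ltcE /= => /andP[].
by have := gtr0_real z0 => /RRe_real ->.
Qed.

Lemma cvg_modcP (T : Type) (F : set_system T) (FF : Filter F) (u : T -> C) z :
  u @ F --> z <->
  forall e : R, 0 < e -> \forall t \near F, modc (u t - z) <= e.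
Proof.
split=> [/cvgrPdist_le h e e0|h].
  have := h (e%:C)%C; rewrite ltcR => /(_ e0); apply: filterS => t.
  by rewrite ler_modc -normrN opprB.
apply/cvgrPdist_le => _ /complex_gt0[e e0 ->].
by apply: filterS (h e e0) => t; rewrite ler_modc -normrN opprB.
Qed.

End ComplexModulus.

(** * The unit circle, the complex exponential and roots of unity *)

Section UnitCircle.
Variable R : realType.
Local Notation C := (cplx R).
Implicit Types (s t x y e : R).

Definition cis t : C := (cos t +i* sin t)%C.

Lemma cisD s t : cis (s + t) = cis s * cis t.
Proof.
rewrite /cis cosD sinD; apply/eqP; rewrite eq_complex /=.
by rewrite eqxx /= addrC mulrC [sin t * _]mulrC addrC mulrC.
Qed.

Lemma cis0 : cis 0 = 1.
Proof. by rewrite /cis cos0 sin0. Qed.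

Lemma modc_cis t : modc (cis t) = 1.
Proof. by rewrite /modc normc_def /= cos2Dsin2 sqrtr1. Qed.

Lemma cis_neq0 t : cis t != 0.
Proof. by rewrite -modc_gt0 modc_cis. Qed.

Lemma cisN t : cis (- t) = (cis t)^-1.
Proof.
by apply: (mulfI (cis_neq0 t)); rewrite -cisD subrr cis0 divff ?cis_neq0.
Qed.

Lemma cisMn t n : cis (n%:R * t) = cis t ^+ n.
Proof.
elim: n => [|n IH]; first by rewrite mul0r cis0 expr0.
by rewrite -natr1 mulrDl mul1r cisD IH exprSr.
Qed.

Lemma cisMz t (k : int) : cis (k%:~R * t) = cis t ^ k.
Proof.
case: k => n; first by rewrite -pmulrn cisMn.
by rewrite NegzE mulrNz mulNr cisN -pmulrn cisMn.
Qed.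

Lemma cis2pi : cis (2 * pi) = 1.
Proof. by rewrite /cis mulr_natl cos2pi sin2pi. Qed.

Lemma cis_neq1 t : 0 < t < 2 * pi -> cis t != 1.
Proof.
move=> /andP[t0 tpi]; rewrite eq_complex /= negb_and; apply/orP; left.
have -> : t = (t / 2) *+ 2 by rewrite -mulr_natr divfK.
have := @sin_gt0_pi R (t / 2); rewrite divr_gt0 //= ltr_pdivrMr // mulrC => /(_ tpi).
(* Half-angle formula: [cos t = 1 - 2 sin (t / 2) ^ 2], and the sine is positive at [t / 2]. *)
rewrite cos_mulr2n cos2sin2 => s0; apply/eqP => /= h.
have := exprn_gt0 2 s0; lra.
Qed.

Lemma is_derive_estimate (f : R -> R) (d e : R) : is_derive (0 : R) 1 f d ->
  0 < e -> exists2 del : R, 0 < del &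
    forall h, `|h| < del -> `|f h - f 0 - h * d| <= e * `|h|.
Proof.
move=> [df fd] e0.
have : (fun h => h^-1 *: (f (h *: 1 + 0) - f 0)) @ 0^' --> d.
  by rewrite -fd; exact: df.
move=> /cvgrPdist_le /(_ e e0) hn.
have {hn} /nbhs_ballP[del /= del0 hd] : nbhs (0 : R)
    (fun h => h != 0 -> `|d - h^-1 *: (f (h *: 1 + 0) - f 0)| <= e) by exact: hn.
exists del => // h hdel.
have [->|h0] := eqVneq h 0; first by rewrite subrr mul0r subrr !normr0 mulr0.
have := hd h; rewrite /ball /= sub0r normrN => /(_ hdel h0).
rewrite /GRing.scale /= mulr1 addr0 => hh.
have -> : f h - f 0 - h * d = - h * (d - h^-1 * (f h - f 0)).
  by field.
by rewrite normrM normrN mulrC ler_wpM2r.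
Qed.

Definition cexp2 x y : C := (expR x)%:C%C * cis y.

Lemma cexp2D x y x' y' : cexp2 (x + x') (y + y') = cexp2 x y * cexp2 x' y'.
Proof. by rewrite /cexp2 expRD cisD rmorphM /= mulrACA. Qed.

(** The complex derivative of the exponential at 0, assembled from the real derivatives of [expR],
    [cos] and [sin]. It is what makes logarithmic polar coordinates satisfy the Cauchy-Riemann
    equations below. *)
Lemma cexp2_estimate e : 0 < e -> exists2 del : R, 0 < del &
  forall x y, `|x| < del -> `|y| < del ->
    modc (cexp2 x y - 1 - (x +i* y)%C) <= e * (`|x| + `|y|).
Proof.
move=> e0.
have e4 : 0 < e / 4 by lra.
have [d1 d10 h1] := is_derive_estimate (is_derive_expR 0) e4.
have [d2 d20 h2] := is_derive_estimate (is_derive_cos 0) e4.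
have [d3 d30 h3] := is_derive_estimate (is_derive_sin 0) e4.
exists (Num.min (Num.min d1 d2) (Num.min d3 (Num.min 1 (e / 4)))).
  by rewrite !lt_min d10 d20 d30 ltr01 e4.
move=> x y; rewrite !lt_min => /andP[/andP[x1 _] /andP[_ /andP[x4 x5]]].
move=> /andP[/andP[_ y2] /andP[y3 /andP[y4 y5]]].
have {}h1 : `|expR x - 1 - x| <= e / 4 * `|x|.
  by have := h1 x x1; rewrite expR0 mulr1.
have {}h2 : `|cos y - 1| <= e / 4 * `|y|.
  by have := h2 y y2; rewrite cos0 sin0 oppr0 mulr0 subr0.
have {}h3 : `|sin y - y| <= e / 4 * `|y|.
  by have := h3 y y3; rewrite cos0 sin0 subr0 mulr1.
(* Three errors: that of [expR], that of [cis] weighted by [1 + x], and the cross term [i x y],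
   which is small because [|y| < e / 4]. *)
have -> : cexp2 x y - 1 - (x +i* y)%C =
    ((expR x - 1 - x)%:C%C * cis y +
    (1 + x)%:C%C * ((cos y - 1) +i* (sin y - y))%C) + (0 +i* (x * y))%C.
  apply/eqP; rewrite /cexp2 /cis eq_complex /=; apply/andP; split; apply/eqP; ring.
have x2 : `|1 + x| <= 2 by rewrite (le_trans (ler_normD _ _)) // normr1; lra.
have c2 : modc ((cos y - 1) +i* (sin y - y))%C <= e / 4 * `|y| + e / 4 * `|y|.
  by rewrite (le_trans (modc_ReIm _)) //= lerD.
have c3 : modc (0 +i* (x * y))%C <= `|x| * `|y|.
  by rewrite (le_trans (modc_ReIm _)) //= normr0 add0r normrM.
have c1 : modc ((expR x - 1 - x)%:C%C * cis y) <= e / 4 * `|x|.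
  by rewrite modcM modc_cis mulr1 modc_real.
have c2' : modc ((1 + x)%:C%C * ((cos y - 1) +i* (sin y - y))%C) <=
    2 * (e / 4 * `|y| + e / 4 * `|y|).
  by rewrite modcM modc_real; apply: ler_pM => //; exact: modc_ge0.
have xy : `|x| * `|y| <= `|x| * (e / 4) by rewrite ler_wpM2l // ltW.
rewrite (le_trans (modcD _ _)) //.
have := modcD ((expR x - 1 - x)%:C%C * cis y)
  ((1 + x)%:C%C * ((cos y - 1) +i* (sin y - y))%C).
have := normr_ge0 x; have := normr_ge0 y; have : 0 <= e / 4 * `|x| by rewrite mulr_ge0 // ltW.
move: c1 c2' c3 xy; nra.
Qed.

Lemma prim_root_cis m : (0 < m)%N -> m.-primitive_root (cis (2 * pi / m%:R)).
Proof.
move=> m0; rewrite /primitive_root_of_unity m0 /=; apply/forallP => k; apply/eqP.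
have mR : (0 : R) < m%:R by rewrite ltr0n.
rewrite unity_rootE -cisMn.
have [->|kn] := eqVneq k.+1 m.
  by rewrite mulrC divfK ?cis2pi ?eqxx // gt_eqF.
apply/negbTE/cis_neq1; have km : (k.+1 < m)%N by rewrite ltn_neqAle kn ltn_ord.
have p0 := @pi_gt0 R.
rewrite mulr_gt0 ?ltr0n //= ?divr_gt0 ?mulr_gt0 //.
by rewrite mulrCA -[ltRHS]mulr1 ltr_pM2l ?mulr_gt0 // ltr_pdivrMr // mul1r ltr_nat.
Qed.

Lemma sum_unity_roots m (f : C -> C) : (0 < m)%N ->
  \sum_(eta \in unity_roots m) f eta =
  \sum_(k < m) f (cis (2 * pi / m%:R) ^+ k).
Proof.
move=> m0; have zP := prim_root_cis m0; set z := cis _ in zP *.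
rewrite (fsbigE [seq z ^+ (k : 'I_m) | k <- index_enum 'I_m]); first last.
- move=> eta /(prim_rootP zP)[k ->] /negP[]; apply: map_f.
  by rewrite mem_index_enum.
- move=> _ /= /mapP[k _ ->]; rewrite /unity_roots /= -exprM mulnC exprM.
  by rewrite (prim_expr_order zP) expr1n.
- rewrite map_inj_uniq ?index_enum_uniq // => k1 k2 /eqP.
  by rewrite (eq_prim_root_expr zP) !modn_small // => /eqP /val_inj.
rewrite big_map; apply: eq_bigl => k; apply/mem_set; rewrite /unity_roots /= -exprM mulnC.
by rewrite exprM (prim_expr_order zP) expr1n.
Qed.

(** Orthogonality of the characters of Z/N: either every term is 1, or the sum is geometric with a
    ratio other than 1 whose [N]-th power is 1. *)
Lemma sum_cis_exprz N (k : int) : (0 < N)%N ->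
  \sum_(j < N) cis (2 * pi / N%:R) ^ (k * j%:Z) = if (N %| k)%Z then N%:R else 0.
Proof.
move=> N0; have zP := prim_root_cis N0; set z := cis _ in zP *.
have z0 : z != 0 by exact: cis_neq0.
under eq_bigr => j _ do rewrite -exprz_exp -exprnP.
have [r kr] : exists r : nat, (k %% N)%Z = r.
  by exists `|(k %% N)%Z|%N; rewrite gez0_abs // modz_ge0 // -lt0n.
have zk : z ^ k = z ^+ r.
  rewrite {1}(divz_eq k N) kr expfzDr // [(_ %/ _)%Z * _]mulrC -exprz_exp -exprnP.
  by rewrite (prim_expr_order zP) exp1rz mul1r.
have rN : (r < N)%N by rewrite -ltz_nat -kr ltz_pmod.
have k1 : (z ^ k == 1) = (N %| k)%Z.
  rewrite zk -(prim_order_dvd zP); apply/idP/idP => [|/dvdz_mod0P].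
    rewrite /dvdn modn_small // => /eqP r0.
    by apply/dvdz_mod0P; rewrite kr r0.
  by rewrite kr => -[->]; rewrite dvdn0.
rewrite -k1; have [->|zk1] := eqVneq (z ^ k) 1.
  by under eq_bigr do rewrite expr1n; rewrite sumr_const card_ord.
have := subrX1 (z ^ k) N; rewrite exprnP exprz_exp mulrC -exprz_exp.
rewrite -exprnP (prim_expr_order zP) exp1rz subrr => /esym/eqP.
by rewrite mulf_eq0 subr_eq0 (negbTE zk1) => /eqP.
Qed.

End UnitCircle.

(** * Dyadic bisection of the unit box and compactness *)

Section Bisection.
Variables (R : realType) (I : finType).

Definition dyadic_cell (m : nat) (b : I -> nat) : set (I -> R) :=
  [set v | forall k, (b k)%:R <= v k * 2 ^+ m <= (b k).+1%:R].

(** Nested intervals, halved in all coordinates at once: every bad cell has a bad child, and the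
    limit point is the supremum of the lower corners. *)
Lemma dyadic_bisection (bad : nat -> (I -> nat) -> Prop) :
    bad 0%N (fun=> 0%N) ->
    (forall m b, bad m b ->
      exists c : {ffun I -> bool}, bad m.+1 (fun k => (c k + (b k).*2)%N)) ->
  exists2 p : I -> R, (forall k, 0 <= p k <= 1) &
    forall m, exists b, [/\ bad m b, forall k, (b k < 2 ^ m)%N &
      dyadic_cell m b p].
Proof.
move=> bad0 badS.
have [c hc] : {c : nat * (I -> nat) -> {ffun I -> bool} &
    forall mb, bad mb.1 mb.2 -> bad mb.1.+1 (fun k => (c mb k + (mb.2 k).*2)%N)}.
  apply: (choice (P := fun mb (c : {ffun I -> bool}) => bad mb.1 mb.2 ->
    bad mb.1.+1 (fun k => (c k + (mb.2 k).*2)%N))) => -[m b] /=.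
  have [/badS[c hc]|nb] := pselect (bad m b); first by exists c.
  (* A default: the choice does not matter on cells that are not bad. *)
  by exists [ffun=> true].
pose bb := fix bb m : I -> nat :=
  if m is m'.+1 then fun k => (c (m', bb m') k + (bb m' k).*2)%N else fun=> 0%N.
have badb m : bad m (bb m) by elim: m => //= m /(hc (m, bb m)).
have bblt m k : (bb m k < 2 ^ m)%N.
  elim: m => //= m IH; rewrite expnS mul2n.
  by case: (c _ _); rewrite ?add1n ?add0n ?ltn_Sdouble ?ltn_double.
pose lo m k : R := (bb m k)%:R / 2 ^+ m.
pose hi m k : R := (bb m k).+1%:R / 2 ^+ m.
have p2 m : (0 : R) < 2 ^+ m by rewrite exprn_gt0.
have loS m k : lo m k <= lo m.+1 k.
  rewrite /lo exprS invfM mulrA ler_pM2r ?invr_gt0 // ler_pdivlMr //=.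
  by rewrite -natrM ler_nat -muln2 leq_addl.
have hiS m k : hi m.+1 k <= hi m k.
  rewrite /hi exprS invfM mulrA ler_pM2r ?invr_gt0 // ler_pdivrMr //=.
  rewrite -natrM ler_nat.
  by case: (c _ _); rewrite -?muln2; lia.
(* The two corners are compared at the common level [m + n]. *)
have lohi m n k : lo m k <= hi n k.
  have lo' m' l : lo m' k <= lo (m' + l)%N k.
    by elim: l => [|l IH]; rewrite ?addn0 // addnS (le_trans IH).
  have hi' m' l : hi (m' + l)%N k <= hi m' k.
    by elim: l => [|l IH]; rewrite ?addn0 // addnS (le_trans (hiS _ _)).
  apply: (le_trans (lo' m n)); apply: le_trans (hi' n m).
  by rewrite addnC /lo /hi ler_pM2r ?invr_gt0 // ler_nat.
pose p k : R := sup (range (fun m => lo m k)).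
have hs k : has_sup (range (fun m => lo m k)).
  split; first by exists (lo 0%N k); exists 0%N.
  by exists (hi 0%N k) => _ [m _ <-].
have lop m k : lo m k <= p k.
  by apply: sup_upper_bound => //; exists m.
have php m k : p k <= hi m k.
  by apply: ge_sup => [|_ [n _ <-] //]; exists (lo 0%N k); exists 0%N.
exists p => [k|m].
  have := lop 0%N k; have := php 0%N k; rewrite /lo /hi /= expr0 !divr1.
  by move=> -> ->.
exists (bb m); split => // k.
apply/andP; split; first by rewrite -ler_pdivrMr //; exact: lop.
by rewrite -ler_pdivlMr //; exact: php.
Qed.

Definition unit_box : set (I -> R) := [set v | forall k, 0 <= v k <= 1].

Lemma dyadic_cell_unit m b v : (forall k, (b k < 2 ^ m)%N) ->
  dyadic_cell m b v -> unit_box v.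
Proof.
move=> hb hv k; have /andP[h1 h2] := hv k.
have p2 : (0 : R) < 2 ^+ m by rewrite exprn_gt0.
rewrite -(pmulr_lge0 _ p2) (le_trans _ h1) //=.
rewrite -(ler_pM2r p2) mul1r (le_trans h2) // -natrX ler_nat.
exact: hb.
Qed.

Lemma dyadic_cell_close m b p v k :
  dyadic_cell m b p -> dyadic_cell m b v -> `|v k - p k| <= (2 ^+ m)^-1.
Proof.
move=> /(_ k)/andP[p1 p2'] /(_ k)/andP[v1 v2].
have p2 : (0 : R) < 2 ^+ m by rewrite exprn_gt0.
rewrite -(ler_pM2r p2) mulVf ?gt_eqF // -{1}(gtr0_norm p2) -normrM mulrBl.
rewrite ler_norml; rewrite -addn1 natrD in p2' v2.
by apply/andP; split; lra.
Qed.

Lemma exp2_small (e : R) : 0 < e -> exists m, (2 ^+ m)^-1 <= e.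
Proof.
move=> e0; exists (Num.truncn e^-1).+1.
rewrite -[leRHS]invrK lef_pV2 ?posrE ?exprn_gt0 ?invr_gt0 //.
have /andP[_ h] := truncn_itv (x := e^-1) (ltW (eqbRL (invr_gt0 _) e0)).
rewrite (le_trans (ltW h)) // -natrX ler_nat.
by apply: ltnW; apply: ltn_expl.
Qed.

(** Compactness by bisection: if [h] is unbounded on a cell then it is so on some child, which the
    local bound at the limit point contradicts. *)
Lemma locally_bounded_box (h : (I -> R) -> cplx R) :
    (forall p, unit_box p -> exists2 del : R, 0 < del & exists M : R,
      forall v, unit_box v -> (forall k, `|v k - p k| <= del) -> modc (h v) <= M) ->
  exists M : R, forall v, unit_box v -> modc (h v) <= M.
Proof.
move=> hloc; apply: contrapT => hno.
pose bad m b := ~ exists M : R, forall v, unit_box v ->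
  dyadic_cell m b v -> modc (h v) <= M.
have [||p p01 hp] := @dyadic_bisection bad.
- by move=> [M hM]; apply: hno; exists M => v v01; apply: hM => // k; rewrite mulr1.
- move=> m b hb; apply: contrapT => hall; apply: hb.
  have [M hM] : {M : {ffun I -> bool} -> R & forall (c : {ffun I -> bool}) v, unit_box v ->
      dyadic_cell m.+1 (fun k => (c k + (b k).*2)%N) v -> modc (h v) <= M c}.
    apply: (choice (P := fun (c : {ffun I -> bool}) M => forall v, unit_box v ->
      dyadic_cell m.+1 (fun k => (c k + (b k).*2)%N) v -> modc (h v) <= M)) => c.
    by apply: contrapT => hc; apply: hall; exists c.
  exists (\sum_c `|M c|) => v v01 hv.
  (* The child that contains [v]; points on the dividing face go to the upper half. *)
  pose c : {ffun I -> bool} := [ffun k => (b k).*2.+1%:R <= v k * 2 ^+ m.+1].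
  rewrite (le_trans (hM c v v01 _)) //; last first.
    by rewrite (le_trans (ler_norm _)) // (bigD1 c) //= lerDl sumr_ge0.
  move=> k; have /andP[h1 h2] := hv k; rewrite /c ffunE.
  have e2 : v k * 2 ^+ m.+1 = 2 * (v k * 2 ^+ m) by rewrite exprS mulrCA.
  have b2 : (b k).*2%:R = 2 * (b k)%:R :> R by rewrite -muln2 natrM mulrC.
  have b3 : (b k).+1%:R = (b k)%:R + 1 :> R by rewrite -addn1 natrD.
  case: (lerP (b k).*2.+1%:R (v k * 2 ^+ m.+1)) => [h3|/ltW h3] /=.
    rewrite add1n h3 e2 -[(b k).*2.+2]/((b k).+1.*2) -muln2 natrM mulrC.
    by rewrite ler_pM2r.
  by rewrite add0n h3 andbT e2 b2 ler_pM2l.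
have [del del0 [M hM]] := hloc p p01.
have [m hm] := exp2_small del0.
have [b [bb blt hb]] := hp m; apply: bb; exists M => v v01 hv; apply: hM => // k.
by rewrite (le_trans (dyadic_cell_close k hb hv)).
Qed.

End Bisection.

(** * Averages over finite grids *)

Section GridAverage.
Variables (R : realType) (I : finType).
Local Notation C := (cplx R).
Implicit Types (F G : (I -> nat) -> C) (L : nat).

(** [F] takes natural numbers rather than ordinals as indices, because difference quotients and
    telescoping also evaluate it at the index [L] just outside the grid. *)
Definition grid_avg L F : C :=
  (L ^ #|I|)%:R^-1 * \sum_(j : {ffun I -> 'I_L}) F (fun k => j k : nat).

Definition upd (T : Type) (v : I -> T) (k : I) (x : T) : I -> T :=
  fun k' => if k' == k then x else v k'.

Lemma eq_grid_avg L F G :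
  (forall j, (forall k, (j k < L)%N) -> F j = G j) -> grid_avg L F = grid_avg L G.
Proof. by move=> h; congr (_ * _); apply: eq_bigr => j _; apply: h => k. Qed.

Lemma grid_avgD L F G :
  grid_avg L (fun j => F j + G j) = grid_avg L F + grid_avg L G.
Proof. by rewrite /grid_avg big_split mulrDr. Qed.

Lemma grid_avgB L F G :
  grid_avg L (fun j => F j - G j) = grid_avg L F - grid_avg L G.
Proof. by rewrite /grid_avg sumrB mulrBr. Qed.

Lemma grid_avgZ L (c : C) F :
  grid_avg L (fun j => c * F j) = c * grid_avg L F.
Proof. by rewrite /grid_avg -mulr_sumr mulrCA. Qed.

Lemma grid_avg_sum L (J : Type) (s : seq J) (P : pred J) (F : J -> (I -> nat) -> C) :
  grid_avg L (fun j => \sum_(x <- s | P x) F x j) =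
  \sum_(x <- s | P x) grid_avg L (F x).
Proof. by rewrite /grid_avg exchange_big mulr_sumr. Qed.

Lemma card_grid_gt0 L : (0 < L)%N -> (0 < L ^ #|I|)%N.
Proof. by rewrite expn_gt0 => ->. Qed.

Lemma modc_grid_avg L F (M : R) : (0 < L)%N ->
  (forall j, (forall k, (j k < L)%N) -> modc (F j) <= M) ->
  modc (grid_avg L F) <= M.
Proof.
move=> L0 hF; rewrite /grid_avg modcM modcV -(rmorph_nat (real_complex R)) modc_real.
have d0 : (0 : R) < (L ^ #|I|)%:R by rewrite ltr0n card_grid_gt0.
rewrite gtr0_norm // mulrC ler_pdivrMr // (le_trans (modc_sum _ _ _)) //.
apply: (le_trans (y := \sum_(j : {ffun I -> 'I_L}) M)).
  by apply: ler_sum => j _; apply: hF => k.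
by rewrite sumr_const card_ffun card_ord mulr_natr.
Qed.

Lemma grid_avg_split L F :
  grid_avg (L + L) F = (2 ^ #|I|)%:R^-1 * \sum_(c : {ffun I -> bool})
    grid_avg L (fun j => F (fun k => (c k * L + j k)%N)).
Proof.
rewrite /grid_avg -mulr_sumr mulrA -invfM -natrM -expnMn mul2n -addnn; congr (_ * _).
rewrite pair_big /=.
pose h (cj : {ffun I -> bool} * {ffun I -> 'I_L}) : {ffun I -> 'I_(L + L)} :=
  [ffun k => if cj.1 k then rshift L (cj.2 k) else lshift L (cj.2 k)].
pose h' (u : {ffun I -> 'I_(L + L)}) : {ffun I -> bool} * {ffun I -> 'I_L} :=
  ([ffun k => if fintype.split (u k) is inl _ then false else true],
   [ffun k => match fintype.split (u k) with inl x => x | inr x => x end]).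
rewrite (reindex h) /=.
  apply: eq_bigr => -[c j] _ /=; congr F; apply/funext => k; rewrite ffunE /=.
  by case: (c k); rewrite /= ?mul1n ?mul0n.
exists h' => [[c j] _|u _].
  congr pair; apply/ffunP => k; rewrite !ffunE /=;
    by case: (c k); rewrite ?(unsplitK (inr _ : 'I_L + 'I_L)) ?(unsplitK (inl _ : 'I_L + 'I_L)).
apply/ffunP => k; rewrite !ffunE /=; case: fintype.splitP => x hx; exact/val_inj.
Qed.

Lemma grid_avg_upd L F k : (0 < L)%N ->
  grid_avg L F = L%:R^-1 * \sum_(x < L) grid_avg L (fun j => F (upd j k x)).
Proof.
move=> L0; rewrite /grid_avg -mulr_sumr mulrCA; congr (_ * _).
rewrite exchange_big pair_big /=.
(* [h] exchanges the coordinate [j k] with [x]; after this change of indices the summand is [F j]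
   and the sum over [x] is a factor [L]. *)
pose h (jx : {ffun I -> 'I_L} * 'I_L) : {ffun I -> 'I_L} * 'I_L :=
  ([ffun k' => upd jx.1 k jx.2 k'], jx.1 k).
rewrite (reindex h) /=; last first.
  have hh : involutive h.
    move=> [j x]; rewrite /h /=; congr pair; last by rewrite ffunE /upd eqxx.
    apply/ffunP => k'; rewrite !ffunE /upd.
    by case: eqP => [->|//]; rewrite ?ffunE /upd ?eqxx //; case: eqP.
  by exists h => u _; rewrite hh.
under [in RHS]eq_bigr => u _.
  have -> : upd (fun k' => ([ffun k'' => upd u.1 k u.2 k''] k' : 'I_L) : nat) k
      (u.1 k : nat) = (fun k' => u.1 k' : nat).
    apply/funext => k'; rewrite /upd; case: eqP => [->//|/eqP kk].
    by rewrite ffunE /upd (negbTE kk).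
  over.
rewrite -(pair_big xpredT xpredT (fun (j : {ffun I -> 'I_L}) (_ : 'I_L) =>
  F (fun k' => j k' : nat))) /=.
under [in RHS]eq_bigr do rewrite sumr_const card_ord -mulr_natl.
by rewrite -mulr_sumr mulKf // pnatr_eq0 -lt0n.
Qed.

Lemma grid_avg_telescope L F k : (0 < L)%N ->
  L%:R * grid_avg L (fun j => F (upd j k (j k).+1) - F j) =
  grid_avg L (fun j => F (upd j k L) - F (upd j k 0%N)).
Proof.
move=> L0; rewrite (grid_avg_upd _ k L0) mulVKf ?pnatr_eq0 -?lt0n //.
rewrite -grid_avg_sum; apply: eq_grid_avg => j _.
have uu x y : upd (upd j k x) k y = upd j k y.
  by apply/funext => k'; rewrite /upd; case: eqP.
have us x : upd j k x k = x by rewrite /upd eqxx.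
under eq_bigr do rewrite uu us.
rewrite -(telescope_sumr (fun x => F (upd j k x)) (leq0n L)) big_mkord.
by [].
Qed.

End GridAverage.

(** * A discrete Goursat theorem *)

Section Goursat.
Variables (R : realType) (I : finType).
Local Notation C := (cplx R).
Variables (h : (I -> R) -> C) (k1 k2 : I) (alp bet : C) (M : nat).

(* For [v], [w1], [w2] the base point of a cell and its neighbours in the
   directions [k1], [k2]: a Riemann sum for the integral of
   [h (alp dx_k1 + bet dx_k2)] along the boundary of the cell. *)
Definition box_increment (v w1 w2 : I -> R) : C :=
  alp * (h v - h w2) + bet * (h w1 - h v).

Let T n := (M * 2 ^ n)%N.
Let pt n (j : I -> nat) : I -> R := fun k => (j k)%:R / (T n)%:R.
Let inc n j := box_increment (pt n j) (pt n (upd j k1 (j k1).+1))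
  (pt n (upd j k2 (j k2).+1)).
Let at_cell (b : I -> nat) L (j : I -> nat) : I -> nat := fun k => (b k * L + j k)%N.
(** Normalized like a circulation divided by an area. The value at a cell is then the mean of the
    values at its children, so a lower bound [e] passes to some child without loss. *)
Let cell_sum n m b : C :=
  (T n)%:R * grid_avg (T (n - m)) (fun j => inc n (at_cell b (T (n - m)) j)).

Hypothesis M_gt0 : (0 < M)%N.
Hypothesis k12 : k1 != k2.

Let T_gt0 n : (0 < T n)%N. Proof. by rewrite /T muln_gt0 M_gt0 expn_gt0. Qed.

Let TR_gt0 n : (0 : R) < (T n)%:R. Proof. by rewrite ltr0n. Qed.

Let at_cell_upd b L j k x :
  at_cell b L (upd j k x) = upd (at_cell b L j) k (b k * L + x)%N.
Proof. by apply/funext => k'; rewrite /at_cell /upd; case: eqP => // ->. Qed.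

Let pt_upd n j k x : pt n (upd j k x) = upd (pt n j) k (x%:R / (T n)%:R).
Proof. by apply/funext => k'; rewrite /pt /upd; case: eqP. Qed.

Let cell_sum_split n m b : (m < n)%N ->
  cell_sum n m b = (2 ^ #|I|)%:R^-1 *
    \sum_(c : {ffun I -> bool}) cell_sum n m.+1 (fun k => (c k + (b k).*2)%N).
Proof.
move=> mn; rewrite /cell_sum -mulr_sumr [RHS]mulrCA; congr (_ * _).
have -> : T (n - m) = (T (n - m.+1) + T (n - m.+1))%N.
  by rewrite /T -subSS subSn // expnS mulnCA mul2n addnn.
rewrite grid_avg_split; congr (_ * _); apply: eq_bigr => c _.
apply: eq_grid_avg => j _; congr inc; apply/funext => k; rewrite /at_cell.
by rewrite -muln2; ring.
Qed.

(** Discrete Stokes formula: the increments telescope inside the cell and leave its opposite sides.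
    Telescoping absorbs the factor [T (n - m)] of [T n] and leaves [2 ^ m]. *)
Let cell_sum_boundary n m b : (m <= n)%N ->
  cell_sum n m b = 2 ^+ m * grid_avg (T (n - m)) (fun j =>
    let v k x := pt n (at_cell b (T (n - m)) (upd j k x)) in
    alp * (h (v k2 0%N) - h (v k2 (T (n - m)))) +
    bet * (h (v k1 (T (n - m))) - h (v k1 0%N))).
Proof.
move=> mn; rewrite /cell_sum.
have -> : (T n)%:R = 2 ^+ m * (T (n - m))%:R :> C.
  by rewrite -natrX -natrM /T mulnCA -expnD subnKC.
rewrite -mulrA; congr (_ * _); set L := T (n - m).
pose F j := h (pt n (at_cell b L j)).
have hinc j : inc n (at_cell b L j) =
    - alp * (F (upd j k2 (j k2).+1) - F j) + bet * (F (upd j k1 (j k1).+1) - F j).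
  rewrite /inc /box_increment /F !at_cell_upd !addnS mulNr -mulrN opprB.
  by [].
under eq_grid_avg => j _ do rewrite hinc.
rewrite grid_avgD !grid_avgZ mulrDr [L%:R * (- alp * _)]mulrCA.
rewrite [L%:R * (bet * _)]mulrCA !(grid_avg_telescope F) ?T_gt0 //.
rewrite -!grid_avgZ -grid_avgD; apply: eq_grid_avg => j _.
by rewrite mulNr -mulrN opprB.
Qed.

Let pt_cell n m b j : (m <= n)%N -> (forall k, (j k <= T (n - m))%N) ->
  dyadic_cell m b (pt n (at_cell b (T (n - m)) j)).
Proof.
move=> mn hj k; rewrite /pt /at_cell.
have -> : (T n)%:R = (T (n - m))%:R * 2 ^+ m :> R.
  by rewrite -natrX -natrM /T -mulnA -expnD subnK.
rewrite invfM mulrA divfK ?gt_eqF ?exprn_gt0 // ler_pdivlMr // ler_pdivrMr //.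
rewrite -!natrM !ler_nat leq_addr /= mulSn addnC leq_add2r.
exact: hj.
Qed.

Hypothesis h_diff : forall p, unit_box p -> forall e : R, 0 < e ->
  exists2 del : R, 0 < del & exists (c : (I -> R) -> C) (kap : C),
    (forall v x, c (upd v k1 x) = c v /\ c (upd v k2 x) = c v) /\
    forall v d, unit_box v -> 0 < d <= del -> (forall k, `|v k - p k| <= d) ->
      modc (h v - c v - kap * (alp * (v k1)%:C%C + bet * (v k2)%:C%C)) <= e * d.

(** [h_diff] is complex differentiability in the plane of [k1] and [k2]: up to a small error, [h] is
    a part constant in that plane plus a multiple of [alp x_k1 + bet x_k2]. The boundary sum kills
    both, and the error is of the order of the side of the cell, which offsets the factor
    [2 ^ m]. *)
Lemma discrete_goursat (e : R) : 0 < e -> exists n0, forall n, (n0 <= n)%N ->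
  modc (grid_avg (T n) (fun j => let v := pt n j in
    alp * (h (upd v k2 0) - h (upd v k2 1)) +
    bet * (h (upd v k1 1) - h (upd v k1 0)))) <= e.
Proof.
move=> e0; apply: contrapT => hno.
(* Badness asks for arbitrarily fine grids, not one fixed grid, since the depth at which bisection
   stops is not known beforehand. *)
pose bad m b := forall n0, exists n, [/\ (n0 <= n)%N, (m <= n)%N &
  e < modc (cell_sum n m b)].
have TT n : (T n)%:R / (T n)%:R = 1 :> R by rewrite divff // gt_eqF.
have [||p p01 hp] := @dyadic_bisection R I bad.
- move=> n0; apply: contrapT => hn; apply: hno; exists n0 => n n0n.
  rewrite leNgt; apply/negP => hlt; apply: hn; exists n; split => //.
  rewrite cell_sum_boundary // expr0 mul1r subn0; congr (_ < modc _): hlt.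
  apply: eq_grid_avg => j _ /=.
  have -> : at_cell (fun=> 0%N) (T n) = id.
    by apply/funext => j'; apply/funext => k; rewrite /at_cell mul0n.
  by rewrite !pt_upd TT !mul0r.
- move=> m b hb; apply: contrapT => hall.
  have [n0 hn0] : {n0 : {ffun I -> bool} -> nat & forall (c : {ffun I -> bool}) n,
      (n0 c <= n)%N -> (m < n)%N ->
      modc (cell_sum n m.+1 (fun k => (c k + (b k).*2)%N)) <= e}.
    apply: (choice (P := fun (c : {ffun I -> bool}) n0 => forall n,
      (n0 <= n)%N -> (m < n)%N ->
      modc (cell_sum n m.+1 (fun k => (c k + (b k).*2)%N)) <= e)) => c.
    apply: contrapT => hc; apply: hall; exists c => n0.
    apply: contrapT => hc'; apply: hc; exists n0 => n n0n mn.
    by rewrite leNgt; apply/negP => ?; apply: hc'; exists n.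
  (* Beyond the largest of the finitely many thresholds all children are small, hence so is their
     mean. *)
  have [n [n1 n2]] := hb (maxn m.+1 (\max_c n0 c)).
  move: n1; rewrite geq_max => /andP[mn n0n].
  apply/negP; rewrite -leNgt cell_sum_split // modcM modcV.
  have p2 : (0 : R) < (2 ^ #|I|)%:R by rewrite ltr0n expn_gt0.
  rewrite -(rmorph_nat (real_complex R)) modc_real gtr0_norm //.
  rewrite mulrC ler_pdivrMr // (le_trans (modc_sum _ _ _)) //.
  apply: (le_trans (y := \sum_(c : {ffun I -> bool}) e)).
    apply: ler_sum => c _; apply: hn0 => //; apply: leq_trans n0n.
    exact: leq_bigmax.
  by rewrite sumr_const card_ffun card_bool mulr_natr.
(* Two error terms for each of the two directions; the 1 keeps [K] positive. *)
pose K := 2 * modc alp + 2 * modc bet + 1.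
have K0 : 0 < K by rewrite /K; have := modc_ge0 alp; have := modc_ge0 bet; lra.
have eK : 0 < e / K by rewrite divr_gt0.
have [del del0 [c [kap [hc hcv]]]] := h_diff p01 eK.
have [m hm] := exp2_small del0.
have [b [bb blt pb]] := hp m; have [n [_ mn]] := bb 0%N.
apply/negP; rewrite -leNgt cell_sum_boundary // modcM modcX.
have p2 : (0 : R) < 2 ^+ m by rewrite exprn_gt0.
have -> : modc 2 = 2 :> R.
  by rewrite -(rmorph_nat (real_complex R)) modc_real normr_nat.
set L := T (n - m).
rewrite mulrC -ler_pdivlMr //; apply: modc_grid_avg => [|j hj] /=; first exact: T_gt0.
pose v k x := pt n (at_cell b L (upd j k x)).
pose err w := h w - c w - kap * (alp * (w k1)%:C%C + bet * (w k2)%:C%C).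
have hv k x : (x <= L)%N -> dyadic_cell m b (v k x).
  move=> xL; apply: pt_cell => // k'; rewrite /upd; case: eqP => // _.
  exact/ltnW/hj.
have herr k x : (x <= L)%N -> modc (err (v k x)) <= e / K * (2 ^+ m)^-1.
  move=> xL; apply: hcv; first exact: dyadic_cell_unit blt (hv k x xL).
    by rewrite invr_gt0 p2.
  by move=> k'; apply: dyadic_cell_close pb (hv k x xL).
have vE k x : v k x = upd (pt n (at_cell b L j)) k ((b k * L + x)%N%:R / (T n)%:R).
  by rewrite /v at_cell_upd pt_upd.
have cv k x y : (k == k1) || (k == k2) -> c (v k x) = c (v k y).
  by move=> /orP[]/eqP->; rewrite !vE; have := hc (pt n (at_cell b L j));
    move=> hh; rewrite ?(hh _).1 ?(hh _).2.
have step k : (b k * L + L)%N%:R / (T n)%:R =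
    (b k * L)%N%:R / (T n)%:R + (2 ^+ m)^-1 :> R.
  rewrite natrD mulrDl; congr (_ + _).
  rewrite (_ : T n = L * 2 ^ m)%N; last by rewrite /L /T -mulnA -expnD subnK.
  by rewrite natrM natrX invfM mulrA divff ?mul1r // gt_eqF // TR_gt0.
rewrite -/(v k2 0%N) -/(v k2 L) -/(v k1 L) -/(v k1 0%N).
(* [c] cancels between opposite sides, and the linear part contributes
   [kap (- alp bet s + bet alp s) = 0], where [s] is the side of the cell. *)
have -> : alp * (h (v k2 0%N) - h (v k2 L)) + bet * (h (v k1 L) - h (v k1 0%N)) =
    (alp * (err (v k2 0%N) - err (v k2 L)) + bet * (err (v k1 L) - err (v k1 0%N))).
  rewrite /err (cv k2 L 0%N) ?eqxx ?orbT // (cv k1 L 0%N) ?eqxx // !vE.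
  rewrite /upd !eqxx (negbTE k12) eq_sym (negbTE k12) addn0 !step !rmorphD /=.
  by ring.
have alp0 := modc_ge0 alp; have bet0 := modc_ge0 bet.
apply: (le_trans (modcD _ _)); rewrite !modcM.
have b4 k : modc (err (v k 0%N) - err (v k L)) <= 2 * (e / K * (2 ^+ m)^-1).
  by rewrite (le_trans (modcD _ _)) // modcN mulr_natl mulr2n lerD ?herr.
rewrite (modcB (err (v k1 L))).
apply: (le_trans (lerD (ler_wpM2l alp0 (b4 k2)) (ler_wpM2l bet0 (b4 k1)))).
have -> : e / 2 ^+ m = K * (e / K * (2 ^+ m)^-1).
  by rewrite mulrA [K * _]mulrC divfK ?gt_eqF.
rewrite /K; have : 0 < e / (2 * modc alp + 2 * modc bet + 1) / 2 ^+ m.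
  by rewrite divr_gt0.
move: (_ / _ / _) => z z0; nra.
Qed.

End Goursat.

(** * Unordered sums and products *)

Section UnorderedLimits.
Variables (R : realType) (I : choiceType) (S : set I).
Local Notation C := (cplx R).
Local Notation totally := (@summability.totally I).
Implicit Types (u v : I -> C) (A B : {fset I}) (F : {fset I} -> C) (e : R).

#[local] Instance totally_proper : ProperFilter totally.
Proof. exact: summability.totally_filter. Qed.

(** A bound on all finite sums off [A]. It is inherited under domination, so a single [A] serves a
    whole polydisc. *)
Definition tail_le u A e : Prop :=
  forall B, \sum_(i <- B | (i \in S) && (i \notin A)) modc (u i) <= e.

Lemma tail_le_mono u v A e : (forall i, i \in S -> modc (v i) <= modc (u i)) ->
  tail_le u A e -> tail_le v A e.
Proof.
by move=> uv hu B; apply: le_trans (hu B); apply: ler_sum => i /andP[/uv].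
Qed.

Lemma perm_fsetU A B : perm_eq (A `|` B)%fset (A ++ [seq i <- B | i \notin A]).
Proof.
apply: uniq_perm; first exact: fset_uniq.
  rewrite cat_uniq fset_uniq filter_uniq ?fset_uniq //= andbT.
  by apply/hasPn => x /=; rewrite mem_filter => /andP[].
by move=> x; rewrite inE mem_cat mem_filter; case: (x \in A).
Qed.

Lemma abs_summable_tail u : abs_summable S u ->
  forall e, 0 < e -> exists A, tail_le u A e.
Proof.
move=> su e e0; pose psum A := \sum_(i <- A | i \in S) modc (u i).
have [M hM] : exists M, forall A, psum A <= M.
  move: su; rewrite /abs_summable /summable.
  under eq_esum do rewrite gee0_abs ?lee_fin ?modc_ge0 //.
  set s := esum _ _ => s_fin.
  have h A : ((psum A)%:E <= s)%E.
    rewrite /psum /s -sumEFin; apply: ereal_sup_ubound => /=.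
    exists [set` [seq i <- A | i \in S]].
      split; first exact: finite_seq.
      by move=> x /=; rewrite mem_filter => /andP[/set_mem].
    by rewrite -fsbig_seq ?filter_uniq ?fset_uniq // big_filter.
  exists (fine s) => A; have := h A.
  by case: s s_fin h => [s||] //= _ h; rewrite lee_fin.
have hs : has_sup (range psum).
  by split; [exists (psum fset0), fset0 | exists M => _ [A _ <-]].
have [_ [A _ <-] hA] := sup_adherent e0 hs.
exists A => B.
have : psum (A `|` B)%fset <= sup (range psum).
  by apply: sup_upper_bound => //; exists (A `|` B)%fset.
rewrite {1}/psum (perm_big _ (perm_fsetU A B)) big_cat /= big_filter_cond.
under [X in _ + X]eq_bigl do rewrite andbC.
by rewrite -/(psum A); lra.
Qed.

(** Completeness of [R], applied to the real and to the imaginary part. *)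
Lemma totally_cvgC F :
    (forall e, 0 < e -> exists A, forall B, (A `<=` B)%fset -> modc (F B - F A) <= e) ->
  exists z : C, F @ totally --> z.
Proof.
move=> hF.
have hcv (f : C -> R) : (forall z w, `|f z - f w| <= modc (z - w)) ->
    exists x : R, (fun A => f (F A)) @ totally --> x.
  move=> hf; have : cvg ((fun A => f (F A)) @ totally).
    apply/cauchy_cvgP; apply/cauchy_exP => e e0.
    have e2 : 0 < e / 2 by rewrite divr_gt0.
    have [A hA] := hF _ e2; exists (f (F A)); exists A => //= B AB.
    rewrite /ball /= (le_lt_trans (hf _ _)) // modcB (le_lt_trans (hA _ AB)) //.
    by rewrite ltr_pdivrMr // ltr_pMr // ltr1n.
  by move=> /cvg_ex[x hx]; exists x.
have [z w|x /cvgrPdist_le hx] := hcv (@complex.Re R).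
  by rewrite -(raddfB (@complex.Re R)) Re_le_modc.
have [z w|y /cvgrPdist_le hy] := hcv (@complex.Im R).
  by rewrite -(raddfB (@complex.Im R)) Im_le_modc.
exists (x +i* y)%C; apply/cvg_modcP => e e0.
have e2 : 0 < e / 2 by rewrite divr_gt0.
near=> A; rewrite (le_trans (modc_ReIm _)) // (splitr e) lerD //.
  by rewrite raddfB /= distrC; near: A; exact: hx.
by rewrite raddfB /= distrC; near: A; exact: hy.
Unshelve. all: by end_near. Qed.

Lemma lim_totally_dist F (z w : C) (A : {fset I}) e : F @ totally --> z ->
  (forall B, (A `<=` B)%fset -> modc (F B - w) <= e) ->
  modc (lim (F @ totally) - w) <= e.
Proof.
move=> Fz hF; rewrite (cvg_lim (@norm_hausdorff _ _) Fz).
apply/ler_addgt0Pr => e' e'0; move/cvg_modcP : (Fz) => /(_ e' e'0)[B _ hB].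
have -> : z - w = (F (A `|` B)%fset - w) - (F (A `|` B)%fset - z).
  by ring.
rewrite (le_trans (modcD _ _)) // modcN lerD // ?hF ?fsubsetUl //.
by apply: hB => /=; exact: fsubsetUr.
Qed.

Lemma psum_sub (V : zmodType) (f : I -> V) A B : (A `<=` B)%fset ->
  \sum_(i <- B | i \in S) f i - \sum_(i <- A | i \in S) f i =
  \sum_(i <- B | (i \in S) && (i \notin A)) f i.
Proof.
move=> /fsetUidPr AB; rewrite -{1}AB (perm_big _ (perm_fsetU A B)) big_cat /=.
rewrite big_filter_cond [X in X - _]addrC addrK.
by apply: eq_bigl => i; rewrite andbC.
Qed.

Lemma usum_approx u A e : (forall e', 0 < e' -> exists A', tail_le u A' e') ->
  tail_le u A e ->
  modc (usum S u - \sum_(i <- A | i \in S) u i) <= e.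
Proof.
move=> hu hA.
have h A' e' B : tail_le u A' e' -> (A' `<=` B)%fset ->
    modc (\sum_(i <- B | i \in S) u i - \sum_(i <- A' | i \in S) u i) <= e'.
  by move=> hA' /psum_sub ->; apply: le_trans (hA' B); exact: modc_sum.
have [|z hz] := @totally_cvgC (fun A => \sum_(i <- A | i \in S) u i).
  by move=> e' /hu[A' hA']; exists A' => B; exact: h.
by apply: (lim_totally_dist (A := A) hz) => B; exact: h.
Qed.

(** Induction on [(1 - u) p - 1 = (p - 1) - u (p - 1) - u]; the bound 1/2 on the sum keeps [|p - 1|]
    at most 1, so each factor adds at most [2 |u|]. *)
Lemma modc_prod1B u (s : seq I) (P : pred I) :
  \sum_(i <- s | P i) modc (u i) <= 2^-1 ->
  modc (\prod_(i <- s | P i) (1 - u i) - 1) <= 2 * \sum_(i <- s | P i) modc (u i).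
Proof.
elim: s => [|i s IH]; first by rewrite !big_nil subrr modc0 mulr0.
rewrite !big_cons; case: ifP => // Pi.
set t := \sum_(_ <- _ | _) _ in IH *; set p := \prod_(_ <- _ | _) _ in IH *.
have ui0 := modc_ge0 (u i); have t0 : 0 <= t by apply: sumr_ge0 => j _; exact: modc_ge0.
move=> ht; have {}IH := IH (le_trans (ler_wpDl ui0 (lexx _)) ht).
have -> : (1 - u i) * p - 1 = (p - 1) - u i * (p - 1) - u i by ring.
rewrite (le_trans (modcD _ _)) // modcN.
have := modcD (p - 1) (- (u i * (p - 1))); rewrite modcN modcM.
by move: (modc_ge0 (p - 1)) => *; nra.
Qed.

Lemma pprod_split u A B : (A `<=` B)%fset ->
  \prod_(i <- B | i \in S) (1 - u i) =
  \prod_(i <- A | i \in S) (1 - u i) *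
    \prod_(i <- B | (i \in S) && (i \notin A)) (1 - u i).
Proof.
move=> /fsetUidPr AB; rewrite -{1}AB (perm_big _ (perm_fsetU A B)) big_cat /=.
by rewrite big_filter_cond; congr (_ * _); apply: eq_bigl => i; rewrite andbC.
Qed.

Lemma uprod1B_cvg u : (forall e', 0 < e' -> exists A', tail_le u A' e') ->
  exists z : C, (fun A => \prod_(i <- A | i \in S) (1 - u i)) @ totally --> z.
Proof.
move=> hu; apply: totally_cvgC => e e0.
have h2 : (0 : R) < 2^-1 by rewrite invr_gt0.
(* [A0] bounds the partial products beyond it by [2 c]; [A1] then makes the relative error so small
   that the total is at most [4 c e / (4 c + 4)]. *)
have [A0 hA0] := hu _ h2; pose c := modc (\prod_(i <- A0 | i \in S) (1 - u i)).
have c0 : 0 <= c by exact: modc_ge0.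
have c4 : 0 < 4 * c + 4 by lra.
have : 0 < Num.min 2^-1 (e / (4 * c + 4)) by rewrite lt_min h2 divr_gt0.
move=> /hu[A1 hA1]; exists (A0 `|` A1)%fset => B /= hB.
rewrite (pprod_split _ hB) -[X in _ - X]mulr1 -mulrBr modcM.
have bnd A (a : R) B' : tail_le u A a -> a <= 2^-1 ->
    modc (\prod_(i <- B' | (i \in S) && (i \notin A)) (1 - u i) - 1) <= 2 * a.
  move=> hA a2; rewrite (le_trans (modc_prod1B _)) //.
    exact: le_trans (hA B') a2.
  by rewrite ler_wpM2l.
have le1 : modc (\prod_(i <- (A0 `|` A1)%fset | i \in S) (1 - u i)) <= 2 * c.
  rewrite (pprod_split _ (fsubsetUl A0 A1)) modcM mulrC ler_wpM2r //.
  set p := \prod_(_ <- _ | _) _; have -> : p = (p - 1) + 1 by rewrite subrK.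
  rewrite (le_trans (modcD _ _)) // modc1.
  have := bnd _ _ (A0 `|` A1)%fset hA0 (lexx _); rewrite -/p; lra.
have le2 : modc (\prod_(i <- B | (i \in S) && (i \notin (A0 `|` A1)%fset)) (1 - u i) - 1)
    <= 2 * Num.min 2^-1 (e / (4 * c + 4)).
  apply: bnd; last by rewrite ge_min lexx.
  move=> B'; apply: le_trans (hA1 B').
  rewrite big_mkcond [leRHS]big_mkcond; apply: ler_sum => i _.
  rewrite !inE negb_or; case: (i \in S) => //=.
  by case: (i \in A0) => //=; case: (i \in A1) => //=; rewrite modc_ge0.
rewrite (le_trans (ler_pM _ _ le1 le2)) ?modc_ge0 //.
have : Num.min 2^-1 (e / (4 * c + 4)) <= e / (4 * c + 4) by rewrite ge_min lexx orbT.
rewrite ler_pdivlMr //; nra.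
Qed.

(** The error is relative to the partial product. Hence a vanishing factor makes the limit vanish,
    and quotients by the product can be estimated. *)
Lemma uprod1B_approx u A e : (forall e', 0 < e' -> exists A', tail_le u A' e') ->
  tail_le u A e -> e <= 2^-1 ->
  modc (uprod1B S u - \prod_(i <- A | i \in S) (1 - u i)) <=
    2 * e * modc (\prod_(i <- A | i \in S) (1 - u i)).
Proof.
move=> hu hA e2; have [z hz] := uprod1B_cvg hu.
apply: (lim_totally_dist (A := A) hz) => B AB.
rewrite (pprod_split _ AB) -[X in _ - X]mulr1 -mulrBr modcM mulrC.
rewrite ler_wpM2r ?modc_ge0 // (le_trans (modc_prod1B _)) //.
  exact: le_trans (hA B) e2.
by rewrite ler_wpM2l.
Qed.

End UnorderedLimits.

(** * Coordinates, differentiability and monomials on row vectors *)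

Section RowVectors.
Variables (R : realType) (r : nat).
Local Notation C := (cplx R).
Local Notation V := 'rV[C]_r.
Implicit Types (x y : V) (lam mu : 'rV[int]_r) (f : V -> C) (e d : R).

Lemma nbhs_rVP x (A : set V) :
  nbhs x A <-> exists2 e, 0 < e &
    forall y, (forall k, modc (y 0 k - x 0 k) < e) -> A y.
Proof.
split=> [/nbhs_ballP[_ /complex_gt0[e e0 ->] he]|[e e0 he]].
  exists e => // y hy; apply: he; split => [|i j]; first by rewrite ltcR.
  by rewrite ord1 /ball /= distrC -ltr_modc.
apply/nbhs_ballP; exists (e%:C)%C => [|y [_ hy]]; first by rewrite /= ltcR.
by apply: he => k; have := hy 0 k; rewrite /ball /= distrC -ltr_modc.
Qed.

Lemma norm_rV_le x d : 0 <= d -> (forall k, modc (x 0 k) <= d) ->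
  `|x| <= (d%:C)%C.
Proof.
move=> d0 hx; have d0' : (0 : C) <= (d%:C)%C by rewrite lecR.
rewrite /Num.norm /= /mx_norm; set dn := NngNum d0'.
rewrite -[(d%:C)%C]/(dn%:num) num_le.
apply/bigmax_leP; split=> [|[i j] _]; first by rewrite -num_le.
by rewrite -num_le /= ord1 -ler_modc.
Qed.

Lemma differentiable_estimate f x : differentiable f x ->
  exists L : 'I_r -> C, forall e, 0 < e -> exists2 del : R, 0 < del &
    forall y d, 0 <= d < del -> (forall k, modc (y 0 k - x 0 k) <= d) ->
      modc (f y - f x - \sum_k L k * (y 0 k - x 0 k)) <= e * d.
Proof.
move=> df; exists (fun k => 'd f x (delta_mx 0 k)) => e e0.
have /eqaddoP/(_ (e%:C)%C) := diff_locally df.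
rewrite ltcR => /(_ e0) /nbhs_rVP[del del0 hdel]; exists del => // y d /andP[d0 dd] hy.
have h : (forall k, modc ((y - x) 0 k - (0 : V) 0 k) < del) ->
    `|f (y - x + x) - (f x + 'd f x (y - x))| <= (e%:C)%C * `|y - x|.
  exact: hdel.
rewrite subrK in h; have {h} : `|f y - (f x + 'd f x (y - x))| <= (e%:C)%C * `|y - x|.
  apply: h => k; rewrite !mxE subr0 (le_lt_trans (hy k)) //.
rewrite opprD addrA => h.
have -> : \sum_k 'd f x (delta_mx 0 k) * (y 0 k - x 0 k) = 'd f x (y - x).
  rewrite [y - x in RHS]row_sum_delta linear_sum; apply: eq_bigr => k _.
  by rewrite linearZ /= !mxE mulrC.
rewrite ler_modc (le_trans h) // rmorphM /= ler_wpM2l ?lecR ?(ltW e0) //.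
by apply: norm_rV_le => // k; rewrite !mxE.
Qed.

Lemma differentiable_prod (I : Type) (s : seq I) (P : pred I) (F : I -> V -> C) x :
  (forall i, P i -> differentiable (F i) x) ->
  differentiable (fun y => \prod_(i <- s | P i) F i y) x.
Proof.
move=> hF; elim: s => [|i s IH].
  rewrite (_ : (fun y => _) = cst 1); first exact: differentiable_cst.
  by apply/funext => y; rewrite big_nil.
have [Pi|Pi] := boolP (P i); last first.
  rewrite (_ : (fun y => _) = (fun y => \prod_(i <- s | P i) F i y)) //.
  by apply/funext => y; rewrite big_cons (negbTE Pi).
rewrite (_ : (fun y => _) = F i * (fun y => \prod_(i <- s | P i) F i y)).
  exact: differentiableM (hF i Pi) IH.
by apply/funext => y; rewrite big_cons Pi.
Qed.

Lemma differentiable_coordX x k (z : int) : (0 <= z) || (x 0 k != 0) ->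
  differentiable (fun y : V => y 0 k ^ z) x.
Proof.
have dc : differentiable (fun y : V => y 0 k) x by exact: differentiable_coord.
have dX n : differentiable (fun y : V => y 0 k ^+ n) x.
  rewrite (_ : (fun y => _) = (fun y : V => \prod_(j < n) y 0 k)).
    exact: differentiable_prod.
  by apply/funext => y; rewrite prodr_const card_ord.
case: z => n xk; first exact: dX.
apply: (@differentiableV _ _ (fun y : V => y 0 k ^+ n.+1)) => //.
exact: expf_neq0.
Qed.

Lemma differentiable_mono lam x :
  (forall k, (0 <= lam 0 k) || (x 0 k != 0)) ->
  differentiable (fun y => mono y lam) x.
Proof. by move=> h; apply: differentiable_prod => k _; apply: differentiable_coordX. Qed.

Lemma modc_mono x lam : modc (mono x lam) = \prod_k modc (x 0 k) ^ lam 0 k.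
Proof. by rewrite modc_prod; apply: eq_bigr => k _; rewrite modc_exprz. Qed.

Lemma mono_le x y lam : Qplus lam -> (forall k, modc (x 0 k) <= modc (y 0 k)) ->
  modc (mono x lam) <= modc (mono y lam).
Proof.
move=> hl hxy; rewrite !modc_mono; apply: ler_prod => k _; have := hl k.
case: (lam 0 k) => n // _; rewrite -!exprnP exprn_ge0 ?modc_ge0 //=.
by rewrite lerXn2r // nnegrE modc_ge0.
Qed.

Lemma monoD x lam mu : (forall k, x 0 k != 0) ->
  mono x (lam + mu) = mono x lam * mono x mu.
Proof.
by move=> hx; rewrite -big_split; apply: eq_bigr => k _; rewrite mxE expfzDr.
Qed.

Lemma monoN x lam : mono x (- lam) = (mono x lam)^-1.
Proof. by rewrite /mono -prodfV; apply: eq_bigr => k _; rewrite mxE invr_expz. Qed.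

Lemma monoZ_alpha x (z : int) i : mono x (z *: alphaQ i) = x 0 i ^ z.
Proof.
rewrite /mono (bigD1 i) //= big1 ?mulr1 => [|k ki].
  by rewrite !mxE !eqxx mulr1.
by rewrite !mxE eqxx (negbTE ki) mulr0 expr0z.
Qed.

Lemma mono_neq0 x lam : (forall k, x 0 k != 0) -> mono x lam != 0.
Proof. by move=> hx; apply/prodf_neq0 => k _; apply: expfz_neq0. Qed.

End RowVectors.

(** The extra index [None] will be the radial parameter; on the two bounding tori of an annulus
    nothing depends on it any more. *)
Lemma grid_avg_option (R : realType) (I : finType) L (F : (I -> nat) -> cplx R) :
  (0 < L)%N -> grid_avg L (fun j : option I -> nat => F (fun k => j (Some k))) =
  grid_avg L F.
Proof.
move=> L0; rewrite /grid_avg.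
pose h (u : 'I_L * {ffun I -> 'I_L}) : {ffun option I -> 'I_L} :=
  [ffun k => if k is Some k' then u.2 k' else u.1].
rewrite (reindex h) /=; last first.
  exists (fun j : {ffun option I -> 'I_L} => (j None, [ffun k => j (Some k)])).
    move=> [x j] _ /=; congr pair; first by rewrite ffunE.
    by apply/ffunP => k; rewrite !ffunE.
  by move=> j _; apply/ffunP => -[k|]; rewrite !ffunE.
under eq_bigr => u _.
  rewrite (_ : (fun k : I => _) = (fun k => u.2 k : nat)); last first.
    by apply/funext => k; rewrite ffunE.
  over.
rewrite -(pair_big xpredT xpredT (fun (_ : 'I_L) (j : {ffun I -> 'I_L}) =>
  F (fun k => j k : nat))) /= sumr_const card_ord card_option expnS natrM invfM.
by rewrite -[X in _ * X]mulr_natl mulrA [_^-1 * _^-1]mulrC mulfVK // pnatr_eq0 -lt0n.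
Qed.

(** * Averages over tori and their comparison across an annulus *)

Section TorusAverage.
Variables (R : realType) (r : nat).
Local Notation C := (cplx R).
Local Notation V := 'rV[C]_r.
Implicit Types (f : V -> C) (rho v : 'I_r -> R).

Definition torus_pt rho v : V := \row_k ((rho k)%:C%C * cis (2 * pi * v k)).

Definition torus_avg N f rho : C :=
  grid_avg N (fun j => f (torus_pt rho (fun k => (j k)%:R / N%:R))).

Lemma modc_torus_pt rho v k : modc (torus_pt rho v 0 k) = `|rho k|.
Proof. by rewrite mxE modcM modc_cis mulr1 modc_real. Qed.

Variables (f : V -> C) (rho : 'I_r -> R) (k0 : 'I_r) (a b : R).

(* [w (Some k)] is the angle of the coordinate [k] and [w None] interpolates
   [ln |x_k0|] between [a] and [b], so that [X] depends on the pair
   [(w None, w (Some k0))] through the complex number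
   [alp (w None) + bet (w (Some k0))] only. *)
Let X (w : option 'I_r -> R) : V :=
  torus_pt (upd rho k0 (expR (a + w None * (b - a)))) (fun k => w (Some k)).

(** The ratio [X w / X p] of the [k]-th coordinates; the chart [X] is affine in the logarithms of
    the coordinates. *)
Let incr (w p : option 'I_r -> R) k : C :=
  cexp2 (if k == k0 then (b - a) * (w None - p None) else 0)
    (2 * pi * (w (Some k) - p (Some k))).

Let XE w p k : X w 0 k = X p 0 k * incr w p k.
Proof.
have cE (x : R) y : (expR x)%:C%C * cis y = cexp2 x y by [].
rewrite /incr !mxE /upd; case: eqP => _.
  by rewrite !cE -cexp2D; congr cexp2; ring.
by rewrite /cexp2 expR0 rmorph1 mul1r -[RHS]mulrA -cisD; congr (_ * cis _); ring.
Qed.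

(** [alp] and [bet] are the derivatives of [log x_k0] along [None] and along [Some k0]. *)
Let alp : C := (b - a)%:C%C.
Let bet : C := (0 +i* (2 * pi))%C.

Let increment_bound (p : option 'I_r -> R) (e : R) : 0 < e -> exists2 del : R, 0 < del &
  forall (v : option 'I_r -> R) d, 0 < d <= del -> (forall k, `|v k - p k| <= d) ->
  forall k, let x := if k == k0 then (b - a) * (v None - p None) else 0 in
    let y := 2 * pi * (v (Some k) - p (Some k)) in
    modc (x +i* y)%C <= (`|b - a| + 2 * pi) * d /\
    modc (incr v p k - 1 - (x +i* y)%C) <= e * ((`|b - a| + 2 * pi) * d).
Proof.
move=> e0; have [d2 d20 h2] := cexp2_estimate e0.
have pi0 : 0 < 2 * pi :> R by rewrite mulr_gt0 // pi_gt0.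
set G := `|b - a| + 2 * pi; have G0 : 0 < G by rewrite ltr_wpDl.
exists (d2 / G / 2); first by rewrite !divr_gt0.
move=> v d /andP[d0 dd] hv k x y.
have xb : `|x| <= `|b - a| * d.
  rewrite /x; case: eqP => _; first by rewrite normrM ler_wpM2l.
  by rewrite normr0 mulr_ge0 // ltW.
have yb : `|y| <= 2 * pi * d.
  by rewrite normrM (gtr0_norm pi0) ler_wpM2l // (ltW pi0).
have xyb : `|x| + `|y| <= G * d by rewrite /G [leRHS]mulrDl lerD.
have Gd : G * d < d2.
  rewrite mulrC -ltr_pdivlMr // (le_lt_trans dd) // ltr_pdivrMr //.
  by rewrite ltr_pMr ?ltr1n // divr_gt0.
split; first by rewrite (le_trans (modc_ReIm _)).
have xs : `|x| < d2 by apply: le_lt_trans Gd; apply: le_trans xyb; rewrite lerDl.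
have ys : `|y| < d2 by apply: le_lt_trans Gd; apply: le_trans xyb; rewrite lerDr.
by rewrite (le_trans (h2 x y xs ys)) // ler_wpM2l // ltW.
Qed.

Let X_lipschitz (p : option 'I_r -> R) : exists2 K : R, 0 <= K & exists2 del : R, 0 < del &
  forall (v : option 'I_r -> R) d, 0 < d <= del -> (forall k, `|v k - p k| <= d) ->
  forall k, modc (X v 0 k - X p 0 k) <= K * d.
Proof.
have [del del0 hdel] := increment_bound p (@ltr01 R).
set G := `|b - a| + 2 * pi in hdel.
have G0 : 0 <= G by rewrite addr_ge0 // mulr_ge0 // pi_ge0.
pose B : R := \sum_k modc (X p 0 k).
have B0 : 0 <= B by apply: sumr_ge0 => k _; exact: modc_ge0.
exists (2 * G * B); first by rewrite !mulr_ge0.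
exists del => // v d d0 hv k; have [z1 z2] := hdel v d d0 hv k.
rewrite (XE v p) -[X in _ - X]mulr1 -mulrBr modcM.
have BX : modc (X p 0 k) <= B.
  by rewrite /B (bigD1 k) //= lerDl sumr_ge0 // => *; exact: modc_ge0.
have i1 : modc (incr v p k - 1) <= 2 * G * d.
  rewrite -[_ - 1](subrK (((if k == k0 then (b - a) * (v None - p None) else 0) +i*
    (2 * pi * (v (Some k) - p (Some k))))%C)) (le_trans (modcD _ _)) //.
  have -> : 2 * G * d = 1 * (G * d) + G * d by ring.
  exact: lerD.
rewrite (le_trans (ler_pM _ _ BX i1)) ?modc_ge0 //.
by rewrite le_eqVlt; apply/orP; left; apply/eqP; ring.
Qed.

Lemma annulus_bounded (g : V -> C) :
  (forall w, unit_box w -> {for X w, continuous g}) ->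
  exists B : R, forall w, unit_box w -> modc (g (X w)) <= B.
Proof.
move=> gc; apply: locally_bounded_box => p p01.
have /cvg_modcP/(_ 1 ltr01)/nbhs_rVP[e e0 he] := gc p p01.
have [K K0 [del del0 hK]] := X_lipschitz p.
have eK : 0 < e / (K + 1) by rewrite divr_gt0 // ltr_wpDl.
exists (Num.min del (e / (K + 1)) / 2); first by rewrite divr_gt0 // lt_min del0.
set d := _ / 2; have d0 : 0 < d by rewrite divr_gt0 // lt_min del0.
have dlt : d < Num.min del (e / (K + 1)).
  by rewrite /d ltr_pdivrMr // ltr_pMr ?ltr1n // lt_min del0.
move: dlt; rewrite lt_min => /andP[d1 d2].
exists (modc (g (X p)) + 1) => v _ hv.
rewrite -[g (X v)](subrK (g (X p))) (le_trans (modcD _ _)) // addrC lerD2l.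
apply: he => k; have dd : 0 < d <= del by rewrite d0 ltW.
rewrite (le_lt_trans (hK v d dd hv k)) //.
move: d2; rewrite ltr_pdivlMr ?ltr_wpDl //; nra.
Qed.

Hypothesis f_diff : forall w, unit_box w -> differentiable f (X w).

(** The hypothesis of the discrete Goursat theorem, by the chain rule: in the plane of [None] and
    [Some k0] only [x_k0] varies, and it is the exponential of an affine function of
    [alp w_None + bet w_k0]. *)
Let local_estimate (p : option 'I_r -> R) : unit_box p -> forall e : R, 0 < e ->
  exists2 del : R, 0 < del & exists (c : (option 'I_r -> R) -> C) (kap : C),
    (forall (v : option 'I_r -> R) x, c (upd v None x) = c v /\ c (upd v (Some k0) x) = c v) /\
    forall (v : option 'I_r -> R) d, unit_box v -> 0 < d <= del -> (forall k, `|v k - p k| <= d) ->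
      modc (f (X v) - c v - kap * (alp * (v None)%:C%C + bet * (v (Some k0))%:C%C))
        <= e * d.
Proof.
move=> p01 e e0; have [L hL] := differentiable_estimate (f_diff p01).
pose G : R := `|b - a| + 2 * pi.
have G0 : 0 <= G by rewrite addr_ge0 // mulr_ge0 // pi_ge0.
have [K K0 [d3 d30 hK]] := X_lipschitz p.
pose K' : R := modc (L k0) * modc (X p 0 k0) * G.
have K'0 : 0 <= K' by rewrite !mulr_ge0 ?modc_ge0.
have e1 : 0 < e / (2 * (K + 1)) by rewrite divr_gt0 // mulr_gt0 //; lra.
have e2 : 0 < e / (2 * (K' + 1)) by rewrite divr_gt0 // mulr_gt0 //; lra.
have [d1 d10 h1] := hL _ e1.
have [d2 d20 h2] := increment_bound p e2.
have d1K : 0 < d1 / (K + 1) by rewrite divr_gt0 // ltr_wpDl.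
pose d4 : R := Num.min (d1 / (K + 1)) (Num.min d2 d3) / 2.
have d40' : 0 < Num.min (d1 / (K + 1)) (Num.min d2 d3) by rewrite !lt_min d20 d30 d1K.
exists d4; first by rewrite divr_gt0.
(* The derivative of [f] with respect to [log x_k0]; the first-order terms in the other coordinates
   go into [c]. *)
pose kap := L k0 * X p 0 k0.
exists (fun v : option 'I_r -> R => f (X p) + \sum_(k | k != k0) L k * (X v 0 k - X p 0 k)
  - kap * (alp * (p None)%:C%C + bet * (p (Some k0))%:C%C)), kap.
split=> [v x|v d v01 /andP[d0 dd4] hv].
  split; congr (_ + _ - _); apply: eq_bigr => k kk0; congr (_ * (_ - _));
    rewrite !mxE /upd (negbTE kk0) //.
  by rewrite (inj_eq Some_inj) (negbTE kk0).
have : d < Num.min (d1 / (K + 1)) (Num.min d2 d3).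
  by rewrite (le_lt_trans dd4) // /d4 ltr_pdivrMr // ltr_pMr // ltr1n.
rewrite !lt_min => /andP[dd1 /andP[/ltW dd2 /ltW dd3]].
have {}dd1 : K * d < d1 by move: dd1; rewrite ltr_pdivlMr ?ltr_wpDl //; nra.
have d3' : 0 < d <= d3 by rewrite d0.
have d2' : 0 < d <= d2 by rewrite d0.
have Xb := hK v d d3' hv.
have [_] := h2 v d d2' hv k0; rewrite eqxx.
set z := (_ +i* _)%C => hz.
have zE : z = alp * (v None)%:C%C + bet * (v (Some k0))%:C%C -
    (alp * (p None)%:C%C + bet * (p (Some k0))%:C%C).
  by apply/eqP; rewrite eq_complex /=; apply/andP; split; apply/eqP; ring.
set t := alp * (v None)%:C%C + _ in zE *; set t' := alp * (p None)%:C%C + _ in zE *.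
have -> : f (X v) - (f (X p) + \sum_(k | k != k0) L k * (X v 0 k - X p 0 k) - kap * t')
    - kap * t =
    (f (X v) - f (X p) - \sum_k L k * (X v 0 k - X p 0 k)) +
    kap * (incr v p k0 - 1 - z).
  rewrite [\sum_k _](bigD1 k0) //= (XE v p k0) /kap zE.
  by ring.
have Kd : 0 <= K * d < d1 by rewrite dd1 mulr_ge0 // ltW.
have t1 := h1 (X v) (K * d) Kd Xb.
have t2 : modc (kap * (incr v p k0 - 1 - z)) <= modc kap * (e / (2 * (K' + 1)) * (G * d)).
  by rewrite modcM ler_wpM2l ?modc_ge0.
have t3 : modc kap * (e / (2 * (K' + 1)) * (G * d)) = K' * (e / (2 * (K' + 1))) * d.
  by rewrite /kap modcM /K'; ring.
have half (x : R) : 0 <= x -> x * (e / (2 * (x + 1))) <= e / 2.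
  move=> x0; have x1 : 0 < x + 1 by rewrite ltr_wpDl.
  have -> : x * (e / (2 * (x + 1))) = e / 2 * (x / (x + 1)).
    by field; rewrite gt_eqF.
  by rewrite ler_piMr ?divr_ge0 ?(ltW e0) // ler_pdivrMr // mul1r lerDl.
apply: (le_trans (modcD _ _)); apply: (le_trans (lerD t1 t2)); rewrite t3.
have -> : e * d = e / 2 * d + e / 2 * d by rewrite -mulrDl -splitr.
apply: lerD; first by rewrite mulrA ler_wpM2r ?(ltW d0) // mulrC half.
by rewrite ler_wpM2r ?(ltW d0) // half.
Qed.

(** Of the boundary terms in Goursat's theorem, the two at angles 0 and [2 pi] cancel by
    periodicity, and the other two are the averages over the inner and the outer torus. *)
Lemma torus_avg_annulus M (e : R) : (0 < M)%N -> 0 < e ->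
  exists n0, forall n, (n0 <= n)%N ->
    modc (torus_avg (M * 2 ^ n) f (upd rho k0 (expR b)) -
          torus_avg (M * 2 ^ n) f (upd rho k0 (expR a))) <= e.
Proof.
move=> M0 e0.
have [n0 hn0] := @discrete_goursat R _ (fun w => f (X w)) None (Some k0) alp bet M
  M0 isT local_estimate e e0.
exists n0 => n /hn0; set T := (M * 2 ^ n)%N.
have T0 : (0 < T)%N by rewrite muln_gt0 M0 expn_gt0.
pose F (j : 'I_r -> nat) := bet *
  (f (torus_pt (upd rho k0 (expR b)) (fun k => (j k)%:R / T%:R)) -
   f (torus_pt (upd rho k0 (expR a)) (fun k => (j k)%:R / T%:R))).
rewrite (eq_grid_avg (G := fun j => F (fun k => j (Some k)))) => [|j _]; last first.
  rewrite /= /F; set w := fun k => (j k)%:R / T%:R.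
  have -> : X (upd w (Some k0) 0) = X (upd w (Some k0) 1).
    apply/rowP => k; rewrite !mxE /upd /= (inj_eq Some_inj).
    by case: eqP => // _; rewrite mulr0 mulr1 cis0 cis2pi.
  rewrite subrr mulr0 add0r; congr (_ * (f _ - f _)); rewrite /X /=.
    by rewrite /upd eqxx mul1r addrC subrK.
  by rewrite /upd eqxx mul0r addr0.
rewrite grid_avg_option // grid_avgZ modcM grid_avgB => h.
(* The factor [bet] may be dropped, as [|bet| = 2 pi] is at least 1. *)
apply: le_trans h; rewrite ler_peMl ?modc_ge0 //.
have := Im_le_modc bet; rewrite /= => h; apply: le_trans h.
rewrite ger0_norm ?mulr_ge0 ?pi_ge0 //; have := @pi_ge2 R; lra.
Qed.

End TorusAverage.

(** * Polar coordinates and Reinhardt domains *)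

Section Reinhardt.
Variables (R : realType) (r : nat).
Local Notation C := (cplx R).
Local Notation V := 'rV[C]_r.
Implicit Types (x y : V) (rho : 'I_r -> R).

Lemma polar (z : C) : exists t, z = (modc z)%:C%C * cis t.
Proof.
have [->|z0] := eqVneq z 0; first by exists 0; rewrite modc0 mul0r.
have m0 : modc z != 0 by rewrite modc_eq0.
pose w := z / (modc z)%:C%C.
have w1 : modc w = 1 by rewrite modcM modcV modc_real ger0_norm ?modc_ge0 // divff.
suff [t wt] : exists t, w = cis t.
  by exists t; rewrite -wt mulrC divfK // -modc_eq0 modc_real ger0_norm ?modc_ge0.
case: w w1 => c s; rewrite /modc normc_def /= => /(congr1 (fun u => u ^+ 2)).
rewrite sqr_sqrtr ?addr_ge0 ?sqr_ge0 // expr1n => cs1.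
have c1 : -1 <= c <= 1 by apply/andP; split; have := sqr_ge0 s; nra.
have cK : cos (acos c) = c by rewrite acosK // in_itv.
have sE : sin (acos c) = `|s|.
  by rewrite sin_acos // -cs1 addrC addKr sqrtr_sqr.
have [s0|s0] := leP 0 s.
  by exists (acos c); rewrite /cis cK sE ger0_norm.
by exists (- acos c); rewrite /cis cosN sinN cK sE ltr0_norm // opprK.
Qed.

Definition near_radii x (del : R) : set ('I_r -> R) :=
  [set rho | forall k, 0 < rho k /\ `|modc (x 0 k) - rho k| < del].

(** The point with the angles of [x] and the radii [rho] lies in the cube around [x], and a rotation
    takes it to any point of its torus. Zero coordinates of [x] may be given any angle. *)
Lemma reinhardt_hull (Y : set V) x del rho v : reinhardt Y ->
  (forall y, (forall k, modc (y 0 k - x 0 k) < del) -> Y y) ->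
  near_radii x del rho -> Y (torus_pt rho v).
Proof.
move=> Yr hY hrho.
have [t ht] : {t : 'I_r -> R & forall k, x 0 k = (modc (x 0 k))%:C%C * cis (t k)}.
  apply: (choice (P := fun k t => x 0 k = (modc (x 0 k))%:C%C * cis t)) => k.
  exact: polar.
pose y : V := \row_k ((rho k)%:C%C * cis (t k)).
have -> : torus_pt rho v = \row_k (cis (2 * pi * v k - t k) * y 0 k).
  by apply/rowP => k; rewrite !mxE mulrCA -cisD subrK.
apply: (Yr y); apply: hY => k; rewrite mxE (ht k) -mulrBl modcM modc_cis mulr1.
by rewrite -raddfB /= modc_real distrC; case: (hrho k).
Qed.

Lemma near_radii_self x del : 0 < del -> exists rho, near_radii x del rho.
Proof.
move=> d0; exists (fun k => modc (x 0 k) + del / 2) => k; split.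
  by rewrite ltr_wpDl ?modc_ge0 // divr_gt0.
rewrite opprD addrA subrr add0r normrN gtr0_norm ?divr_gt0 //.
by rewrite ltr_pdivrMr // ltr_pMr // ltr1n.
Qed.

Lemma near_radii_shift x y d1 d2 rho : (forall k, modc (y 0 k - x 0 k) < d2) ->
  near_radii y d1 rho -> near_radii x (d1 + d2) rho.
Proof.
move=> hy hrho k; have [r0 hr] := hrho k; split => //.
have := hy k.
have h1 : modc (y 0 k) <= modc (x 0 k) + modc (y 0 k - x 0 k).
  by rewrite (le_trans _ (modcD _ _)) // addrC subrK.
have h2 : modc (x 0 k) <= modc (y 0 k) + modc (y 0 k - x 0 k).
  by rewrite modcB (le_trans _ (modcD _ _)) // addrC subrK.
move: hr; rewrite !ltr_norml => /andP[? ?] ?; apply/andP; split; lra.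
Qed.

Lemma torus_pt_near x rho v : (forall k, 0 < rho k) -> x = torus_pt rho v ->
  forall del, 0 < del -> near_radii x del rho.
Proof.
by move=> r0 -> del d0 k; rewrite modc_torus_pt (gtr0_norm (r0 k)) subrr normr0.
Qed.

Lemma expR_between (a b u c d : R) : 0 <= u <= 1 ->
  c < expR a < d -> c < expR b < d -> c < expR (a + u * (b - a)) < d.
Proof.
move=> /andP[u0 u1] /andP[ca ad] /andP[cb bd].
have [ab|/ltW ba] := leP a b.
  rewrite (lt_le_trans ca) ?ler_expR ?lerDl ?mulr_ge0 ?subr_ge0 //=.
  rewrite (le_lt_trans _ bd) // ler_expR; nra.
rewrite (le_lt_trans _ ad) ?andbT ?ler_expR ?gerDl; last by nra.
rewrite (lt_le_trans cb) // ler_expR; nra.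
Qed.

(** * Laurent coefficients do not depend on the torus *)

Section LaurentCoefficient.
Variables (Y : set V) (G : V -> C) (M : nat) (lam : 'rV[int]_r).
Hypothesis M_gt0 : (0 < M)%N.
Hypothesis Y_open : open Y.
Hypothesis Y_connected : connected Y.
Hypothesis Y_reinhardt : reinhardt Y.
Hypothesis G_continuous : forall x, Y x -> {for x, continuous G}.
Hypothesis G_approx : forall rho, (forall k, 0 < rho k) -> Y (torus_pt rho (fun=> 0)) ->
  forall e : R, 0 < e -> exists H : V -> C, (forall x, Y x -> differentiable H x) /\
    forall x, Y x -> (forall k, modc (x 0 k) <= rho k) ->
      modc (G x - H x) <= e * modc (G x).

Definition laurent_avg n rho : C :=
  torus_avg (M * 2 ^ n) (fun x => mono x (- lam) * G x) rho.

(** Goursat applies to the holomorphic approximant [H]; replacing [G] by [H] on each of the two tori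
    costs [e / 3], as [mono x (- lam) * G x] is bounded on the annulus. *)
Lemma laurent_avg_step rho k0 (a b : R) : (forall k, 0 < rho k) ->
  (forall w : option 'I_r -> R, unit_box w -> Y (torus_pt
    (upd rho k0 (expR (a + w None * (b - a)))) (fun k => w (Some k)))) ->
  forall e : R, 0 < e -> exists n0, forall n, (n0 <= n)%N ->
    modc (laurent_avg n (upd rho k0 (expR b)) -
          laurent_avg n (upd rho k0 (expR a))) <= e.
Proof.
move=> rho0 hY e e0.
have upd0 (s : R) k : 0 < upd rho k0 (expR s) k.
  by rewrite /upd; case: eqP => // _; rewrite expR_gt0.
have X0 (s : R) v k : torus_pt (upd rho k0 (expR s)) v 0 k != 0.
  by rewrite -modc_gt0 modc_torus_pt normr_gt0 gt_eqF.
have [|B hB] := @annulus_bounded R r rho k0 a b (fun x => mono x (- lam) * G x).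
  move=> w w01; set x := torus_pt _ _.
  have mc : {for x, continuous (fun y => mono y (- lam))}.
    apply: differentiable_continuous; apply: differentiable_mono => k.
    by rewrite X0 orbT.
  exact: cvgM mc (G_continuous (hY w w01)).
(* The whole annulus lies in the polydisc of its outer torus, so one approximant serves all of
   it. *)
pose s := Num.max a b.
have Ys : Y (torus_pt (upd rho k0 (expR s)) (fun=> 0)).
  rewrite /s; have [ab|ba] := leP a b.
    have := hY (fun k => if k is None then 1 else 0).
    rewrite mul1r [a + _]addrC subrK; apply.
    by case=> [k|]; rewrite ?lexx ?ler01.
  have := hY (fun=> 0); rewrite mul0r addr0; apply => k; by rewrite lexx ler01.
pose B' : R := `|B| + 1; have B0 : 0 < B' by rewrite /B' ltr_wpDl.
have e1 : 0 < e / 3 / B' by rewrite !divr_gt0.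
have [H [Hd HG]] := G_approx (upd0 s) Ys e1.
have e3 : 0 < e / 3 by rewrite divr_gt0.
have [|n0 hn0] := @torus_avg_annulus R r (fun x => mono x (- lam) * H x) rho k0 a b
    _ M (e / 3) M_gt0 e3.
  move=> w w01; apply: (@differentiableM _ _ (fun x => mono x (- lam)) H).
    by apply: differentiable_mono => k; rewrite X0 orbT.
  exact/Hd/hY.
exists n0 => n /hn0; set T := (M * 2 ^ n)%N => hH.
have T0 : (0 < T)%N by rewrite muln_gt0 M_gt0 expn_gt0.
have close (c : R) : 0 <= c <= 1 ->
    modc (laurent_avg n (upd rho k0 (expR (a + c * (b - a)))) -
      torus_avg T (fun x => mono x (- lam) * H x)
        (upd rho k0 (expR (a + c * (b - a))))) <= e / 3.
  move=> c01; rewrite /laurent_avg /torus_avg -grid_avgB; apply: modc_grid_avg => // j hj.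
  pose w (k : option 'I_r) : R := if k is Some k' then (j k')%:R / T%:R else c.
  have w01 : unit_box w.
    move=> [k|] //=; rewrite divr_ge0 //= ler_pdivrMr ?ltr0n // mul1r ler_nat.
    exact: ltnW.
  set x := torus_pt _ _; have Yx : Y x by exact: hY w01.
  rewrite -mulrBr modcM.
  have xs k : modc (x 0 k) <= upd rho k0 (expR s) k.
    rewrite modc_torus_pt gtr0_norm // /upd; case: eqP => // _.
    rewrite ler_expR /s le_max; case/andP: c01 => c0 c1.
    have [ab|/ltW ba] := leP a b; apply/orP; [right|left]; nra.
  have hGH := HG x Yx xs; have hBx : modc (mono x (- lam) * G x) <= B := hB w w01.
  apply: (le_trans (ler_wpM2l (modc_ge0 _) hGH)); rewrite mulrCA -modcM.
  apply: (le_trans (ler_wpM2l (ltW e1) hBx)).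
  rewrite mulrAC ler_pdivrMr // ler_wpM2l ?(ltW e3) //.
  by rewrite /B' (le_trans (ler_norm B)) // lerDl.
have c1 := close 1; rewrite mul1r [a + _]addrC subrK lexx ler01 in c1.
have c0 := close 0; rewrite mul0r addr0 lexx ler01 in c0.
have {}c1 := c1 isT; have {}c0 := c0 isT.
set u1 := laurent_avg _ _ in c1 *; set u0 := laurent_avg _ _ in c0 *.
set v1 := torus_avg _ _ _ in c1 hH; set v0 := torus_avg _ _ _ in c0 hH.
have -> : u1 - u0 = (u1 - v1) + (v1 - v0) + (v0 - u0) by ring.
have -> : e = e / 3 + e / 3 + e / 3 by field.
rewrite (le_trans (modcD _ _)) // lerD ?(modcB v0) //.
by rewrite (le_trans (modcD _ _)) // lerD.
Qed.

Variable bet : C.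

Let good rho := forall e : R, 0 < e -> exists n0, forall n, (n0 <= n)%N ->
  modc (laurent_avg n rho - bet) <= e.

Let good_step rho k0 (t : R) :
  (forall w : option 'I_r -> R, unit_box w -> Y (torus_pt
    (upd rho k0 (expR (ln (rho k0) + w None * (ln t - ln (rho k0)))))
    (fun k => w (Some k)))) ->
  (forall k, 0 < rho k) -> 0 < t -> good rho -> good (upd rho k0 t).
Proof.
move=> hY r0 t0 hrho e e0; have e2 : 0 < e / 2 by rewrite divr_gt0.
have [n0 hn0] := hrho _ e2.
have [n1 hn1] := laurent_avg_step r0 hY e2.
exists (maxn n0 n1) => n; rewrite geq_max => /andP[/hn0 h0 /hn1].
rewrite !lnK ?posrE //.
have -> : upd rho k0 (rho k0) = rho.
  by apply/funext => k; rewrite /upd; case: eqP => [->|].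
move=> h1; set u := laurent_avg _ _ in h1 *; set u' := laurent_avg _ _ in h0 h1.
have -> : u - bet = (u - u') + (u' - bet) by ring.
by rewrite (splitr e) (le_trans (modcD _ _)) // lerD.
Qed.

Let good_near x del rho rho' :
  (forall y, (forall k, modc (y 0 k - x 0 k) < del) -> Y y) ->
  near_radii x del rho -> near_radii x del rho' -> good rho -> good rho'.
Proof.
move=> hx hr hr' grho.
(* The radii are changed one at a time; every intermediate torus stays over the cube around [x]. *)
pose h (j : nat) : 'I_r -> R := fun k => if (k < j)%N then rho' k else rho k.
have hN j : near_radii x del (h j) by move=> k; rewrite /h; case: ifP.
have gh (j : nat) : (j <= r)%N -> good (h j).
  elim: j => [|j IH] jr.
    by rewrite (_ : h 0%N = rho) //; apply/funext.
  have -> : h j.+1 = upd (h j) (Ordinal jr) (rho' (Ordinal jr)).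
    apply/funext => k; rewrite /h /upd ltnS leq_eqVlt -val_eqE /=.
    by case: eqP => //= kj; congr rho'; exact/val_inj.
  apply: good_step => [w w01| k||]; [|by case: (hN j k)|by case: (hr' (Ordinal jr))|].
    apply: reinhardt_hull hx _ => // k; have [h0 h1] := hN j k.
    rewrite /upd; case: eqP => // ->; split; first exact: expR_gt0.
    have [p0 p1] := hN j (Ordinal jr); have [p0' p1'] := hr' (Ordinal jr).
    set m := modc _ in p1 p1' *.
    have := @expR_between (ln (h j (Ordinal jr))) (ln (rho' (Ordinal jr)))
      (w None) (m - del) (m + del) (w01 None).
    rewrite !lnK ?posrE //.
    move: p1 p1'; rewrite !ltr_norml => /andP[a1 a2] /andP[b1 b2] hb.
    have /andP[] : m - del < expR (ln (h j (Ordinal jr)) +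
       w None * (ln (rho' (Ordinal jr)) - ln (h j (Ordinal jr)))) < m + del.
      by apply: hb; apply/andP; split; lra.
    by move=> ? ?; apply/andP; split; lra.
  exact: IH (ltnW jr).
suff -> : rho' = h r by exact: gh.
by apply/funext => k; rewrite /h ltn_ord.
Qed.

(** [Y] is connected, but so far its tori with positive radii are not known to be: points with zero
    coordinates belong to [Y] and carry no such torus. Goodness is therefore made a property of
    points, through all nearby tori; this set is open, relatively closed and contains 0. *)
Lemma laurent_avg_cvg (d0 : R) rho : 0 < d0 -> Y 0 ->
  (forall rho', (forall k, 0 < rho' k < d0) -> good rho') ->
  (forall k, 0 < rho k) -> Y (torus_pt rho (fun=> 0)) -> good rho.
Proof.
move=> d00 Y0 g0 rho0 Yrho.
pose O : set V := [set x | exists2 del : R, 0 < del & forall rho, near_radii x del rho -> good rho].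
have oO : open O.
  move=> x [del del0 hx]; have del2 : 0 < del / 2 by rewrite divr_gt0.
  apply/nbhs_rVP; exists (del / 2) => // y hy; exists (del / 2) => // rho' hr.
  by apply: hx; rewrite (splitr del); apply: near_radii_shift hy hr.
have YO : Y `&` O = Y.
  apply: Y_connected; first (exists 0; split => //).
  - exists d0 => // rho' hr; apply: g0 => k; have [-> /=] := hr k.
    by rewrite mxE modc0 sub0r normrN => /ltr_normlW.
  - by exists O.
  exists (closure O); first exact: closed_closure.
  apply/seteqP; split=> x [Yx Ox]; split => //; first exact: subset_closure.
  have /nbhs_rVP[del del0 hx] := Y_open Yx.
  have del2 : 0 < del / 2 by rewrite divr_gt0.
  have nx : nbhs x [set y | forall k, modc (y 0 k - x 0 k) < del / 2].
    by apply/nbhs_rVP; exists (del / 2).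
  have [y [[dy dy0 hy] hyx]] := Ox _ nx.
  have md : 0 < Num.min dy (del / 2) by rewrite lt_min dy0.
  have [rho' hr'] := near_radii_self y md.
  have gr' : good rho'.
    by apply: hy => k; have [? ] := hr' k; rewrite lt_min => /andP[].
  exists del => // rho2 hr2; apply: (good_near hx _ hr2 gr').
  rewrite (splitr del); apply: near_radii_shift hyx _ => k.
  by have [? ] := hr' k; rewrite lt_min => /andP[].
have : Y (torus_pt rho (fun=> 0)) by [].
rewrite -YO => -[_ [del del0]]; apply.
exact: torus_pt_near rho0 erefl _ del0.
Qed.

End LaurentCoefficient.
End Reinhardt.

Lemma cvg_sumC (R : realType) (T : Type) (Fi : set_system T) {FF : Filter Fi}
    (I : Type) (s : seq I) (P : pred I) (f : I -> T -> cplx R) (l : I -> cplx R) :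
  (forall i, P i -> f i @ Fi --> l i) ->
  (fun t => \sum_(i <- s | P i) f i t) @ Fi --> \sum_(i <- s | P i) l i.
Proof.
move=> hf; elim: s => [|i s IH].
  rewrite big_nil (_ : (fun t => _) = cst 0); first exact: cvg_cst.
  by apply/funext => t; rewrite big_nil.
rewrite big_cons; have [Pi|nPi] := boolP (P i); last first.
  rewrite (_ : (fun t => _) = (fun t => \sum_(i <- s | P i) f i t)) //.
  by apply/funext => t; rewrite big_cons (negbTE nPi).
rewrite (_ : (fun t => _) = (f i) + (fun t => \sum_(i <- s | P i) f i t)).
  exact: cvgD (hf i Pi) IH.
by apply/funext => t; rewrite big_cons Pi.
Qed.

(** * Continuity of power series and of infinite products *)

Section LocallyUniformLimits.
Variables (R : realType) (r : nat).
Local Notation C := (cplx R).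
Local Notation V := 'rV[C]_r.
Implicit Types (x y : V) (f : V -> C).

Lemma continuous_rVP f x : {for x, continuous f} <->
  forall e : R, 0 < e -> \forall y \near x, modc (f y - f x) <= e.
Proof. exact: (@cvg_modcP R V (nbhs x) _ f (f x)). Qed.

Lemma continuous_unif_approx f x :
    (forall e : R, 0 < e -> exists2 h : V -> C, {for x, continuous h} &
      \forall y \near x, modc (f y - h y) <= e) ->
  {for x, continuous f}.
Proof.
move=> hf; apply/continuous_rVP => e e0; have e3 : 0 < e / 3 by rewrite divr_gt0.
have [h /continuous_rVP hc fh] := hf _ e3.
have hx : modc (f x - h x) <= e / 3 by exact: (nbhs_singleton fh).
near=> y.
have -> : f y - f x = (f y - h y) + (h y - h x) - (f x - h x) by ring.
have -> : e = e / 3 + e / 3 + e / 3 by field.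
rewrite (le_trans (modcD _ _)) // modcN lerD //.
rewrite (le_trans (modcD _ _)) // lerD //; first by near: y; exact: fh.
by near: y; exact: hc.
Unshelve. all: by end_near. Qed.

(* [x] ranges over the closed polydisc whose radii are the moduli of the
   coordinates of [y]. *)
Definition polydisc y : set V := [set x | forall k, modc (x 0 k) <= modc (y 0 k)].

(** Slightly larger radii give a point of [Y] that dominates a neighbourhood of [x], so absolute
    convergence at that point is uniform near [x]. *)
Lemma reinhardt_larger (Y : set V) x : open Y -> reinhardt Y -> Y x ->
  exists rho : 'I_r -> R, [/\ forall k, 0 < rho k, Y (torus_pt rho (fun=> 0)) &
    \forall y \near x, polydisc (torus_pt rho (fun=> 0)) y].
Proof.
move=> Yo Yr Yx; have /nbhs_rVP[del del0 hx] := Yo _ Yx.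
have d2 : 0 < del / 2 by rewrite divr_gt0.
have d2' : del / 2 < del by rewrite ltr_pdivrMr // ltr_pMr // ltr1n.
pose rho k := modc (x 0 k) + del / 2.
have r0 k : 0 < rho k by rewrite ltr_wpDl ?modc_ge0.
exists rho; split => //.
  apply: reinhardt_hull hx _ => // k; split => //.
  by rewrite opprD addrA subrr add0r normrN gtr0_norm.
apply/nbhs_rVP; exists (del / 2) => // y hy k.
rewrite modc_torus_pt gtr0_norm // /rho -[y 0 k](subrK (x 0 k)).
by rewrite (le_trans (modcD _ _)) // addrC lerD2l ltW.
Qed.

Section Monomials.
Variables (S : set 'rV[int]_r) (c : 'rV[int]_r -> C) (ex : 'rV[int]_r -> 'rV[int]_r).
Hypothesis ex_Qplus : forall b, S b -> Qplus (ex b).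
(** Covers the Taylor series, with [ex] the identity, and the product over roots, with [c] constant
    equal to [q] and [ex b] equal to [m_b b]. *)
Let term x b : C := c b * mono x (ex b).

Lemma term_le x y b : polydisc y x -> b \in S -> modc (term x b) <= modc (term y b).
Proof.
move=> xy /set_mem Sb; rewrite /term !modcM.
exact: ler_wpM2l (modc_ge0 _) _ _ (mono_le (ex_Qplus Sb) xy).
Qed.

Lemma tail_term y x A e : polydisc y x -> tail_le S (term y) A e ->
  tail_le S (term x) A e.
Proof. by move=> xy; apply: tail_le_mono => b; exact: term_le. Qed.

Lemma continuous_term x b : S b -> {for x, continuous (fun y => term y b)}.
Proof.
move=> Sb; apply: differentiable_continuous.
apply: (@differentiableM _ _ (cst (c b)) (fun y => mono y (ex b))).
  exact: differentiable_cst.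
by apply: differentiable_mono => k; rewrite ex_Qplus.
Qed.

Lemma differentiable_pprod1B x (A : {fset 'rV[int]_r}) :
  differentiable (fun y => \prod_(b <- A | b \in S) (1 - term y b)) x.
Proof.
apply: differentiable_prod => b /set_mem Sb.
rewrite (_ : (fun y => _) = cst 1 - (fun y => term y b)); last exact/funext.
apply: differentiableB; first exact: differentiable_cst.
apply: (@differentiableM _ _ (cst (c b)) (fun y => mono y (ex b))).
  exact: differentiable_cst.
by apply: differentiable_mono => k; rewrite ex_Qplus.
Qed.

Lemma continuous_usum y x : abs_summable S (term y) ->
  (\forall z \near x, polydisc y z) -> {for x, continuous (fun z => usum S (term z))}.
Proof.
move=> /abs_summable_tail hs xy; apply: continuous_unif_approx => e e0.
have [A hA] := hs e e0.
exists (fun z => \sum_(b <- A | b \in S) term z b).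
  apply: (@cvg_sumC R V (nbhs x) (nbhs_filter x)) => b /set_mem Sb.
  exact: continuous_term.
apply: filterS xy => z yz; apply: usum_approx => [e' /hs[A' hA']|].
  by exists A'; exact: tail_term yz _.
exact: tail_term yz _.
Qed.

Lemma uprod1B_unif_approx y A e : abs_summable S (term y) -> tail_le S (term y) A e ->
  e <= 2^-1 -> forall x, polydisc y x ->
  modc (uprod1B S (term x) - \prod_(b <- A | b \in S) (1 - term x b)) <=
    2 * e * modc (\prod_(b <- A | b \in S) (1 - term x b)).
Proof.
move=> /abs_summable_tail hs hA e2 x xy.
have hx e' : 0 < e' -> exists A', tail_le S (term x) A' e'.
  by move=> /hs[A' hA']; exists A'; exact: tail_term xy hA'.
exact: (uprod1B_approx hx (tail_term xy hA) e2).
Qed.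

Lemma continuous_uprod1B y x : abs_summable S (term y) ->
  (\forall z \near x, polydisc y z) ->
  {for x, continuous (fun z => uprod1B S (term z))}.
Proof.
move=> hs xy; apply: continuous_unif_approx => e e0.
set p := modc (uprod1B S (term x)).
have p0 : 0 <= p by exact: modc_ge0.
(* With [e' <= 1/4] the relative error is at most 1/2, whence [|PA x| <= 2 p], and [|PA|] is at most
   [2 p + 1] near [x]. *)
pose e' : R := Num.min 4^-1 (e / (2 * (2 * p + 1))).
have q0 : 0 < 2 * (2 * p + 1) by lra.
have e'0 : 0 < e' by rewrite lt_min invr_gt0 ltr0n divr_gt0.
have e'4 : e' <= 4^-1 by rewrite ge_min lexx.
have e'2 : e' <= 2^-1 by lra.
have e'e : 2 * e' * (2 * p + 1) <= e.
  have : e' <= e / (2 * (2 * p + 1)) by rewrite ge_min lexx orbT.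
  by rewrite ler_pdivlMr // => h; lra.
have [A hA] := abs_summable_tail hs e'0.
have hP := uprod1B_unif_approx hs hA e'2.
set PA := fun z => \prod_(b <- A | b \in S) (1 - term z b).
have cA : {for x, continuous PA}.
  exact/differentiable_continuous/differentiable_pprod1B.
exists PA => //.
have xx : polydisc y x by exact: nbhs_singleton xy.
have PAx : modc (PA x) <= 2 * p.
  have h1 := hP x xx; rewrite -/(PA x) in h1.
  have h2 : modc (PA x) <= p + modc (uprod1B S (term x) - PA x).
    by rewrite -{1}[PA x](subrK (uprod1B S (term x))) addrC (le_trans (modcD _ _)) // modcB.
  have := modc_ge0 (PA x); nra.
move/continuous_rVP : cA => /(_ 1 ltr01) cA.
near=> z.
have yz : polydisc y z by near: z; exact: xy.
rewrite (le_trans (hP z yz)) // (le_trans _ e'e) // ler_wpM2l //; first by lra.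
have zx : modc (PA z - PA x) <= 1 by near: z; exact: cA.
rewrite -/(PA z) -[PA z](subrK (PA x)) (le_trans (modcD _ _)) //.
by rewrite addrC lerD.
Unshelve. all: by end_near. Qed.

(** If the factor at [b] vanished, so would a partial product containing it, and the relative
    estimate would force the limit to be 0. *)
Lemma uprod1B_factor_neq0 x b : abs_summable S (term x) ->
  uprod1B S (term x) != 0 -> S b -> 1 - term x b != 0.
Proof.
move=> hs + Sb; apply: contra_neq => hb.
have h2 : (0 : R) < 2^-1 by rewrite invr_gt0.
have [A hA] := abs_summable_tail hs h2.
have hA' : tail_le S (term x) (b |` A)%fset 2^-1.
  move=> B; apply: le_trans (hA B); rewrite big_mkcond [leRHS]big_mkcond.
  apply: ler_sum => b' _; rewrite !inE negb_or.
  by case: (b' \in S) => //=; case: (b' == b) => //=; case: ifP; rewrite ?modc_ge0.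
have := uprod1B_unif_approx hs hA' (lexx _) (fun k => lexx _).
have -> : \prod_(b' <- (b |` A)%fset | b' \in S) (1 - term x b') = 0.
  rewrite (perm_big _ (perm_fsetU [fset b]%fset A)) big_cat /= big_mkcond.
  by rewrite big_seq_fset1 mem_set // hb mul0r.
rewrite subr0 modc0 mulr0 => h; apply/eqP; rewrite -modc_eq0.
by rewrite eq_le h modc_ge0.
Qed.
End Monomials.
End LocallyUniformLimits.

(** * Coefficients of power series as averages *)

Section PowerSeries.
Variables (R : realType) (r : nat).
Local Notation C := (cplx R).
Local Notation V := 'rV[C]_r.
Implicit Types (rho : 'I_r -> R) (lam mu : 'rV[int]_r).

(** The average factors into one character sum per coordinate. A grid of order [N] sees exponents
    only modulo [N]. *)
Lemma torus_avg_mono N rho mu : (0 < N)%N ->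
  torus_avg N (fun x => mono x mu) rho =
  if [forall k, (N %| mu 0%R k)%Z] then \prod_k (rho k)%:C%C ^ mu 0 k else 0.
Proof.
move=> N0; pose z : C := cis (2 * pi / N%:R).
have -> : torus_avg N (fun x => mono x mu) rho = (\prod_k (rho k)%:C%C ^ mu 0 k) *
    ((N ^ r)%:R^-1 * \prod_k \sum_(j < N) z ^ (mu 0 k * j%:Z)).
  rewrite bigA_distr_bigA /= mulrCA /torus_avg /grid_avg card_ord; congr (_ * _).
  rewrite mulr_sumr; apply: eq_bigr => j _; rewrite -big_split /=.
  apply: eq_bigr => k _; rewrite mxE expfzMl; congr (_ * _).
  rewrite /z -!cisMz; congr cis; rewrite rmorphM /= -[(j k)%:~R]/((j k)%:R); ring.
under [X in _ * (_ * X)]eq_bigr do rewrite sum_cis_exprz //.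
case: ifPn => [/forallP h|]; last first.
  rewrite negb_forall => /existsP[k nk].
  by rewrite [X in _ * (_ * X)](bigD1 k) //= (negbTE nk) mul0r !mulr0.
under [X in _ * (_ * X)]eq_bigr => k _ do rewrite h.
rewrite prodr_const card_ord natrX mulVf ?mulr1 // expf_neq0 // pnatr_eq0.
by rewrite -lt0n.
Qed.

Lemma torus_avgB N (f g : V -> C) rho :
  torus_avg N (fun x => f x - g x) rho = torus_avg N f rho - torus_avg N g rho.
Proof. exact: grid_avgB. Qed.

Lemma torus_avgZ N c (f : V -> C) rho :
  torus_avg N (fun x => c * f x) rho = c * torus_avg N f rho.
Proof. exact: grid_avgZ. Qed.

Lemma torus_avg_sum N (I : Type) (s : seq I) (P : pred I) (F : I -> V -> C) rho :
  torus_avg N (fun x => \sum_(i <- s | P i) F i x) rho =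
  \sum_(i <- s | P i) torus_avg N (F i) rho.
Proof. exact: grid_avg_sum. Qed.

Lemma eq_torus_avg N (f g : V -> C) rho :
  (forall v, f (torus_pt rho v) = g (torus_pt rho v)) ->
  torus_avg N f rho = torus_avg N g rho.
Proof. by move=> h; apply: eq_grid_avg. Qed.

Lemma modc_torus_avg N (f : V -> C) rho (B : R) : (0 < N)%N ->
  (forall v, unit_box v -> modc (f (torus_pt rho v)) <= B) ->
  modc (torus_avg N f rho) <= B.
Proof.
move=> N0 h; apply: modc_grid_avg => // j hj; apply: h => k.
by rewrite divr_ge0 //= ler_pdivrMr ?ltr0n // mul1r ler_nat ltnW.
Qed.

Lemma torus_pt_neq0 rho v k : (forall k, 0 < rho k) -> torus_pt rho v 0 k != 0 :> C.
Proof. by move=> r0; rewrite -modc_gt0 modc_torus_pt normr_gt0 gt_eqF. Qed.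

Variable a : 'rV[int]_r -> C.
Let term (x : V) lam : C := a lam * mono x lam.

(** A finite part of the series has exact averages on fine grids; the tail is uniformly small on the
    torus, also after multiplication by [x ^ (- lam)], whose modulus is the constant [w] there. *)
Lemma laurent_avg_usum M lam rho : (0 < M)%N -> (forall k, 0 < rho k) ->
  abs_summable Qplus (term (torus_pt rho (fun=> 0))) ->
  forall e : R, 0 < e -> exists n0, forall n, (n0 <= n)%N ->
    modc (laurent_avg (fun x => usum Qplus (term x)) M lam n rho -
      (if lam \in Qplus then a lam else 0)) <= e.
Proof.
move=> M0 r0 hs e e0; set y := torus_pt rho _ in hs.
pose w : R := modc (mono y (- lam)).
have w0 : 0 < w.
  by rewrite modc_gt0 mono_neq0 // => k; exact: torus_pt_neq0.
have ew : 0 < e / w by rewrite divr_gt0.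
have [A0 hA0] := abs_summable_tail hs ew; pose A := (lam |` A0)%fset.
have hA : tail_le Qplus (term y) A (e / w).
  move=> B; apply: le_trans (hA0 B); rewrite big_mkcond [leRHS]big_mkcond.
  apply: ler_sum => b' _; rewrite !inE negb_or.
  by case: (b' \in Qplus) => //=; case: (b' == lam) => //=; case: ifP; rewrite ?modc_ge0.
pose SA (x : V) := \sum_(b <- A | b \in Qplus) term x b.
(* Bounds every entry of [b - lam] for [b] in [A], so that modulo a larger [N] only [b = lam] has
   exponent 0. *)
pose n0 := (\sum_(b <- A) \sum_k absz ((b - lam)%R 0%R k))%N.
exists n0 => n n0n; set N := (M * 2 ^ n)%N.
have N0 : (0 < N)%N by rewrite muln_gt0 M0 expn_gt0.
have nN : (n0 < N)%N.
  apply: (leq_ltn_trans n0n); apply: (@leq_trans (2 ^ n)); first exact: ltn_expl.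
  by rewrite leq_pmull.
have sA : torus_avg N (fun x => mono x (- lam) * SA x) rho =
    if lam \in Qplus then a lam else 0.
  have -> : torus_avg N (fun x => mono x (- lam) * SA x) rho =
      torus_avg N (fun x => \sum_(b <- A | b \in Qplus) a b * mono x (b - lam)) rho.
    apply: eq_torus_avg => v; rewrite /SA mulr_sumr; apply: eq_bigr => b _.
    rewrite /term mulrCA -monoD => [|k]; last exact: torus_pt_neq0.
    by rewrite addrC.
  rewrite torus_avg_sum big_seq_cond.
    under eq_bigr => b /andP[bA _].
      rewrite torus_avgZ torus_avg_mono //.
      rewrite (_ : [forall k, _] = (b == lam)); last first.
        apply/forallP/eqP => [hb|->]; last by move=> k; rewrite subrr mxE dvdz0.
        apply/eqP; rewrite -subr_eq0; apply/eqP/rowP => k; rewrite [RHS]mxE.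
        apply/eqP/negP => /negP bk; have := hb k; rewrite dvdzE => /dvdn_leq.
        rewrite absz_gt0 bk => /(_ isT); rewrite leqNgt => /negP; apply.
        apply: leq_ltn_trans nN; rewrite /n0 (big_fsetD1 b) //= (bigD1 k) //= -addnA.
        exact: leq_addr.
      over.
    rewrite -big_seq_cond.
    rewrite (perm_big _ (perm_fsetU [fset lam]%fset A0)) big_cat /= addrC.
    rewrite big1_seq ?add0r => [|b]; last first.
      rewrite mem_filter !inE => /andP[_ /andP[/negbTE -> _]].
      by rewrite mulr0.
    rewrite big_mkcond big_seq_fset1 eqxx; case: ifP => // _.
    by rewrite big1 ?mulr1 // => k _; rewrite subrr mxE expr0z.
rewrite -sA /laurent_avg -torus_avgB; apply: modc_torus_avg => // v _.
have pv : polydisc y (torus_pt rho v) by move=> k; rewrite !modc_torus_pt.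
rewrite -mulrBr modcM.
have -> : modc (mono (torus_pt rho v) (- lam)) = w.
  by rewrite /w !modc_mono; apply: eq_bigr => k _; rewrite !modc_torus_pt.
rewrite mulrC -ler_pdivlMr //; apply: usum_approx => [e' e'0|].
  have [A' hA'] := abs_summable_tail hs e'0; exists A'.
  exact: (@tail_term R r Qplus a id (fun _ => id) y _ _ _ pv).
exact: (@tail_term R r Qplus a id (fun _ => id) y _ _ _ pv).
Qed.

End PowerSeries.

(** * Reflections of exponents, points and tori *)

Section Reflections.
Variables (R : realType) (r : nat) (D : root_datum R r).
Local Notation C := (cplx R).
Local Notation V := 'rV[C]_r.
Implicit Types (i k : 'I_r) (lam mu : 'rV[int]_r) (x : V) (rho : 'I_r -> R).

Lemma pairQD lam mu i : pairQ D (lam + mu) i = pairQ D lam i + pairQ D mu i.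
Proof. by rewrite /pairQ -big_split; apply: eq_bigr => k _; rewrite mxE mulrDl. Qed.

Lemma pairQZ (z : int) lam i : pairQ D (z *: lam) i = z * pairQ D lam i.
Proof. by rewrite /pairQ mulr_sumr; apply: eq_bigr => k _; rewrite mxE mulrA. Qed.

Lemma pairQ_alpha k i : pairQ D (alphaQ k) i = cartan D i k.
Proof.
rewrite /pairQ (bigD1 k) //= big1 => [|k' kk']; last by rewrite mxE (negbTE kk') mul0r.
by rewrite mxE !eqxx mul1r addr0.
Qed.

Lemma pairQ_alpha_self i : pairQ D (alphaQ i) i = 2.
Proof. by rewrite pairQ_alpha; case: (cartan_gcm D) => ->. Qed.

Lemma pairQE lam i : pairQ D lam i = \sum_k lam 0 k * pairQ D (alphaQ k) i.
Proof. by rewrite {1}/pairQ; apply: eq_bigr => k _; rewrite pairQ_alpha. Qed.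

Lemma alphaQ_pos_real_root i : pos_real_roots D (alphaQ i).
Proof.
split; first by move=> k; rewrite mxE; case: (_ && _).
exists [::], i; rewrite /= /ofQ (bigD1 i) //= mxE !eqxx scale1r big1 ?addr0 // => k ki.
by rewrite mxE eqxx /= (negbTE ki) scale0r.
Qed.

Section Multiplicity.
Variables (n : nat) (i : 'I_r).
Hypothesis n_gt0 : (0 < n)%N.
Let d := gcdn n `|qQ D (alphaQ i)|.

Lemma multi_gt0 : (0 < multi D n i)%N.
Proof. by rewrite divn_gt0 ?gcdn_gt0 ?n_gt0 // dvdn_leq ?dvdn_gcdl. Qed.

(** [m_i] is the order of [q(alpha_i)] in the additive group Z/n. *)
Lemma dvd_multiM (z : int) : (n %| z * qQ D (alphaQ i))%Z = (multi D n i %| z)%Z.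
Proof.
have d0 : (0 < d)%N by rewrite gcdn_gt0 n_gt0.
rewrite !dvdzE /= abszM /multi /mult -/d; set a := `|qQ D (alphaQ i)|%N.
have dn : (n %/ d * d = n)%N by rewrite divnK ?dvdn_gcdl.
have da : (a %/ d * d = a)%N by rewrite divnK ?dvdn_gcdr.
rewrite -{1}dn -{1}da mulnA dvdn_pmul2r // Gauss_dvdl //.
by rewrite /coprime -(eqn_pmul2r d0) mul1n muln_gcdl dn da.
Qed.

End Multiplicity.

Lemma sreflQE i lam : sreflQ D i lam = lam + (- pairQ D lam i) *: alphaQ i.
Proof. by rewrite /sreflQ scaleNr. Qed.

Lemma mono_sigma_pt i x lam : (forall k, x 0 k != 0) ->
  mono (sigma_pt D i x) lam = mono x (sreflQ D i lam).
Proof.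
move=> x0; rewrite sreflQE monoD // monoZ_alpha pairQE -sumrN.
rewrite (big_morph (fun z => x 0 i ^ z) (fun y z => expfzDr y z (x0 i)) (expr0z _)).
rewrite -big_split; apply: eq_bigr => k _ /=.
by rewrite mxE expfzMl exprz_exp mulNr [_ * pairQ _ _ _]mulrC.
Qed.

Lemma mono_eps_pt i (eta : C) x lam : eta != 0 ->
  mono (eps_pt D i eta x) lam = eta ^ pairQ D lam i * mono x lam.
Proof.
move=> eta0; rewrite pairQE.
rewrite (big_morph (fun z => eta ^ z) (fun y z => expfzDr y z eta0) (expr0z _)).
rewrite -big_split; apply: eq_bigr => k _ /=.
by rewrite mxE expfzMl exprz_exp [_ * pairQ _ _ _]mulrC.
Qed.

Definition refl_pt i (eta : C) x : V := eps_pt D i eta (sigma_pt D i x).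

Lemma refl_ptE i eta x k :
  refl_pt i eta x 0 k =
  eta ^ pairQ D (alphaQ k) i * (x 0 k * x 0 i ^ (- pairQ D (alphaQ k) i)).
Proof. by rewrite !mxE. Qed.

Lemma refl_pt_self i eta x : x 0 i != 0 -> refl_pt i eta x 0 i = eta ^+ 2 / x 0 i.
Proof.
move=> xi; rewrite refl_ptE pairQ_alpha_self; congr (_ * _).
by rewrite -[x 0 i in LHS]expr1z -expfzDr.
Qed.

(** Conjugation by [sigma_i] inverts [eps_(i, eta)], so each product of the two is an involution, as
    for reflections in a dihedral group. *)
Lemma refl_ptK i eta x : eta != 0 -> x 0 i != 0 -> refl_pt i eta (refl_pt i eta x) = x.
Proof.
move=> e0 xi; apply/rowP => k; rewrite refl_ptE refl_pt_self // [X in _ * (X * _)]refl_ptE.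
set a := pairQ _ _ _.
have -> : (eta ^+ 2 / x 0 i) ^ (- a) = eta ^ (- a) * eta ^ (- a) * x 0 i ^ a.
  by rewrite expfzMl expr2 expfzMl exprz_inv opprK.
have ea : eta ^ a != 0 by exact: expfz_neq0.
have xa : x 0 i ^ a != 0 by exact: expfz_neq0.
rewrite -!invr_expz; move: (eta ^ a) (x 0 i ^ a) (x 0 k) ea xa => u v w u0 v0.
by field; rewrite u0 v0.
Qed.

Lemma refl_pt_continuous i eta x : x 0 i != 0 ->
  {for x, continuous (refl_pt i eta)}.
Proof.
move=> xi A /nbhs_rVP[e e0 hA].
have hk k : \forall y \near x, modc (refl_pt i eta y 0 k - refl_pt i eta x 0 k) < e.
  have : {for x, continuous (fun y => refl_pt i eta y 0 k)}.
    rewrite (_ : (fun y => _) = (fun y : V =>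
      eta ^ pairQ D (alphaQ k) i * (y 0 k * y 0 i ^ (- pairQ D (alphaQ k) i)))).
      apply: differentiable_continuous.
      apply: (@differentiableM _ _ (cst _) (fun y : V => y 0 k * _)).
        exact: differentiable_cst.
      apply: (@differentiableM _ _ (fun y : V => y 0 k) (fun y : V => y 0 i ^ _)).
        exact: differentiable_coord.
      by apply: differentiable_coordX; rewrite xi orbT.
    by apply/funext => y; rewrite refl_ptE.
  move=> /continuous_rVP/(_ (e / 2)); rewrite divr_gt0 // => /(_ isT).
  apply: filterS => y /le_lt_trans; apply.
  by rewrite ltr_pdivrMr // ltr_pMr // ltr1n.
have : \forall y \near x, forall k, modc (refl_pt i eta y 0 k - refl_pt i eta x 0 k) < e.
  exact: (@filter_forall V 'I_r (fun k y =>
    modc (refl_pt i eta y 0 k - refl_pt i eta x 0 k) < e) (nbhs x) _ hk).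
by apply: filterS => y; exact: hA.
Qed.

Definition refl_radii i rho : 'I_r -> R :=
  fun k => rho k * rho i ^ (- pairQ D (alphaQ k) i).

Lemma refl_radii_gt0 i rho : (forall k, 0 < rho k) -> forall k, 0 < refl_radii i rho k.
Proof. by move=> r0 k; rewrite mulr_gt0 // exprz_gt0. Qed.

Lemma real_complexXz (x : R) (z : int) : (x ^ z)%:C%C = x%:C%C ^ z :> C.
Proof.
case: z => m; first by rewrite -!exprnP rmorphXn.
by rewrite /exprz fmorphV rmorphXn.
Qed.

Lemma sigma_pt_torus i rho :
  sigma_pt D i (torus_pt rho (fun=> 0)) = torus_pt (refl_radii i rho) (fun=> 0).
Proof.
by apply/rowP => k; rewrite !mxE mulr0 cis0 !mulr1 /refl_radii rmorphM /= real_complexXz.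
Qed.

(** On angles, [refl_pt] is an affine map with integer coefficients. Its translation part lies on
    the grid because [m] divides [N], so it permutes the grid points. *)
Lemma torus_avg_refl m n i (t : nat) (f : V -> C) rho : (0 < m)%N ->
  let N := (m * 2 ^ n)%N in
  torus_avg N (fun x => f (refl_pt i (cis (2 * pi / m%:R) ^+ t) x)) rho =
  torus_avg N f (refl_radii i rho).
Proof.
move=> m0 N; have N0 : (0 < N)%N by rewrite muln_gt0 m0 expn_gt0.
have NZ : (N : int) != 0 by rewrite eqz_nat -lt0n.
have red_lt (z : int) : (`|(z %% N)%Z| < N)%N.
  by rewrite -ltz_nat gez0_abs ?modz_ge0 // ltz_pmod.
pose red z := Ordinal (red_lt z).
pose s : int := (t * 2 ^ n)%N.
pose a k := pairQ D (alphaQ k) i.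
(* The map on angle indices modulo [N]: [j_k - a_k j_i] comes from [sigma_i], and [a_k s] from the
   root of unity, whose own index is [s]. *)
pose h (j : {ffun 'I_r -> 'I_N}) : {ffun 'I_r -> 'I_N} :=
  [ffun k => red ((j k : nat)%:Z - a k * ((j i : nat)%:Z - s))].
have redE z : (red z : nat)%:Z = (z %% N)%Z by rewrite /red /= gez0_abs ?modz_ge0.
have redD (z : int) : exists q : int, (z %% N)%Z = q * N + z.
  by exists (- (z %/ N)%Z); rewrite {3}(divz_eq z N) mulNr addKr.
have hh : involutive h.
  move=> j; apply/ffunP => k; apply: val_inj; apply/eqP; rewrite -eqz_nat.
  rewrite !ffunE !redE /a pairQ_alpha_self -/(a k).
  have [q1 ->] := redD ((j k : nat)%:Z - a k * ((j i : nat)%:Z - s)).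
  have [q2 ->] := redD ((j i : nat)%:Z - 2 * ((j i : nat)%:Z - s)).
  set jk : int := j k : nat; set ji : int := j i : nat.
  have -> : q1 * N + (jk - a k * (ji - s)) - a k * (q2 * N + (ji - 2 * (ji - s)) - s) =
      (q1 - a k * q2) * N + jk by ring.
  by rewrite modzMDl modz_small // /jk ltz_nat ltn_ord.
rewrite /torus_avg /grid_avg; congr (_ * _).
rewrite [RHS](reindex_inj (inv_inj hh)); apply: eq_bigr => j _; congr f.
have zc (u : int) : cis (2 * pi * (u%:~R / N%:R)) = cis (2 * pi / N%:R) ^ u :> C.
  by rewrite -cisMz; congr cis; ring.
have zN (q u : int) : cis (2 * pi / N%:R) ^ (q * N + u) = cis (2 * pi / N%:R) ^ u :> C.
  rewrite expfzDr ?cis_neq0 // [q * _]mulrC -exprz_exp -exprnP.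
  by rewrite (prim_expr_order (prim_root_cis _ N0)) exp1rz mul1r.
have zt : cis (2 * pi / m%:R) ^+ t = cis (2 * pi / N%:R) ^ s :> C.
  rewrite -cisMn -cisMz; congr cis; rewrite /s -[(_%:Z)%:~R]/((t * 2 ^ n)%:R) /N !natrM.
  have m1 : m%:R != 0 :> R by rewrite pnatr_eq0 -lt0n.
  have n1 : (2 ^ n)%:R != 0 :> R by rewrite pnatr_eq0 -lt0n expn_gt0.
  by field; rewrite n1.
have zr (u : int) : cis (2 * pi * ((red u : nat)%:R / N%:R)) =
    cis (2 * pi / N%:R) ^ u :> C.
  have -> : (red u : nat)%:R = ((u %% N)%Z)%:~R :> R by rewrite -redE.
  by rewrite zc; have [q ->] := redD u; rewrite zN.
apply/rowP => k; rewrite refl_ptE !mxE -/(a k) /refl_radii -/(a k) ffunE.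
rewrite (rmorphM (real_complex R)) /= real_complexXz expfzMl zt.
rewrite -[((j k : nat)%:R / N%:R)]/(((j k : nat)%:Z)%:~R / N%:R).
rewrite -[((j i : nat)%:R / N%:R)]/(((j i : nat)%:Z)%:~R / N%:R).
set u := (_ - _)%R.
rewrite zr !zc /u expfzDr ?cis_neq0 // !exprz_exp.
rewrite [_ ^ (- (a k * _))](_ : _ = cis (2 * pi / N%:R) ^ (s * a k) *
  cis (2 * pi / N%:R) ^ ((j i : nat)%:Z * - a k)).
  have sw (u1 u2 u3 u4 u5 : C) :
      u1 * (u2 * u3 * (u4 * u5)) = u2 * u4 * (u3 * (u1 * u5)) by ring.
  exact: sw.
by rewrite -expfzDr ?cis_neq0 //; congr (_ ^ _); ring.
Qed.

End Reflections.

Lemma closure_openI (T : topologicalType) (A B : set T) x :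
  open A -> A `<=` closure B -> closure A x -> closure (A `&` B) x.
Proof.
move=> Ao AB Ax N /nbhs_interior hN.
have [z [Az Nz]] := Ax _ hN.
have [w [Bw [Aw Nw]]] := AB z Az _ (filterI (open_nbhs_nbhs (conj Ao Az)) Nz).
by exists w; split.
Qed.

Lemma uprod1BD1 (R : realType) (I : choiceType) (S : set I) (u : I -> cplx R) i0 :
  S i0 -> abs_summable S u ->
  uprod1B S u = (1 - u i0) * uprod1B (S `\ i0) u.
Proof.
move=> Si0 /abs_summable_tail hs.
have hs' e : 0 < e -> exists A, tail_le (S `\ i0) u A e.
  move=> /hs[A hA]; exists A => B; apply: le_trans (hA B).
  rewrite big_mkcond [leRHS]big_mkcond; apply: ler_sum => i _.
  case: ifPn => [/andP[/set_mem[Si _] iA]|_]; first by rewrite mem_set //= iA.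
  by case: ifP; rewrite ?modc_ge0.
have [z hz] := uprod1B_cvg hs'.
pose FF := @summability.totally_filter I.
rewrite [in RHS]/uprod1B (cvg_lim (@norm_hausdorff _ _) hz).
apply: (cvg_lim (@norm_hausdorff _ _)); apply/cvg_modcP => e e0.
set c := 1 - u i0; have e1 : 0 < e / (modc c + 1).
  by rewrite divr_gt0 // ltr_wpDl ?modc_ge0.
have /cvg_modcP/(_ _ e1)[A _ hA] := hz.
exists (i0 |` A)%fset => //= B; rewrite /= fsubUset fsub1set => /andP[i0B AB].
have -> : \prod_(i <- B | i \in S) (1 - u i) = c * \prod_(i <- B | i \in S `\ i0) (1 - u i).
  rewrite big_mkcond (bigD1_seq i0) ?fset_uniq //= mem_set //; congr (_ * _).
  rewrite -big_mkcondr; apply: eq_bigl => i; rewrite andbC.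
  apply/andP/idP => [[/set_mem Si /eqP ii0]|/set_mem[Si ii0]].
    by apply/mem_set; split.
  by split; [exact/mem_set | exact/eqP].
rewrite -mulrBr modcM; have := hA B AB; rewrite /= ler_pdivlMr ?ltr_wpDl ?modc_ge0 //.
have := modc_ge0 c; set v := modc (_ - _) => c0 hv.
have : 0 <= v by exact: modc_ge0.
by move=> v0; nra.
Qed.

(** * The function [G] and its coefficients *)

Section Numerator.
Variables (R : realType) (r : nat) (D : root_datum R r) (n : nat) (q : R).
Local Notation C := (cplx R).
Local Notation V := 'rV[C]_r.
Local Notation qC := (q%:C%C : C).
Variables (Y : set V) (Z F : V -> C) (a : 'rV[int]_r -> C) (i : 'I_r) (Yi : set V).
Local Notation m := (multi D n i).
Local Notation S := (pos_real_roots D `\ alphaQ i).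
Local Notation P := (root_prod D n q S).

Hypothesis Yi_sub : Yi `<=` Y.
Hypothesis Yi_open : open Yi.
Hypothesis Yi_reinhardt : reinhardt Yi.
Hypothesis P_cvg : forall x, Yi x -> root_prod_cvg D n q S x.
Hypothesis P_neq0 : forall x, Yi x -> P x != 0.
Hypothesis D_cvg : forall x, Y x -> root_prod_cvg D n q (pos_real_roots D) x.
Hypothesis F_holo : holomorphic_on Y F.
Variable O : set V.
Hypothesis O_dense : Y `<=` closure O.
Hypothesis DZ_F : forall x, O x -> root_prod D n q (pos_real_roots D) x * Z x = F x.

(** Built from [F] and not from [Z], whose values are meaningful only on a dense subset; it is
    continuous on all of [Yi]. *)
Definition reduced_numerator x : C := F x / P x.
Local Notation G := reduced_numerator.

Let S_Qplus b : S b -> Qplus ((mult D n b)%:Z *: b).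
Proof. by move=> [[bQ _] _] k; rewrite mxE mulr_ge0. Qed.

Lemma root_term_alpha x : root_term D n q x (alphaQ i) = qC * x 0 i ^+ m.
Proof. by rewrite /root_term monoZ_alpha exprnP. Qed.

Lemma root_prod_alpha x : Y x ->
  root_prod D n q (pos_real_roots D) x = (1 - qC * x 0 i ^+ m) * P x.
Proof.
move=> Yx; rewrite -root_term_alpha; apply: uprod1BD1; last exact: D_cvg.
exact: alphaQ_pos_real_root.
Qed.

Lemma reduced_numeratorE x : Yi x -> O x -> (1 - qC * x 0 i ^+ m) * Z x = G x.
Proof.
move=> Yix Ox; rewrite /G -DZ_F // (root_prod_alpha (Yi_sub Yix)).
by rewrite [_ * P x * Z x]mulrAC mulfK ?P_neq0.
Qed.

Lemma P_continuous x : Yi x -> {for x, continuous P}.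
Proof.
move=> Yix; have [rho [rho0 Yrho hx]] := reinhardt_larger Yi_open Yi_reinhardt Yix.
exact: (@continuous_uprod1B R r S (fun=> qC) (fun b => (mult D n b)%:Z *: b) S_Qplus
  _ x (P_cvg Yrho) hx).
Qed.

Lemma reduced_numerator_continuous x : Yi x -> {for x, continuous G}.
Proof.
move=> Yix; have Fc : {for x, continuous F}.
  by apply: differentiable_continuous; case: F_holo => _; apply; exact: Yi_sub.
exact: cvgM Fc (cvgV (P_neq0 Yix) (P_continuous Yix)).
Qed.

Lemma reduced_numerator_approx rho : (forall k, 0 < rho k) ->
  Yi (torus_pt rho (fun=> 0)) -> forall e : R, 0 < e ->
  exists H : V -> C, (forall x, Yi x -> differentiable H x) /\
    forall x, Yi x -> (forall k, modc (x 0 k) <= rho k) ->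
      modc (G x - H x) <= e * modc (G x).
Proof.
move=> rho0 Yrho e e0; pose e' : R := Num.min 2^-1 (e / 2).
have e'0 : 0 < e' by rewrite lt_min invr_gt0 ltr0n divr_gt0.
have e'2 : e' <= 2^-1 by rewrite ge_min lexx.
have e'e : 2 * e' <= e.
  have : e' <= e / 2 by rewrite ge_min lexx orbT.
  by rewrite ler_pdivlMr // mulrC.
have [A hA] := abs_summable_tail (P_cvg Yrho) e'0.
pose PA x := \prod_(b <- A | b \in S) (1 - root_term D n q x b).
have PA0 x : Yi x -> PA x != 0.
  move=> Yix; rewrite prodf_seq_neq0; apply/allP => b _; apply/implyP => /set_mem Sb.
  exact: (@uprod1B_factor_neq0 R r S (fun=> qC) (fun b => (mult D n b)%:Z *: b)
    S_Qplus x b (P_cvg Yix) (P_neq0 Yix) Sb).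
exists (fun x => F x / PA x); split=> [x Yix|x Yix xrho].
  apply: (@differentiableM _ _ F (fun x => (PA x)^-1)).
    by case: F_holo => _; apply; exact: Yi_sub.
  apply: differentiableV; last exact: PA0.
  exact: (@differentiable_pprod1B R r S (fun=> qC) (fun b => (mult D n b)%:Z *: b) S_Qplus).
have xy : polydisc (torus_pt rho (fun=> 0)) x.
  by move=> k; rewrite modc_torus_pt gtr0_norm.
have hP : modc (P x - PA x) <= 2 * e' * modc (PA x).
  exact: (@uprod1B_unif_approx R r S (fun=> qC) (fun b => (mult D n b)%:Z *: b)
    S_Qplus _ A e' (P_cvg Yrho) hA e'2 x xy).
(* The relative error of the partial product becomes a relative error of the quotient. *)
have -> : F x / P x - F x / PA x = - (F x / P x) * ((P x - PA x) / PA x).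
  by field; rewrite P_neq0 ?PA0.
rewrite !modcM modcN modcV -modcM mulrC ler_wpM2r ?modc_ge0 //.
by rewrite ler_pdivrMr ?modc_gt0 ?PA0 // (le_trans hP) // ler_wpM2r ?modc_ge0.
Qed.

Hypothesis Yi0 : Yi 0.
Hypothesis Z_taylor : taylor_at0 Y Z a.
Hypothesis a_supp : forall lam, ~ Qplus lam -> a lam = 0.
Hypothesis m_gt0 : (0 < m)%N.

Definition numerator_coef lam : C := a lam - qC * a (lam - m%:Z *: alphaQ i).

(** Near 0, [G] is [1 - q x_i ^ m] times the Taylor series: both sides are continuous and agree on a
    dense set. The coefficients of this product are [numerator_coef]. *)
Lemma laurent_avg_near0 lam : exists2 d0 : R, 0 < d0 & forall rho,
  (forall k, 0 < rho k < d0) -> forall e : R, 0 < e -> exists n0,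
  forall N, (n0 <= N)%N -> modc (laurent_avg G m lam N rho - numerator_coef lam) <= e.
Proof.
have [U [Uo U0 UY Usum [T [T_open TU UT TZ]]]] := Z_taylor.
pose term (x : V) lam := a lam * mono x lam.
pose Sa x := usum Qplus (term x).
have [del1 d10 h1] : exists2 e : R, 0 < e & forall y : V,
    (forall k, modc (y 0 k - (0 : V) 0 k) < e) -> U y.
  by apply/nbhs_rVP; exact: Uo.
have [del2 d20 h2] : exists2 e : R, 0 < e & forall y : V,
    (forall k, modc (y 0 k - (0 : V) 0 k) < e) -> Yi y.
  by apply/nbhs_rVP; exact: Yi_open.
pose d := Num.min del1 del2 / 2.
have d0 : 0 < d by rewrite divr_gt0 // lt_min d10.
have dlt : d < Num.min del1 del2 by rewrite /d ltr_pdivrMr // ltr_pMr ?ltr1n // lt_min d10.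
have {dlt}[dd1 dd2] : d < del1 /\ d < del2 by move: dlt; rewrite lt_min => /andP[].
have UYi (y : V) : (forall k, modc (y 0 k) <= d) -> U y /\ Yi y.
  by move=> hy; split; [apply: h1 | apply: h2] => k; rewrite mxE subr0 (le_lt_trans (hy k)).
pose y0 : V := torus_pt (fun=> d) (fun=> 0).
have y0d k : modc (y0 0 k) = d by rewrite modc_torus_pt gtr0_norm.
have sy0 : abs_summable Qplus (term y0) by apply: Usum; apply: (UYi y0 _).1 => k; rewrite y0d.
pose N0 : set V := [set x | forall k, modc (x 0 k) < d].
have N0nbhs x : N0 x -> nbhs x N0.
  move=> hx; apply/nbhs_rVP; pose e : R := d - \big[Num.max/0]_k modc (x 0 k).
  exists e.
    rewrite subr_gt0; apply/bigmax_ltP; split => // k _; exact: hx.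
  move=> y hy k; rewrite -[y 0 k](subrK (x 0 k)) (le_lt_trans (modcD _ _)) //.
  rewrite -ltrBrDr (lt_le_trans (hy k)) // lerD2l lerN2.
  exact: (le_bigmax _ (fun k => modc (x 0 k)) k).
have Sa_cont x : N0 x -> {for x, continuous Sa}.
  move=> hx; apply: (@continuous_usum R r Qplus a id (fun _ => id) y0 x sy0).
  by apply: filterS (N0nbhs x hx) => z hz k; rewrite y0d ltW.
have GSa x : N0 x -> G x = (1 - qC * x 0 i ^+ m) * Sa x.
  move=> hx; apply/eqP; rewrite -subr_eq0 -modc_eq0 eq_le modc_ge0 andbT.
  apply/ler_addgt0Pr => e e0; rewrite add0r.
  pose H z := G z - (1 - qC * z 0 i ^+ m) * Sa z.
  have Hc : {for x, continuous H}.
    have Gc : {for x, continuous G}.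
      by apply: reduced_numerator_continuous; apply: (UYi x _).2 => k; exact/ltW.
    have Xc : {for x, continuous (fun z : V => z 0 i ^ m%:Z)}.
      exact/differentiable_continuous/differentiable_coordX.
    have Lc : {for x, continuous (fun z : V => 1 - qC * z 0 i ^+ m)}.
      exact: cvgB (cvg_cst _) (cvgM (cvg_cst _) Xc).
    exact: cvgB Gc (cvgM Lc (Sa_cont x hx)).
  move/continuous_rVP : Hc => /(_ e e0) Hc.
  have nN : nbhs x (N0 `&` [set z | modc (H z - H x) <= e]).
    by apply: filterI Hc; exact: N0nbhs.
  have Ux : U x by apply: (UYi x _).1 => k; exact/ltW.
  have /(_ _ nN)[z [[Tz Oz] [N0z Hz]]] : closure (T `&` O) x.
    by apply: (closure_openI T_open _ (UT x Ux)) => z /TU/UY; exact: O_dense.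
  have Hz0 : H z = 0.
    rewrite /H -reduced_numeratorE ?TZ ?subrr //.
    by apply: (UYi z _).2 => k; exact/ltW.
  by move: Hz; rewrite /= Hz0 sub0r modcN.
exists d => // rho hrho e e0.
have rho0 k : 0 < rho k by case/andP: (hrho k).
have N0rho v : N0 (torus_pt rho v).
  by move=> k; rewrite modc_torus_pt gtr0_norm //; case/andP: (hrho k).
have srho : abs_summable Qplus (term (torus_pt rho (fun=> 0))).
  by apply: Usum; apply: (UYi _ _).1 => k; exact/ltW/N0rho.
have aE mu : (if mu \in Qplus then a mu else 0) = a mu.
  by case: ifPn => // /negP mu0; rewrite a_supp // => h; apply: mu0; exact/mem_set.
pose c : R := 2 * (modc qC + 1).
have c0 : 0 < c by rewrite mulr_gt0 // ltr_wpDl ?modc_ge0.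
have ec : 0 < e / c by rewrite divr_gt0.
have [n1 hn1] := @laurent_avg_usum R r a m lam rho m_gt0 rho0 srho _ ec.
have [n2 hn2] := @laurent_avg_usum R r a m (lam - m%:Z *: alphaQ i) rho m_gt0 rho0 srho _ ec.
exists (maxn n1 n2) => N; rewrite geq_max => /andP[/hn1 {}hn1 /hn2 {}hn2].
rewrite aE in hn1; rewrite aE in hn2.
have -> : laurent_avg G m lam N rho = laurent_avg Sa m lam N rho -
    qC * laurent_avg Sa m (lam - m%:Z *: alphaQ i) N rho.
  rewrite /laurent_avg -torus_avgZ -torus_avgB; apply: eq_torus_avg => v.
  set x := torus_pt rho v; have x0 k : x 0 k != 0 by exact: torus_pt_neq0.
  rewrite (GSa _ (N0rho v)) opprB addrC monoD // monoZ_alpha -exprnP.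
  by move: (mono x _) (x 0 i ^+ m) (Sa x) (qC) => u1 u2 u3 u4; ring.
set u1 := laurent_avg _ _ _ _ _ in hn1 *; set u2 := laurent_avg _ _ _ _ _ in hn2 *.
have -> : u1 - qC * u2 - numerator_coef lam =
    (u1 - a lam) - qC * (u2 - a (lam - m%:Z *: alphaQ i)).
  by rewrite /numerator_coef; ring.
rewrite (le_trans (modcD _ _)) // modcN modcM.
have := modc_ge0 qC; set qm := modc qC in c c0 ec hn1 hn2 * => qm0.
have ee : e / c * (1 + qm) <= e.
  by rewrite mulrAC ler_pdivrMr // ler_wpM2l ?(ltW e0) // /c; lra.
apply: le_trans ee; rewrite mulrDr mulr1 lerD // mulrC ler_wpM2r //.
Qed.

End Numerator.

(** * The functional equation in terms of [G] *)

Section FunctionalEquation.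
Variables (R : realType) (r : nat) (D : root_datum R r) (n : nat) (q : R).
Variables (g : int -> cplx R) (l : 'I_r -> nat).
Local Notation C := (cplx R).
Local Notation V := 'rV[C]_r.
Local Notation qC := (q%:C%C : C).
Variables (Y : set V) (Z : V -> C) (i : 'I_r) (Yi : set V).
Local Notation m := (multi D n i).
Local Notation al := (alphaQ i).

Hypothesis q_gt1 : 1 < q.
Hypothesis m_gt0 : (0 < m)%N.
Hypothesis Yi_sub : Yi `<=` Y.
Hypothesis Yi_open : open Yi.
Hypothesis Yi_reinhardt : reinhardt Yi.
Hypothesis Yi_sigma : sigma_invariant D i Yi.
Hypothesis Z_inv : generically_eq (cg_domain D n Y i) (cg_act D n q g l i Z) Z.
Variables (O : set V) (G : V -> C).
Hypothesis O_open : open O.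
Hypothesis O_dense : Y `<=` closure O.
Hypothesis G_continuous : forall x, Yi x -> {for x, continuous G}.
Hypothesis GZ : forall x, Yi x -> O x -> (1 - qC * x 0 i ^+ m) * Z x = G x.

Let xi : C := cis (2 * pi / m%:R).
Let refl (t : nat) (x : V) : V := refl_pt D i (xi ^+ t) x.
Let xi_neq0 t : xi ^+ t != 0. Proof. by rewrite expf_neq0 // cis_neq0. Qed.
Let xi_m t : (xi ^+ t) ^+ m = 1.
Proof. by rewrite -exprM mulnC exprM (prim_expr_order (prim_root_cis _ m_gt0)) expr1n. Qed.

(** [eps_(i, eta)] multiplies the coordinates by numbers of modulus 1, so it preserves a Reinhardt
    domain. *)
Lemma refl_Yi t x : Yi x -> x 0 i != 0 -> Yi (refl t x).
Proof.
move=> Yx xi0; have := Yi_reinhardt (fun k =>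
  (pairQ D (alphaQ k) i)%:~R * (t%:R * (2 * pi / m%:R))) (Yi_sigma Yx xi0).
congr Yi; apply/rowP => k; rewrite [LHS]mxE [RHS]mxE -/(cis _); congr (_ * _).
by rewrite cisMz cisMn.
Qed.

(** Here [|q x_i ^ m| < 1], so the denominator in the action does not vanish. *)
Let W : set V := [set x | [/\ Yi x, x 0 i != 0 & modc (x 0 i) * q < 1]].

Let W_open : open W.
Proof.
move=> x [Yx xi0 xq]; have q0 := lt_trans ltr01 q_gt1.
have h0 : 0 < modc (x 0 i) by rewrite modc_gt0.
have h1 : 0 < q^-1 - modc (x 0 i) by rewrite subr_gt0 -[ltRHS]mul1r ltr_pdivlMr.
have hn : nbhs x [set z | forall k, modc (z 0 k - x 0 k) <
    Num.min (modc (x 0 i)) (q^-1 - modc (x 0 i))].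
  apply/nbhs_rVP; exists (Num.min (modc (x 0 i)) (q^-1 - modc (x 0 i))) => //.
  by rewrite lt_min h0.
apply: filterS (filterI (Yi_open Yx) hn) => z [Yz /(_ i)].
rewrite lt_min => /andP[z0 z1]; split => //.
  by apply: contraTneq z0 => ->; rewrite sub0r modcN ltxx.
rewrite -ltr_pdivlMr // mul1r -[z 0 i](subrK (x 0 i)) (le_lt_trans (modcD _ _)) //.
by rewrite -ltrBrDr.
Qed.

Let kernel (j : nat) (x : V) : C :=
  x 0 i ^- j * (1 - qC) - (x 0 i ^- m - 1) * g (qQ D al * j%:Z).

Let rhs (x : V) : C := \sum_(j < m) \sum_(t < m)
  m%:R^-1 * (xi ^+ t) ^ (j%:Z - (l i)%:Z - 1) *
    (x 0 i ^+ (l i).+1 * kernel j x * G (refl t x)).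

Let qx_neq1 (z : C) : z != 0 -> modc z * q < 1 ->
  1 - qC * z ^+ m != 0 /\ 1 - qC * z ^- m != 0.
Proof.
move=> z0 zq; have q0 := lt_trans ltr01 q_gt1.
have mz : 0 < modc z by rewrite modc_gt0.
have z1 : modc z < 1 by rewrite (lt_trans _ zq) // ltr_pMr.
have zm : q * modc z ^+ m < 1.
  rewrite (le_lt_trans _ zq) // mulrC ler_wpM2r ?(ltW q0) //.
  by rewrite -{2}(expr1 (modc z)) ler_wiXn2l // ?ltW.
split; rewrite subr_eq0; apply/eqP => /(congr1 (@modc R)).
  by rewrite modc1 modcM modcX modc_real gtr0_norm // => h; rewrite -h ltxx in zm.
rewrite modc1 modcM modcV modcX modc_real gtr0_norm // => h.
have zm0 : 0 < modc z ^+ m by rewrite exprn_gt0.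
have zq' : modc z ^+ m = q by rewrite -[LHS]mul1r h divfK ?gt_eqF.
have : 1 < q * q by rewrite (lt_trans q_gt1) // ltr_pMr.
by rewrite -{2}zq' => /(lt_trans zm); rewrite ltxx.
Qed.

(** The [m]-th power of the [i]-th coordinate of every [refl t x] is [x_i ^ - m]. Multiplication by
    [1 - q x_i ^ - m] therefore turns all values of [Z] on the right into values of [G] at once. *)
Let generic_functional_equation x : W x -> O x -> (forall t, (t < m)%N -> O (refl t x)) ->
  cg_act D n q g l i Z x = Z x -> (1 - qC * x 0 i ^- m) * G x = rhs x.
Proof.
move=> [Yx xi0 xq] Ox Orefl; rewrite -GZ // => <-.
have [n1 n2] := qx_neq1 xi0 xq.
rewrite /cg_act; set X := 1 - qC * x 0 i ^- m in n2 *; set X' := 1 - _ in n1 *.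
set Sg := \sum_(j < m) _.
have -> : X * (X' * (x 0 i ^+ (l i).+1 / X' * Sg)) = x 0 i ^+ (l i).+1 * (X * Sg).
  by field.
rewrite /Sg !mulr_sumr; apply: eq_bigr => j _.
rewrite /fpart sum_unity_roots // -/xi !mulr_sumr !mulr_suml !mulr_sumr.
apply: eq_bigr => t _; rewrite -/(refl_pt D i _ x) -/(refl t x).
have Yr : Yi (refl t x) by exact: refl_Yi.
have rx : (refl t x) 0 i ^+ m = x 0 i ^- m.
  by rewrite refl_pt_self // exprMn exprVn (exprAC (xi ^+ t)) xi_m expr1n mul1r.
have := GZ Yr (Orefl t (ltn_ord t)); rewrite rx -/X => <-; rewrite /kernel.
by ring.
Qed.

(** The generic conditions must hold at a point and at all its reflections simultaneously. Each
    [refl t] is a continuous involution, so each condition cuts out an open set that keeps [x] in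
    its closure. *)
Let dense_generic x (s : seq nat) : W x -> exists A : set V,
  [/\ open A, closure A x, A `<=` W `&` O,
    forall z, A z -> cg_act D n q g l i Z z = Z z &
    forall t z, t \in s -> A z -> O (refl t z)].
Proof.
move=> Wx; have [T1 [T1_open T1d dT1 T1Z]] := Z_inv.
elim: s => [|t s [A [Ao Ax AWO AZ As]]].
  have Wcg : W `<=` cg_domain D n Y i.
    move=> z [Yz z0 _]; split => // [|eta]; first exact: Yi_sub.
    move=> /(prim_rootP (prim_root_cis _ m_gt0))[t ->].
    exact/Yi_sub/(refl_Yi t).
  exists (W `&` T1 `&` O); split; last by [].
  - by apply: openI => //; exact: openI.
  - apply: closure_openI; first exact: openI.
      by move=> z [[Yz _ _] _]; apply/O_dense/Yi_sub.
    by apply: (closure_openI W_open _ (subset_closure Wx)) => z Wz; exact/dT1/Wcg.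
  - by move=> z [[]].
  - by move=> z [[_ /T1Z]].
exists (A `&` [set z | O (refl t z)]); split.
- move=> z [Az Oz]; apply: filterI; first exact: Ao.
  have [[Yz z0 _] _] := AWO z Az.
  by apply: (refl_pt_continuous z0); exact: O_open.
- apply: (closure_openI Ao _ Ax) => z Az N Nz.
  have [Wz _] := AWO z Az; have [Yz z0 _] := Wz.
  have rr : refl t (refl t z) = z by exact: refl_ptK.
  have rz0 : (refl t z) 0 i != 0.
    by rewrite refl_pt_self // mulf_neq0 ?invr_eq0 // expf_neq0.
  have nN : nbhs (refl t (refl t z)) (N `&` W).
    by rewrite rr; apply: filterI => //; exact: W_open.
  have [w [wO [Nw Ww]]] := O_dense (Yi_sub (refl_Yi t Yz z0)) (refl_pt_continuous rz0 nN).
  exists (refl t w); split => //=.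
  suff -> : refl t (refl t w) = w by [].
  apply: refl_ptK => //; case: Ww => _ + _; apply: contra_neq => w0.
  rewrite refl_ptE w0 mul0r mulr0 //.
- by move=> z [/AWO].
- by move=> z [/AZ].
by move=> u z; rewrite inE => /orP[/eqP->|us] [Az Oz]; [exact: Oz|exact: As us Az].
Qed.

Let rhs_continuous x : W x -> {for x, continuous rhs}.
Proof.
move=> [Yx x0 _]; have FF := nbhs_filter x.
apply: (@cvg_sumC R V (nbhs x) FF) => j _.
apply: (@cvg_sumC R V (nbhs x) FF) => t _.
have Xc (z : int) : {for x, continuous (fun y : V => y 0 i ^ z)}.
  by apply/differentiable_continuous/differentiable_coordX; rewrite x0 orbT.
have Xn (k : nat) : {for x, continuous (fun y : V => y 0 i ^- k)}.
  rewrite (_ : (fun y : V => _) = (fun y => y 0 i ^ (- k%:Z))); first exact: Xc.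
  by apply/funext => y; rewrite exprnN.
have Kc : {for x, continuous (kernel j)}.
  exact: cvgB (cvgM (Xn j) (cvg_cst _)) (cvgM (cvgB (Xn m) (cvg_cst _)) (cvg_cst _)).
have Gc : {for x, continuous (fun y => G (refl t y))}.
  exact: (continuous_comp (refl_pt_continuous x0) (G_continuous (refl_Yi t Yx x0))).
exact: cvgM (cvg_cst _) (cvgM (cvgM (Xc (l i).+1) Kc) Gc).
Qed.

(** Both sides are continuous at [x] and agree at generic points arbitrarily close to it. *)
Lemma functional_equation (x : V) : Yi x -> x 0 i != 0 -> modc (x 0 i) * q < 1 ->
  (1 - qC * x 0 i ^- m) * G x = \sum_(j < m) \sum_(t < m)
    m%:R^-1 * (cis (2 * pi / m%:R) ^+ t) ^ (j%:Z - (l i)%:Z - 1) *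
      (x 0 i ^+ (l i).+1 * (x 0 i ^- j * (1 - qC)
        - (x 0 i ^- m - 1) * g (qQ D al * j%:Z)) *
        G (refl_pt D i (cis (2 * pi / m%:R) ^+ t) x)).
Proof.
move=> Yx x0 xq; have Wx : W x by [].
rewrite -[RHS]/(rhs x); pose H (z : V) := (1 - qC * z 0 i ^- m) * G z - rhs z.
have Xc : {for x, continuous (fun y : V => y 0 i ^ (- m%:Z))}.
  by apply/differentiable_continuous/differentiable_coordX; rewrite x0 orbT.
have Hc : {for x, continuous H}.
  have Lc : {for x, continuous (fun z : V => 1 - qC * z 0 i ^- m)}.
    rewrite (_ : (fun z : V => _) = (fun z => 1 - qC * z 0 i ^ (- m%:Z))).
      exact: cvgB (cvg_cst _) (cvgM (cvg_cst _) Xc).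
    by apply/funext => z; rewrite exprnN.
  exact: cvgB (cvgM Lc (G_continuous Yx)) (rhs_continuous Wx).
apply/eqP; rewrite -subr_eq0 -modc_eq0 eq_le modc_ge0 andbT.
apply/ler_addgt0Pr => e e0; rewrite add0r.
move/continuous_rVP : Hc => /(_ e e0) Hc.
have [A [Ao Ax AWO AZ As]] := dense_generic (iota 0 m) Wx.
have [z [Az Hz]] := Ax _ Hc; have [Wz Oz] := AWO z Az.
have Hz0 : H z = 0.
  rewrite /H generic_functional_equation ?subrr ?AZ // => t tm.
  by apply: As Az; rewrite mem_iota.
by move: Hz; rewrite /= Hz0 sub0r modcN.
Qed.

End FunctionalEquation.

(** * The functional equation for coefficients *)

Section CoefficientRelation.
Variables (R : realType) (r : nat) (D : root_datum R r) (n : nat) (q : R).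
Variables (g : int -> cplx R) (l : 'I_r -> nat).
Local Notation C := (cplx R).
Local Notation V := 'rV[C]_r.
Local Notation qC := (q%:C%C : C).
Variables (G : V -> C) (i : 'I_r).
Local Notation m := (multi D n i).
Local Notation al := (alphaQ i).
Local Notation L := ((l i)%:Z).
Variable b : 'rV[int]_r -> C.
Variable rho : 'I_r -> R.

Hypothesis m_gt0 : (0 < m)%N.
Hypothesis rho_gt0 : forall k, 0 < rho k.
Hypothesis cvg_rho : forall lam,
  (fun N => laurent_avg G m lam N rho) @ \oo --> b lam.
Hypothesis cvg_refl : forall lam,
  (fun N => laurent_avg G m lam N (refl_radii D i rho)) @ \oo --> b lam.

Let xi : C := cis (2 * pi / m%:R).

Hypothesis equation : forall v, let x := torus_pt rho v in
  (1 - qC * x 0 i ^- m) * G x = \sum_(j < m) \sum_(t < m)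
    m%:R^-1 * (xi ^+ t) ^ (j%:Z - L - 1) *
      (x 0 i ^+ (l i).+1 * (x 0 i ^- j * (1 - qC)
        - (x 0 i ^- m - 1) * g (qQ D al * j%:Z)) * G (refl_pt D i (xi ^+ t) x)).

Let xi_neq0 t : xi ^+ t != 0. Proof. by rewrite expf_neq0 // cis_neq0. Qed.

Lemma sreflQD lam mu : sreflQ D i (lam + mu) = sreflQ D i lam + sreflQ D i mu.
Proof. by rewrite /sreflQ pairQD scalerDl opprD addrACA. Qed.

Lemma sreflQZ (z : int) lam : sreflQ D i (z *: lam) = z *: sreflQ D i lam.
Proof. by rewrite /sreflQ pairQZ scalerBr scalerA. Qed.

Lemma sreflQ_alpha : sreflQ D i al = - al.
Proof. by rewrite /sreflQ pairQ_alpha_self -{1}[al]scale1r -scalerBl -scaleN1r. Qed.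

(** Change of variables by the involution [refl_pt], which moves the average to the reflected torus
    and transforms the monomial. *)
Let refl_avg N t nu : torus_avg (m * 2 ^ N)
    (fun x => mono x (- nu) * G (refl_pt D i (xi ^+ t) x)) rho =
  (xi ^+ t) ^ (- pairQ D nu i) * laurent_avg G m (sreflQ D i nu) N (refl_radii D i rho).
Proof.
rewrite /laurent_avg -torus_avgZ.
transitivity (torus_avg (m * 2 ^ N)
    (fun y => mono (refl_pt D i (xi ^+ t) y) (- nu) * G y) (refl_radii D i rho)).
  rewrite -(@torus_avg_refl R r D m N i t
    (fun y => mono (refl_pt D i (xi ^+ t) y) (- nu) * G y) rho m_gt0).
  apply: eq_torus_avg => v.
  by rewrite -/xi refl_ptK //; exact: torus_pt_neq0.
apply: eq_torus_avg => v; have x0 k := torus_pt_neq0 v k (refl_radii_gt0 D i rho_gt0).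
rewrite mono_eps_pt // mono_sigma_pt //.
have -> : pairQ D (- nu) i = - pairQ D nu i by rewrite -scaleN1r pairQZ mulN1r.
have -> : sreflQ D i (- nu) = - sreflQ D i nu by rewrite -scaleN1r sreflQZ scaleN1r.
by rewrite mulrA.
Qed.

(** The coefficient of [x ^ mu] in [x_i ^ (L + 1 - z) f] is that of [x ^ (nu mu z)] in [f]. The
    values [z = j], [m], 0 come from the three powers of [x_i] in the action. *)
Let nu (mu : 'rV[int]_r) (z : int) : 'rV[int]_r := mu - (L + 1 - z) *: al.

Let equation_avg mu N :
  laurent_avg G m mu N rho - qC * laurent_avg G m (mu + m%:Z *: al) N rho =
  \sum_(j < m) \sum_(t < m) m%:R^-1 * (xi ^+ t) ^ (j%:Z - L - 1) *
    let T z := (xi ^+ t) ^ (- pairQ D (nu mu z) i) *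
      laurent_avg G m (sreflQ D i (nu mu z)) N (refl_radii D i rho) in
    ((1 - qC) * T j%:Z - g (qQ D al * j%:Z) * (T m%:Z - T 0)).
Proof.
rewrite /laurent_avg -torus_avgZ -torus_avgB.
transitivity (torus_avg (m * 2 ^ N) (fun x => \sum_(j < m) \sum_(t < m)
    m%:R^-1 * (xi ^+ t) ^ (j%:Z - L - 1) *
    ((1 - qC) * (mono x (- nu mu j%:Z) * G (refl_pt D i (xi ^+ t) x)) -
     g (qQ D al * j%:Z) * (mono x (- nu mu m%:Z) * G (refl_pt D i (xi ^+ t) x) -
       mono x (- nu mu 0) * G (refl_pt D i (xi ^+ t) x)))) rho).
  apply: eq_torus_avg => v; set x := torus_pt rho v.
  have x0 k : x 0 k != 0 by exact: torus_pt_neq0.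
  have xz (z : int) : mono x (- nu mu z) = mono x (- mu) * x 0 i ^+ (l i).+1 * x 0 i ^ (- z).
    rewrite /nu opprB addrC monoD // monoZ_alpha -mulrA; congr (_ * _).
    by rewrite exprnP -expfzDr //; congr (_ ^ _); lia.
  transitivity (mono x (- mu) * ((1 - qC * x 0 i ^- m) * G x)).
    rewrite opprD monoD // -[- (m%:Z *: al)]scaleNr monoZ_alpha -exprnN; ring.
  rewrite equation -/x mulr_sumr; apply: eq_bigr => j _.
  rewrite mulr_sumr; apply: eq_bigr => t _; rewrite !xz oppr0 expr0z -!exprnN; ring.
rewrite torus_avg_sum; apply: eq_bigr => j _.
rewrite torus_avg_sum; apply: eq_bigr => t _.
by rewrite torus_avgZ torus_avgB !torus_avgZ torus_avgB !refl_avg.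
Qed.

Lemma coefficient_sum mu : b mu - qC * b (mu + m%:Z *: al) =
  \sum_(j < m) \sum_(t < m) m%:R^-1 * (xi ^+ t) ^ (j%:Z - L - 1) *
    let T z := (xi ^+ t) ^ (- pairQ D (nu mu z) i) * b (sreflQ D i (nu mu z)) in
    ((1 - qC) * T j%:Z - g (qQ D al * j%:Z) * (T m%:Z - T 0)).
Proof.
pose u N := laurent_avg G m mu N rho - qC * laurent_avg G m (mu + m%:Z *: al) N rho.
have u1 : u @ \oo --> b mu - qC * b (mu + m%:Z *: al).
  by apply: cvgB; [exact: cvg_rho | apply: cvgMl_tmp; exact: cvg_rho].
apply: (cvg_unique (@norm_hausdorff _ C) u1); rewrite /u.
rewrite (_ : (fun N => _) = (fun N => \sum_(j < m) \sum_(t < m)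
  m%:R^-1 * (xi ^+ t) ^ (j%:Z - L - 1) *
    let T z := (xi ^+ t) ^ (- pairQ D (nu mu z) i) *
      laurent_avg G m (sreflQ D i (nu mu z)) N (refl_radii D i rho) in
    ((1 - qC) * T j%:Z - g (qQ D al * j%:Z) * (T m%:Z - T 0)))); last first.
  by apply/funext => N; rewrite equation_avg.
apply: cvg_sumC => j _; apply: cvg_sumC => t _; apply: cvgMl_tmp.
have Tc z : (fun N => (xi ^+ t) ^ (- pairQ D (nu mu z) i) *
      laurent_avg G m (sreflQ D i (nu mu z)) N (refl_radii D i rho)) @ \oo -->
    (xi ^+ t) ^ (- pairQ D (nu mu z) i) * b (sreflQ D i (nu mu z)).
  by apply: cvgMl_tmp; exact: cvg_refl.
apply: cvgB; apply: cvgMl_tmp; first exact: Tc.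
by apply: cvgB; exact: Tc.
Qed.

Let ortho (k : int) (c : C) : \sum_(t < m) m%:R^-1 * ((xi ^+ t) ^ k * c) =
  if (m %| k)%Z then c else 0.
Proof.
rewrite -mulr_sumr -mulr_suml.
under eq_bigr => t _ do rewrite exprnP exprz_exp mulrC.
rewrite sum_cis_exprz //; case: ifP => _; last by rewrite mul0r mulr0.
by rewrite mulrA mulVf ?mul1r // pnatr_eq0 -lt0n.
Qed.

Hypothesis g_mod : forall s t : int, (s = t %[mod n])%Z -> g s = g t.
Hypothesis n_gt0 : (0 < n)%N.

(** Summing over the roots of unity leaves one index in each part of the double sum: the one
    congruent to [delta] in the first, the one congruent to [- delta] in the part with [g]. *)
Lemma coefficient_relation mu : let j := (delta D l i mu %% m)%Z in
  let s := sreflQ D i mu + (L + 1) *: al in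
  b mu - qC * b (mu + m%:Z *: al) = (1 - qC) * b (s - j *: al)
    - g (- j * qQ D al) * (b (s - m%:Z *: al) - b s).
Proof.
move=> j s; rewrite coefficient_sum.
have snu z : sreflQ D i (nu mu z) = s - z *: al.
  rewrite /nu /s -scaleNr sreflQD sreflQZ sreflQ_alpha scalerN -scaleNr opprK.
  by rewrite scalerBl addrA.
have pnu z : pairQ D (nu mu z) i = pairQ D mu i - 2 * (L + 1 - z).
  by rewrite /nu -scaleNr pairQD pairQZ pairQ_alpha_self; ring.
have mZ : (m : int) != 0 by rewrite eqz_nat -lt0n.
have inner (k : 'I_m) : \sum_(t < m) m%:R^-1 * (xi ^+ t) ^ (k%:Z - L - 1) *
    (let T z := (xi ^+ t) ^ (- pairQ D (nu mu z) i) * b (sreflQ D i (nu mu z)) in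
    ((1 - qC) * T k%:Z - g (qQ D al * k%:Z) * (T m%:Z - T 0))) =
  (if k%:Z == j then (1 - qC) * b (s - k%:Z *: al) else 0) -
  (if k%:Z == (- j %% m)%Z then g (qQ D al * k%:Z) * (b (s - m%:Z *: al) - b s) else 0).
  have kmod (z : int) : (m %| k%:Z - z)%Z = (k%:Z == (z %% m)%Z).
    by rewrite -eqz_mod_dvd [(k%:Z %% _)%Z]modz_small // ltz_nat ltn_ord.
  have e1 z w : (xi ^+ w) ^ (k%:Z - L - 1) * (xi ^+ w) ^ (- pairQ D (nu mu z) i) =
     (xi ^+ w) ^ (delta D l i mu + k%:Z - 2 * z).
    by rewrite -expfzDr //; congr (_ ^ _); rewrite pnu /delta; ring.
  transitivity (\sum_(t < m) (m%:R^-1 * ((xi ^+ t) ^ (delta D l i mu - k%:Z) *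
      ((1 - qC) * b (s - k%:Z *: al))) -
     (m%:R^-1 * ((xi ^+ t) ^ (delta D l i mu + k%:Z - 2 * m%:Z) *
       (g (qQ D al * k%:Z) * b (s - m%:Z *: al))) -
     m%:R^-1 * ((xi ^+ t) ^ (delta D l i mu + k%:Z) *
       (g (qQ D al * k%:Z) * b s))))).
    apply: eq_bigr => t _ /=; rewrite !snu scale0r subr0.
    have ek := e1 k%:Z t; have em := e1 m%:Z t; have e0 := e1 0 t.
    rewrite mulr0 subr0 in e0; rewrite -e0 -em.
    have -> : delta D l i mu - k%:Z = delta D l i mu + k%:Z - 2 * k%:Z by ring.
    rewrite -ek; move: (_ ^ (_ - 1)) => p.
    move: (_ ^ (- pairQ D (nu mu k%:Z) i)) (_ ^ (- pairQ D (nu mu m%:Z) i)) => pk pm.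
    move: (_ ^ (- pairQ D (nu mu 0) i)) => p0.
    move: (b _) (b _) (b s) (g _) => b1 b2 b3 gk.
    by ring.
  rewrite !sumrB !ortho; congr (_ - _).
    by rewrite -opprB rpredN kmod.
  have -> : (delta D l i mu + k%:Z - 2 * m%:Z \in dvdz m) =
      (delta D l i mu + k%:Z \in dvdz m).
    by rewrite rpredBr // dvdz_mull.
  have -> : (delta D l i mu + k%:Z \in dvdz m) = (k%:Z == (- j %% m)%Z).
    rewrite addrC -[delta D l i mu]opprK kmod; congr (_ == _).
    by rewrite /j modzNm.
  by case: ifP => _; rewrite -?mulrBr // subrr.
under eq_bigr => k _ do rewrite inner.
rewrite sumrB -!big_mkcond /=.
have rl (z : int) : (`|(z %% m)%Z| < m)%N by rewrite -ltz_nat gez0_abs ?modz_ge0 // ltz_pmod.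
have pick (z : int) (F : int -> C) : \sum_(k < m | k%:Z == (z %% m)%Z) F k%:Z = F (z %% m)%Z.
  rewrite (big_pred1 (Ordinal (rl z))) /=; first by rewrite gez0_abs ?modz_ge0.
  move=> k /=; apply/eqP/eqP => [h|->]; last by rewrite /= gez0_abs ?modz_ge0.
  by apply/val_inj/eqP; rewrite -eqz_nat /= gez0_abs ?modz_ge0 //; apply/eqP.
rewrite (pick _ (fun z => (1 - qC) * b (s - z *: al))).
rewrite (pick _ (fun z => g (qQ D al * z) * (b (s - m%:Z *: al) - b s))).
(* The surviving index is the remainder of [- j] modulo [m]; replacing it by [- j] changes the
   argument of [g] by a multiple of [m q(alpha_i)], hence of [n]. *)
congr (_ - _ * _); apply: g_mod; apply/eqP; rewrite eqz_mod_dvd.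
by rewrite mulrC -mulrBl dvd_multiM // -eqz_mod_dvd modz_mod.
Qed.

End CoefficientRelation.

(** * The recurrence along a line in direction [alpha_i] *)

Section LineRecurrence.
Variables (R : realType) (q : R).
Local Notation C := (cplx R).
Local Notation qC := (q%:C%C : C).
Hypothesis q_gt1 : 1 < q.

Let q_gt0 : 0 < q. Proof. exact: lt_trans ltr01 q_gt1. Qed.
Let qC_neq0 : qC != 0.
Proof. by rewrite -modc_eq0 modc_real gtr0_norm // gt_eqF. Qed.

(* A solution is a combination of [q ^ k] and [q ^ - k]; the decay of
   [T k - q T (k - 1)] kills the second and antisymmetry the first. *)
Lemma antisymmetric_solution_eq0 (T : int -> C) (c : int) :
    (forall k, T (c - k) = - T k) ->
    (forall k, T k - qC * T (k - 1) = qC * (T (k + 1) - qC * T k)) ->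
    (forall k (e : R), 0 < e -> exists N : nat,
      q ^+ N * modc (T (k + N%:Z) - qC * T (k + N%:Z - 1)) <= e) ->
  forall k, T k = 0.
Proof.
move=> Tc Tr Td k; pose S k := T k - qC * T (k - 1).
have SN z (N : nat) : S z = qC ^+ N * S (z + N%:Z).
  elim: N => [|N IH]; first by rewrite expr0 mul1r addr0.
  have -> : z + N.+1%:Z = z + N%:Z + 1 by lia.
  by rewrite IH exprSr -mulrA; congr (_ * _); rewrite /S Tr addrK.
have S0 z : S z = 0.
  apply/eqP; rewrite -modc_eq0 eq_le modc_ge0 andbT; apply/ler_addgt0Pr => e e0.
  have [N hN] := Td z e e0; rewrite add0r (SN z N) modcM modcX modc_real.
  by rewrite gtr0_norm.
have TN z : T z = qC * T (z - 1) by apply/eqP; rewrite -subr_eq0; apply/eqP/S0.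
have TS (N : nat) z : T (z + N%:Z) = qC ^+ N * T z.
  elim: N => [|N IH]; first by rewrite expr0 mul1r addr0.
  rewrite TN exprS -mulrA -IH; congr (_ * T _); lia.
have TZ (w z : int) : T (z + w) = qC ^ w * T z.
  case: w => N; first exact: TS.
  have := TS N.+1 (z + Negz N); rewrite NegzE addrNK => ->.
  by rewrite -exprnN mulKf ?expf_neq0.
(* Growth and antisymmetry give [T (c - k)] as [q ^ (c - 2 k) T k] and as [- T k]; but
   [1 + q ^ (c - 2 k)] is positive. *)
have := TZ (c - 2 * k) k; have -> : k + (c - 2 * k) = c - k by ring.
rewrite Tc => h; have : (1 + qC ^ (c - 2 * k)) * T k = 0.
  by rewrite mulrDl mul1r -h subrr.
move=> /eqP; rewrite mulf_eq0 => /orP[/eqP h'|/eqP //].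
have p : 0 < q ^ (c - 2 * k) by rewrite exprz_gt0.
move: h'; rewrite -real_complexXz -(rmorph1 (real_complex R)) -rmorphD => -[h'].
by have := lt_trans p (ltr_pwDl ltr01 (lexx (q ^ (c - 2 * k)))); rewrite h' ltxx.
Qed.

Variables (A : int -> C) (m : nat) (del : int) (gam : int -> C).
Hypothesis m_gt0 : (0 < m)%N.
Let B z := A z - qC * A (z - m%:Z).
Hypothesis A_supp : exists z0 : int, forall z, z < z0 -> A z = 0.
Hypothesis B_decay : forall z, exists K : R, forall k : nat,
  modc (B (z + (k * m)%N%:Z)) <= K / (2 * q) ^+ k.
Hypothesis B_rel : forall z, let j := ((del - 2 * z) %% m)%Z in
  B z - qC * B (z + m%:Z) =
  (1 - qC) * B (del - z - j) - gam j * (B (del - z - m%:Z) - B (del - z)).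
Hypothesis gam0 : gam 0 = -1.
Hypothesis gamM : forall j, 0 < j < m%:Z -> gam j * gam (m%:Z - j) = qC.

Let q2 : (0 : R) < 2 * q. Proof. by rewrite mulr_gt0. Qed.

(** Of the rate [(2 q) ^ - N] a factor [2 ^ - N] survives multiplication by [q ^ N]. *)
Let decay_comb (z w : int) (c : C) (e : R) : 0 < e -> exists N0, forall N : nat, (N0 <= N)%N ->
  q ^+ N * modc (B (z + (N * m)%N%:Z) - c * B (w + (N * m)%N%:Z)) <= e.
Proof.
move=> e0; have [K1 h1] := B_decay z; have [K2 h2] := B_decay w.
pose K := `|K1| + modc c * `|K2| + 1.
have K0 : 0 < K by rewrite ltr_wpDl // addr_ge0 // mulr_ge0 // modc_ge0.
have eK : 0 < e / K by rewrite divr_gt0.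
have [N0 hN0] := exp2_small eK; exists N0 => N NN.
have qN : 0 < q ^+ N by rewrite exprn_gt0.
have hN : (2 ^+ N)^-1 <= e / K.
  rewrite (le_trans _ hN0) // lef_pV2 ?posrE ?exprn_gt0 // ler_weXn2l //.
  by rewrite ler1n.
have p2 : 0 < (2 * q) ^+ N by rewrite exprn_gt0.
have bnd : modc (B (z + (N * m)%N%:Z) - c * B (w + (N * m)%N%:Z)) <= K / (2 * q) ^+ N.
  set v := ((2 * q) ^+ N)^-1; have v0 : 0 <= v by rewrite invr_ge0 ltW.
  have b1 : modc (B (z + (N * m)%N%:Z)) <= `|K1| * v.
    by rewrite (le_trans (h1 N)) // ler_wpM2r // ler_norm.
  have b2 : modc (c * B (w + (N * m)%N%:Z)) <= modc c * (`|K2| * v).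
    rewrite modcM ler_wpM2l ?modc_ge0 // (le_trans (h2 N)) // ler_wpM2r // ler_norm.
    by [].
  rewrite (le_trans (modcD _ _)) // modcN /K; nra.
rewrite (le_trans (ler_wpM2l (ltW qN) bnd)) // exprMn invfM.
rewrite mulrCA [X in _ * (_ * X)]mulrC mulVKf ?gt_eqF //.
by rewrite mulrC -ler_pdivlMr.
Qed.

Let A_zero (z : int) : exists N0 : nat, forall N : nat, (N0 <= N)%N ->
  A (z - (N * m)%N%:Z) = 0.
Proof.
have [z0 hz] := A_supp; exists `|z - z0|.+1%N => N NN; apply: hz.
have : (N <= N * m)%N by rewrite leq_pmulr.
move: (N * m)%N => M hM; lia.
Qed.

(** [A] and [B] are the coefficients of [Z] and [G] along the line, and the reflection sends [z] to
    [del - z]. In both cases the claim is that a defect [T] vanishes at 0. *)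
Lemma line_recurrence : let j := (del %% m)%Z in
  A 0 = if j == 0 then A (del - m%:Z)
        else gam j * A (j - m%:Z) + A (del - j) - gam j * A (del - m%:Z).
Proof.
move=> j; pose d := (del %/ m)%Z.
have mZ : (m : int) != 0 by rewrite eqz_nat -lt0n.
have dE : del = d * m%:Z + j by exact: divz_eq.
have jm : 0 <= j < m%:Z by rewrite modz_ge0 //= ltz_pmod.
have jk (k : int) : ((del - 2 * (k * m%:Z)) %% m)%Z = j.
  have -> : del - 2 * (k * m%:Z) = (- 2 * k) * m%:Z + del by ring.
  by rewrite modzMDl.
case: ifPn => [/eqP j0|j0].
  (* For [j = 0] the reflection preserves the multiples of [m], and [gam 0 = -1] turns [B_rel]
     directly into the recurrence for [T]. *)
  pose T k := A (k * m%:Z) - A ((d - 1 - k) * m%:Z).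
  have T0 : forall k, T k = 0.
    apply: (@antisymmetric_solution_eq0 T (d - 1)) => [k|k|k e e0].
    - rewrite /T; have -> : d - 1 - (d - 1 - k) = k by ring.
      by rewrite opprB.
    - have := B_rel (k * m%:Z); rewrite /= jk j0 gam0 dE j0 addr0 subr0 /B.
      have -> : k * m%:Z + m%:Z = (k + 1) * m%:Z by ring.
      have -> : (k + 1) * m%:Z - m%:Z = k * m%:Z by ring.
      have -> : k * m%:Z - m%:Z = (k - 1) * m%:Z by ring.
      have -> : d * m%:Z - k * m%:Z = (d - k) * m%:Z by ring.
      have -> : (d - k) * m%:Z - m%:Z = (d - 1 - k) * m%:Z by ring.
      have -> : (d - 1 - k) * m%:Z - m%:Z = (d - 1 - (k + 1)) * m%:Z by ring.
      rewrite /T; have -> : d - 1 - (k - 1) = d - k by ring.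
      move: (A _) (A _) (A _) (A _) (A _) (A _) => a1 a2 a3 a4 a5 a6 h.
      apply/eqP; rewrite -subr_eq0; move/eqP: h; rewrite -subr_eq0 => /eqP h.
      by rewrite -[X in _ == X]h; apply/eqP; ring.
    (* Far along the line the reflected terms leave the support of [A]; what remains of
       [T k - q T (k - 1)] is a value of [B]. *)
    have [N1 h1] := decay_comb (k * m%:Z) 0 0 e0.
    have [N2 h2] := A_zero ((d - 1 - k) * m%:Z).
    have [N3 h3] := A_zero ((d - k) * m%:Z).
    exists (maxn N1 (maxn N2 N3)); set N := maxn _ _.
    have n1 : (N1 <= N)%N by rewrite leq_maxl.
    have n2 : (N2 <= N)%N by rewrite /N !leq_max leqnn orbT.
    have n3 : (N3 <= N)%N by rewrite /N !leq_max leqnn !orbT.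
    rewrite (le_trans _ (h1 N n1)) // mul0r subr0 /T /B.
    have -> : (d - 1 - (k + N%:Z)) * m%:Z = (d - 1 - k) * m%:Z - (N * m)%N%:Z.
      by rewrite PoszM; ring.
    have -> : (d - 1 - (k + N%:Z - 1)) * m%:Z = (d - k) * m%:Z - (N * m)%N%:Z.
      by rewrite PoszM; ring.
    have -> : (k + N%:Z) * m%:Z = k * m%:Z + (N * m)%N%:Z by rewrite PoszM; ring.
    have -> : (k + N%:Z - 1) * m%:Z = k * m%:Z + (N * m)%N%:Z - m%:Z.
      by rewrite PoszM; ring.
    by rewrite h2 // h3 // !subr0 lexx.
  have := T0 0; rewrite /T mul0r subr0 => /eqP; rewrite subr_eq0 => /eqP ->.
  by rewrite dE j0; congr A; ring.
have jm' : 0 < j < m%:Z by rewrite lt_def j0.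
set ga := gam j; set ga' := gam (m%:Z - j).
have gg : ga * ga' = qC by exact: gamM.
(* The reflection now exchanges the classes of 0 and [j] modulo [m], so one defect must involve both
   of them. *)
pose T k := A (k * m%:Z) - A ((d - k) * m%:Z) -
  ga * (A (j + (k - 1) * m%:Z) - A (j + (d - k - 1) * m%:Z)).
have T0 : forall k, T k = 0.
  apply: (@antisymmetric_solution_eq0 T d) => [k|k|k e e0].
  - rewrite /T; have -> : d - (d - k) = k by ring.
    by ring.
  - have e1 := B_rel (k * m%:Z); rewrite jk -/ga in e1.
    have e2 := B_rel (j + (k - 1) * m%:Z).
    (* On the class of [j] the remainder is [m - j], which brings in the second factor of
       [gam j * gam (m - j) = q]. *)
    have j2 : ((del - 2 * (j + (k - 1) * m%:Z)) %% m)%Z = m%:Z - j.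
      have -> : del - 2 * (j + (k - 1) * m%:Z) = (d - 2 * k + 1) * m%:Z + (m%:Z - j).
        by rewrite dE; ring.
      by rewrite modzMDl modz_small // subr_ge0 ltrBlDr ltrDl; move: jm' => /andP[/ltW]; lia.
    rewrite j2 -/ga' in e2.
    move: e1 e2; rewrite /= /B /T dE.
    have -> : k * m%:Z + m%:Z = (k + 1) * m%:Z by ring.
    have -> : (k + 1) * m%:Z - m%:Z = k * m%:Z by ring.
    have -> : k * m%:Z - m%:Z = (k - 1) * m%:Z by ring.
    have -> : d * m%:Z + j - k * m%:Z - j = (d - k) * m%:Z by ring.
    have -> : d * m%:Z + j - k * m%:Z = j + (d - k) * m%:Z by ring.
    have -> : j + (d - k) * m%:Z - m%:Z = j + (d - k - 1) * m%:Z by ring.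
    have -> : j + (d - k - 1) * m%:Z - m%:Z = j + (d - (k + 1) - 1) * m%:Z by ring.
    have -> : (d - k) * m%:Z - m%:Z = (d - (k + 1)) * m%:Z by ring.
    have -> : j + (k - 1) * m%:Z + m%:Z = j + (k + 1 - 1) * m%:Z by ring.
    have -> : j + (k + 1 - 1) * m%:Z - m%:Z = j + (k - 1) * m%:Z by ring.
    have -> : j + (k - 1) * m%:Z - m%:Z = j + (k - 1 - 1) * m%:Z by ring.
    have -> : d * m%:Z + j - (j + (k - 1) * m%:Z) - (m%:Z - j) = j + (d - k) * m%:Z by ring.
    have -> : d * m%:Z + j - (j + (k - 1) * m%:Z) - m%:Z = (d - k) * m%:Z by ring.
    have -> : d * m%:Z + j - (j + (k - 1) * m%:Z) = (d - (k - 1)) * m%:Z by ring.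
    have -> : j + (d - (k - 1) - 1) * m%:Z = j + (d - k) * m%:Z by ring.

    have -> : j + (d - k) * m%:Z - m%:Z = j + (d - k - 1) * m%:Z by ring.
    have -> : (d - k) * m%:Z - m%:Z = (d - (k + 1)) * m%:Z by ring.
    set a0 := A (k * m%:Z); set a1 := A ((k + 1) * m%:Z); set a2 := A ((k - 1) * m%:Z).
    set b0 := A ((d - k) * m%:Z); set b1 := A ((d - (k + 1)) * m%:Z).
    set b2 := A ((d - (k - 1)) * m%:Z).
    set c0 := A (j + (k - 1) * m%:Z); set c1 := A (j + (k + 1 - 1) * m%:Z).
    set c2 := A (j + (k - 1 - 1) * m%:Z).
    set d0 := A (j + (d - k - 1) * m%:Z); set d1 := A (j + (d - (k + 1) - 1) * m%:Z).
    set d2 := A (j + (d - k) * m%:Z).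
    rewrite -/ga -/ga'; move: a0 a1 a2 b0 b1 b2 c0 c1 c2 d0 d1 d2.
    move=> a0 a1 a2 b0 b1 b2 c0 c1 c2 d0 d1 d2.
    move=> /eqP; rewrite -subr_eq0 => /eqP e1 /eqP; rewrite -subr_eq0 => /eqP e2.
    apply/eqP; rewrite -subr_eq0; apply/eqP.
    have gq : ga * ga' - qC = 0 by rewrite gg subrr.
    (* The recurrence is [e1 - ga e2] plus a multiple of [ga ga' - q]; the three marked zeros stand
       for these vanishing quantities. *)
    transitivity (0 - ga * 0 + 0 * (b0 - qC * b1 - (b2 - qC * b0))); last by ring.
    by rewrite -{1}e1 -{1}e2 -{1}gq; ring.
  have [N1 h1] := decay_comb (k * m%:Z) (j + (k - 1) * m%:Z) ga e0.
  have [N2 h2] := A_zero ((d - k) * m%:Z).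
  have [N3 h3] := A_zero ((d - k + 1) * m%:Z).
  have [N4 h4] := A_zero (j + (d - k - 1) * m%:Z).
  have [N5 h5] := A_zero (j + (d - k) * m%:Z).
  exists (N1 + N2 + N3 + N4 + N5)%N; set N := (_ + N5)%N.
  have n1 : (N1 <= N)%N by rewrite /N; lia.
  have n2 : (N2 <= N)%N by rewrite /N; lia.
  have n3 : (N3 <= N)%N by rewrite /N; lia.
  have n4 : (N4 <= N)%N by rewrite /N; lia.
  have n5 : (N5 <= N)%N by rewrite /N; lia.
  rewrite (le_trans _ (h1 N n1)) // /T /B.
  have -> : (k + N%:Z) * m%:Z = k * m%:Z + (N * m)%N%:Z by rewrite PoszM; ring.
  have -> : (d - (k + N%:Z)) * m%:Z = (d - k) * m%:Z - (N * m)%N%:Z.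
    by rewrite PoszM; ring.
  have -> : j + (k + N%:Z - 1) * m%:Z = j + (k - 1) * m%:Z + (N * m)%N%:Z.
    by rewrite PoszM; ring.
  have -> : j + (d - (k + N%:Z) - 1) * m%:Z = j + (d - k - 1) * m%:Z - (N * m)%N%:Z.
    by rewrite PoszM; ring.
  have -> : (k + N%:Z - 1) * m%:Z = k * m%:Z + (N * m)%N%:Z - m%:Z.
    by rewrite PoszM; ring.
  have -> : (d - (k + N%:Z - 1)) * m%:Z = (d - k + 1) * m%:Z - (N * m)%N%:Z.
    by rewrite PoszM; ring.
  have -> : j + (k + N%:Z - 1 - 1) * m%:Z = j + (k - 1) * m%:Z + (N * m)%N%:Z - m%:Z.
    by rewrite PoszM; ring.
  have -> : j + (d - (k + N%:Z - 1) - 1) * m%:Z = j + (d - k) * m%:Z - (N * m)%N%:Z.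
    by rewrite PoszM; ring.
  rewrite h2 // h3 // h4 // h5 //.
  move: (A _) (A _) (A _) (A _) => a1 a2 a3 a4.
  by rewrite le_eqVlt; apply/orP; left; apply/eqP; congr (_ * modc _); ring.
have := T0 0; rewrite /T mul0r subr0 sub0r dE => /eqP; rewrite subr_eq0 => /eqP.
have -> : j + (-1) * m%:Z = j - m%:Z by ring.
have -> : d * m%:Z + j - j = d * m%:Z by ring.
have -> : d * m%:Z + j - m%:Z = j + (d - 1) * m%:Z by ring.
move=> /eqP; rewrite subr_eq => /eqP ->; ring.
Qed.

End LineRecurrence.

(** Cauchy's inequality: [B] bounds [G] on the torus and serves all exponents. *)
Lemma laurent_coef_bound (R : realType) (r : nat) (Y : set 'rV[cplx R]_r)
    (G : 'rV[cplx R]_r -> cplx R) (M : nat) (rho : 'I_r -> R) (i : 'I_r) :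
  (0 < M)%N -> (forall x, Y x -> {for x, continuous G}) ->
  (forall k, 0 < rho k) -> (forall v, Y (torus_pt rho v)) ->
  exists2 B : R, 0 <= B & forall lam b,
    (fun N => laurent_avg G M lam N rho) @ \oo --> b ->
    modc b <= B * modc (mono (torus_pt rho (fun=> 0)) (- lam)).
Proof.
move=> M0 Gc rho0 Yrho; pose t := ln (rho i).
have updE : upd rho i (expR (t + 0 * (t - t))) = rho.
  apply/funext => k; rewrite mul0r addr0 lnK ?posrE // /upd.
  by case: eqP => [->|].
(* The torus is treated as an annulus whose two radii coincide. *)
have [w w01|B hB] := @annulus_bounded R r rho i t t G.
  by apply: Gc; rewrite subrr mulr0 -(mul0r (t - t)) updE.
have bnd v : unit_box v -> modc (G (torus_pt rho v)) <= B.
  move=> v01; pose w (k : option 'I_r) := if k is Some k' then v k' else 0.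
  have w01 : unit_box w by case=> [k|] //=; rewrite lexx ler01.
  by have := hB w w01; rewrite /= updE.
have B0 : 0 <= B.
  have z01 : @unit_box R 'I_r (fun=> 0) by move=> k; rewrite lexx ler01.
  exact: le_trans (modc_ge0 _) (bnd _ z01).
exists B => // lam b /cvg_modcP hb; apply/ler_addgt0Pr => e e0.
have [N _ /(_ N (leqnn N)) /= hN] := hb e e0.
rewrite -[b](subrK (laurent_avg G M lam N rho)) (le_trans (modcD _ _)) // addrC.
rewrite lerD // 1?modcB //.
apply: modc_torus_avg; first by rewrite muln_gt0 M0 expn_gt0.
move=> v v01; rewrite modcM mulrC ler_pM ?modc_ge0 ?bnd //.
by rewrite !modc_mono; under eq_bigr do rewrite modc_torus_pt;
  under [leRHS]eq_bigr do rewrite modc_torus_pt.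
Qed.

(** * Conclusion: specialization to the line through [lam] *)

Theorem proposition4p4 (R : realType) (r : nat) (D : root_datum R r)
    (n : nat) (hn : (2 <= n)%N)
    (q : R) (hq : 1 < q)
    (g : int -> cplx R)
    (g_mod : forall s t : int, (s = t %[mod n])%Z -> g s = g t)
    (g_0 : g 0 = -1)
    (g_mul : forall t : int, ~~ (n %| t)%Z -> g t * g (- t) = (q%:C)%C)
    (omega : hdual D) (l : 'I_r -> nat)
    (homega : forall i, pairing omega i = (l i)%:R)
    (Y : set 'rV[cplx R]_r) (hY : hypothesis_A D n q Y)
    (Z : 'rV[cplx R]_r -> cplx R)
    (Z_mero : meromorphic_on Y Z)
    (Z_inv : cg_invariant D n q g l Y Z)
    (DZ_hol : DZ_holomorphic D n q Y Z)
    (a : 'rV[int]_r -> cplx R)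
    (a_supp : forall lam, ~ Qplus lam -> a lam = 0)
    (Z_taylor : taylor_at0 Y Z a)
    (i : 'I_r) (lam : 'rV[int]_r) :
  let m : int := (multi D n i)%:Z in
  let li : int := (l i)%:Z in
  let qi : int := qQ D (alphaQ i) in
  let j : int := (delta D l i lam %% m)%Z in
  a lam =
    if j == 0 then a (sreflQ D i lam + (li + 1 - m) *: alphaQ i)
    else g (- j * qi) * a (lam + (j - m) *: alphaQ i)
         + a (sreflQ D i lam + (li + 1 - j) *: alphaQ i)
         - g (- j * qi) * a (sreflQ D i lam + (li + 1 - m) *: alphaQ i).
Proof.
move=> m li qi.
have [_ _ _ /(_ i)[Yi [Yi_sub [Yi_open Yi_conn Yi_rein Yi0] YiP Yi_sigma]]] := hY.
have P_cvg x (Yx : Yi x) := (YiP x Yx).1; have P_neq0 x (Yx : Yi x) := (YiP x Yx).2.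
have [D_cvg [F [F_holo [T [T_open TY YT TF]]]]] := DZ_hol.
have n_gt0 : (0 < n)%N by exact: leq_trans hn.
have m_gt0 := multi_gt0 D i n_gt0.
pose G := reduced_numerator D n q F i.
pose b := numerator_coef D n q a i.
have Gc x : Yi x -> {for x, continuous G}.
  exact: (@reduced_numerator_continuous R r D n q Y F i Yi).
have Ga rho : (forall k, 0 < rho k) -> Yi (torus_pt rho (fun=> 0)) ->
    forall e : R, 0 < e -> exists H : 'rV[cplx R]_r -> cplx R,
    (forall x, Yi x -> differentiable H x) /\
    forall x, Yi x -> (forall k, modc (x 0 k) <= rho k) ->
      modc (G x - H x) <= e * modc (G x).
  exact: (@reduced_numerator_approx R r D n q Y F i Yi).
have cvgb rho mu : (forall k, 0 < rho k) -> Yi (torus_pt rho (fun=> 0)) ->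
    (fun N => laurent_avg G (multi D n i) mu N rho) @ \oo --> b mu.
  move=> rho0 Yrho; apply/cvg_modcP => e e0.
  have [d0 d00 near0] := @laurent_avg_near0 R r D n q Y Z F a i Yi Yi_sub Yi_open
    Yi_rein P_cvg P_neq0 D_cvg F_holo T YT TF Yi0 Z_taylor a_supp m_gt0 mu.
  have [N0 hN0] := @laurent_avg_cvg R r Yi G (multi D n i) mu m_gt0 Yi_open Yi_conn
    Yi_rein Gc Ga (b mu) d0 rho d00 Yi0 near0 rho0 Yrho e e0.
  by exists N0.
have q_gt0 : 0 < q by exact: lt_trans ltr01 hq.
(* The bound [1 / (2 q)] serves twice: [q |x_i| < 1] on the torus of radius [t], and
   [|x_i| = 1 / t >= 2 q] on its reflection. *)
have [t [t0 tq tY]] : exists t : R, [/\ 0 < t, t <= (2 * q)^-1 &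
    forall v, Yi (torus_pt (fun=> t) v)].
  have /nbhs_rVP[del del0 hdel] := Yi_open _ Yi0.
  have q2 : 0 < (2 * q)^-1 by rewrite invr_gt0 mulr_gt0.
  exists (Num.min (del / 2) (2 * q)^-1); split.
  - by rewrite lt_min q2 divr_gt0.
  - by rewrite ge_min lexx orbT.
  move=> v; apply: hdel => k; rewrite [X in _ - X]mxE subr0 modc_torus_pt gtr0_norm.
    by rewrite gt_min ltr_pdivrMr // ltr_pMr // ltr1n.
  by rewrite lt_min q2 divr_gt0.
pose rho : 'I_r -> R := fun=> t.
have rho0 k : 0 < rho k by [].
pose rho' := refl_radii D i rho.
have rho'0 : forall k, 0 < rho' k by exact: refl_radii_gt0.
have rho'Y v : Yi (torus_pt rho' v).
  have Y0 : Yi (torus_pt rho' (fun=> 0)).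
    by rewrite -sigma_pt_torus; apply: (Yi_sigma _ (tY _)); exact: torus_pt_neq0.
  have /nbhs_rVP[del del0 hdel] := Yi_open _ Y0.
  apply: reinhardt_hull Yi_rein hdel _.
  exact: torus_pt_near rho'0 erefl _ del0.
have [B B0 hB] := laurent_coef_bound i m_gt0 Gc rho'0 rho'Y.
have xq v : modc (torus_pt rho v 0 i) * q < 1.
  rewrite modc_torus_pt gtr0_norm // (le_lt_trans (ler_wpM2r (ltW q_gt0) tq)) //.
  by rewrite invfM mulfVK ?gt_eqF // invf_lt1 // ltr1n.
have FE v := @functional_equation R r D n q g l Y Z i Yi hq m_gt0 Yi_sub Yi_open
  Yi_rein Yi_sigma (Z_inv i) T G T_open YT Gc
  (@reduced_numeratorE R r D n q Y Z F i Yi Yi_sub P_neq0 D_cvg T TF)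
  (torus_pt rho v) (tY v) (torus_pt_neq0 v i rho0) (xq v).
have rel := @coefficient_relation R r D n q g l G i b rho m_gt0 rho0
  (fun mu => cvgb rho mu rho0 (tY _)) (fun mu => cvgb rho' mu rho'0 (rho'Y _)).
have {}rel := rel FE g_mod n_gt0.
pose A (z : int) : cplx R := a (lam + z *: alphaQ i).
pose gam (z : int) := g (- z * qi).
pose del := delta D l i lam.
have Bb z : A z - (q%:C)%C * A (z - m) = b (lam + z *: alphaQ i).
  by rewrite /A /b /numerator_coef scalerBl addrA.
have s_line z : sreflQ D i (lam + z *: alphaQ i) + (li + 1) *: alphaQ i =
    lam + (del - z) *: alphaQ i.
  rewrite sreflQE pairQD pairQZ pairQ_alpha_self -!addrA -!scalerDl.
  by congr (_ + _ *: _); rewrite /del /delta; ring.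
have A_supp : exists z0 : int, forall z, z < z0 -> A z = 0.
  exists (- lam 0 i) => z hz; apply: a_supp => /(_ i).
  by rewrite !mxE !eqxx mulr1 leNgt -ltrBrDl sub0r hz.
have B_decay z : exists K : R, forall k : nat,
    modc (A (z + (k * multi D n i)%N%:Z) -
      (q%:C)%C * A (z + (k * multi D n i)%N%:Z - m)) <= K / (2 * q) ^+ k.
  set y : 'rV[cplx R]_r := torus_pt rho' (fun=> 0).
  have y0 k : y 0 k != 0 by exact: torus_pt_neq0.
  have q2 : 0 < 2 * q by rewrite mulr_gt0.
  have yi : 2 * q <= modc (y 0 i) ^+ multi D n i.
    rewrite modc_torus_pt gtr0_norm // /rho' /refl_radii pairQ_alpha_self.
    have -> : rho i * rho i ^ (- 2) = t^-1.
      by rewrite /rho -exprnN expr2 invfM mulrA divff ?mul1r // gt_eqF.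
    have t2 : 2 * q <= t^-1 by rewrite -[leLHS]invrK lef_pV2 ?posrE ?invr_gt0.
    rewrite (le_trans t2) // -[leLHS]expr1 ler_weXn2l //.
    by rewrite (le_trans _ t2) //; lra.
  (* Cauchy's inequality on the reflected torus; the remaining factor [|y_i| ^ (- k m)] is at most
     [(2 q) ^ - k]. *)
  exists (B * modc (mono y (- (lam + z *: alphaQ i)))) => k.
  rewrite Bb (le_trans (hB _ _ (cvgb _ _ rho'0 (rho'Y _)))) //.
  rewrite -mulrA ler_wpM2l // scalerDl addrA opprD monoD // modcM.
  rewrite ler_wpM2l ?modc_ge0 // monoN monoZ_alpha modcV -exprnP modcX mulnC exprM.
  have yk : (2 * q) ^+ k <= (modc (y 0 i) ^+ multi D n i) ^+ k.
    by rewrite lerXn2r // nnegrE ?(ltW q2) // (le_trans (ltW q2) yi).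
  have qk : 0 < (2 * q) ^+ k by rewrite exprn_gt0.
  by rewrite lef_pV2 ?posrE // (lt_le_trans qk yk).
have B_rel z : let j := ((del - 2 * z) %% m)%Z in
    A z - (q%:C)%C * A (z - m) - (q%:C)%C * (A (z + m) - (q%:C)%C * A (z + m - m)) =
    (1 - (q%:C)%C) * (A (del - z - j) - (q%:C)%C * A (del - z - j - m)) -
    gam j * (A (del - z - m) - (q%:C)%C * A (del - z - m - m)
      - (A (del - z) - (q%:C)%C * A (del - z - m))).
  rewrite /= !Bb; have := rel (lam + z *: alphaQ i); rewrite /= s_line.
  have -> : delta D l i (lam + z *: alphaQ i) = del - 2 * z.
    by rewrite /del /delta pairQD pairQZ pairQ_alpha_self; ring.
  have vD u w : lam + (u + w) *: alphaQ i = lam + u *: alphaQ i + w *: alphaQ i.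
    by rewrite scalerDl addrA.
  have vB u w : lam + (u - w) *: alphaQ i = lam + u *: alphaQ i - w *: alphaQ i.
    by rewrite scalerBl addrA.
  by rewrite /gam (vD z m) (vB (del - z) m) (vB (del - z) ((del - 2 * z) %% m)%Z).
have gam0 : gam 0 = -1 by rewrite /gam oppr0 mul0r.
(* Modulo [n], [- (m - j) q(alpha_i)] is [j q(alpha_i)], and this is nonzero because [m] is the
   order of [q(alpha_i)]. *)
have gamM j : 0 < j < m -> gam j * gam (m - j) = (q%:C)%C.
  move=> /andP[j0 jm]; rewrite -(g_mul (- j * qi)).
    congr (_ * _); apply: g_mod; apply/eqP; rewrite eqz_mod_dvd.
    have -> : - (m - j) * qi - - (- j * qi) = - m * qi by ring.
    by rewrite dvd_multiM // rpredN dvdzz.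
  rewrite dvd_multiM // rpredN; apply/negP => /dvdzP[k jk].
  have m0 : 0 < m by rewrite ltz_nat.
  by move: j0 jm; rewrite jk pmulr_lgt0 // gtr_pMl //; lia.
have := @line_recurrence R q hq A (multi D n i) del gam m_gt0 A_supp B_decay B_rel
  gam0 gamM.
rewrite /A scale0r addr0 /= => ->; rewrite -/m.
have sE z : lam + (del - z) *: alphaQ i =
    sreflQ D i lam + (li + 1 - z) *: alphaQ i.
  rewrite sreflQE -[RHS]addrA -scalerDl; congr (_ + _ *: _).
  by rewrite /del /delta; ring.
by rewrite !sE.
Qed.
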